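(* Let $\mu$ be a Borel probability measure on $\mathbb{S}$, let $w_0\in\mathbb{B}$, and let $\lambda_{\min}$ denote the smallest eigenvalue of $-\nabla F_\mu(w_0)$. Suppose $\lambda_{\min}>0$. Let $(w_k)_{k\ge 0}$ be the iterates, started at $w_0$, of either the Newton iteration (N) or the shifted Newton iteration (S) described in the context, and let $\mu_k = (\sigma_{w_k})_{\#}\mu$. Suppose that $$ q := 4\,|F_\mu(w_0)|_g/\lambda_{\min}^2 < 1 .$$ Then there exists a conformal barycenter $w_*(\mu)\in\mathbb{B}$ of $\mu$, the measure $\mu_* := (\sigma_{w_*(\mu)})_{\#}\mu$ satisfies $\int_{\mathbb{S}} x \,\mathrm{d}\mu_*(x)=0$, and the iterates $w_k$ and $\mu_k$ converge with $$ d_g(w_k,w_*(\mu)) \le \tfrac12\,\lambda_{\min}\, q^{(2^k)} \quad\text{and}\quad W_p(\mu_k,\mu_* ) \le \lambda_{\min}\, q^{(2^k)} $$ for all $k\ge 0$, where $W_p$ denotes the $p$-Wasserstein distance, $p\in[1,\infty]$.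
   Context: Let $H$ be a real Hilbert space (possibly infinite-dimensional) with inner product $\langle\cdot,\cdot\rangle$ and norm $|\cdot|$. $\mathbb{B}=\{z\in H: |z|<1\}$ is the Poincaré ball with Riemannian metric $g|_w(X,Y)=\frac{4}{(1-|w|^2)^2}\langle X,Y\rangle$ for $X,Y\in T_w\mathbb{B}\cong H$; $|X|_g=\sqrt{g|_w(X,X)}$, $d_g$ is the geodesic distance, $\exp$ the Riemannian exponential map (in particular $\exp_0(u)=\frac{\tanh|u|}{|u|}u$, $\exp_0(0)=0$), and $\nabla$ the Levi-Civita covariant derivative of $g$; $X^\flat=g(X,\cdot)$. $\mathbb{S}=\{x\in H:|x|=1\}$ with angular distance $d_{\mathbb{S}}(x,y)=\arccos\langle x,y\rangle$. Director: for $w\in\mathbb{B}$, $x\in\mathbb{S}$, $V_x(w)\in T_w\mathbb{B}$ is the unique tangent vector with $|V_x(w)|_g=1$ and $\lim_{t\to\infty}\exp_w(tV_x(w))=x$ (limit in $H$). Explicitly $V_x(w)=\frac12\,\frac{(1-|w|^2)^2x-2(1-|w|^2)(1-\langle w,x\rangle)w}{1-2\langle w,x\rangle+|w|^2}$. For a Borel probability measure $\mu$ on $\mathbb{S}$, $F_\mu(w)=\int_{\mathbb{S}}V_x(w)\,\mathrm{d}\mu(x)$; a conformal barycenter of $\mu$ is a point $w\in\mathbb{B}$ with $F_\mu(w)=0$. One has $\nabla F_\mu(w)=\int_{\mathbb{S}}V_x(w)\otimes V_x(w)^\flat\,\mathrm{d}\mu(x)-\mathrm{id}_{T_w\mathbb{B}}$,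 a self-adjoint endomorphism of $(T_w\mathbb{B},g|_w)$. The ''smallest eigenvalue'' of the self-adjoint operator $-\nabla F_\mu(w)$ means $\inf\{ g(-\nabla F_\mu(w)X,X): |X|_g=1\}$. Shift transformation: $\sigma(w,z)=\sigma_w(z)=\frac{(1-|w|^2)z-(1+|z|^2-2\langle w,z\rangle)w}{1-2\langle w,z\rangle+|w|^2|z|^2}$ for $w\in\mathbb{B}$, $z\in\mathbb{B}\cup\mathbb{S}$; it restricts to an isometry of $(\mathbb{B},g)$ and to a map $\mathbb{S}\to\mathbb{S}$. $(\sigma_w)_{\#}\mu$ is the push-forward measure. (N) Newton iteration: $v_k=-\nabla F_\mu(w_k)^{-1}F_\mu(w_k)$, $w_{k+1}=\exp_{w_k}(v_k)$. (S) Shifted Newton iteration: $\mu_k=(\sigma_{w_k})_{\#}\mu$, $u_k=-\nabla F_{\mu_k}(0)^{-1}F_{\mu_k}(0)$, $w_{k+1}=\sigma(-w_k,\exp_0(u_k))$. Wasserstein distance (with respect to $d_{\mathbb{S}}$): $W_p(\mu_1,\mu_2)=\inf_\gamma\big(\iint d_{\mathbb{S}}(y,z)^p\,\mathrm{d}\gamma(y,z)\big)^{1/p}$ for $1\le p<\infty$ and $W_\infty(\mu_1,\mu_2)=\inf_\gamma\operatorname{ess\,sup}_{(y,z)\in\operatorname{supp}\gamma}d_{\mathbb{S}}(y,z)$, where $\gamma$ runs over all probability measures on $\mathbb{S}\times\mathbb{S}$ with marginals $\mu_1$ and $\mu_2$. *)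

(* Defs.v *)
From HB Require Import structures.
From mathcomp Require Import all_boot all_order all_algebra.
From mathcomp Require Import all_classical all_reals all_analysis.

Set Implicit Arguments.
Unset Strict Implicit.
Unset Printing Implicit Defensive.

Import Order.TTheory GRing.Theory Num.Theory.
Import numFieldNormedType.Exports.

Local Open Scope classical_set_scope.
Local Open Scope ring_scope.

(* A real Hilbert space is a complete normed space [H] together with a bilinear
   form satisfying this predicate. *)
Definition inner_product (R : realType) (H : normedModType R)
    (ip : H -> H -> R) : Prop :=
  [/\ forall x y, ip x y = ip y x,
      forall x y z, ip (x + y) z = ip x z + ip y z,
      forall a x y, ip (a *: x) y = a * ip x y &
      forall x, ip x x = `|x| ^+ 2].

Notation borel T := (g_sigma_algebraType (@open T)).

Section HilbertBall.
Context {R : realType} {H : completeNormedModType R}.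
Variable ip : H -> H -> R.

Definition poincare_ball : set H := [set z | `|z| < 1].
Definition sphere : set H := [set x | `|x| = 1].

Definition metric (w X Y : H) : R := 4 / (1 - `|w| ^+ 2) ^+ 2 * ip X Y.
Definition metric_norm (w X : H) : R := Num.sqrt (metric w X X).

(* Christoffel form of the Levi-Civita connection in the global chart given by
   the inclusion of the ball in [H]: this is the Koszul formula for the constant
   vector fields [X], [Y], [Z], whose Lie brackets vanish. *)
Definition is_christoffel (w X Y G : H) : Prop :=
  forall Z, 2 * metric w G Z =
    'D_X (fun u => metric u Y Z) w + 'D_Y (fun u => metric u X Z) w
    - 'D_Z (fun u => metric u X Y) w.
Definition christoffel (w X Y : H) : H := xget 0 (is_christoffel w X Y).

(* The value of nabla_X Y at [w]. *)
Definition covariant_derivative (Y : H -> H) (w X : H) : H :=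
  'D_X Y w + christoffel w X (Y w).

Definition geodesic (c : R -> H) : Prop :=
  forall t, [/\ poincare_ball (c t), derivable c t 1, derivable (derive1 c) t 1 &
    derive1 (derive1 c) t + christoffel (c t) (derive1 c t) (derive1 c t) = 0].

Definition expmap (w v : H) : H :=
  xget 0 [set z | exists c, [/\ geodesic c, c 0 = w, derive1 c 0 = v & c 1 = z]].

Definition C1_curve (x y : H) (c : R -> H) : Prop :=
  [/\ c 0 = x, c 1 = y,
      forall t, t \in `[0, 1] -> poincare_ball (c t) /\ derivable c t 1 &
      {within `[0, 1], continuous derive1 c}].

Definition curve_length (c : R -> H) : \bar R :=
  \int[lebesgue_measure]_(t in `[0, 1]) (metric_norm (c t) (derive1 c t))%:E.

(* Extended-real valued, so that it is +oo when a point lies outside the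
   ball. *)
Definition geodesic_distance (x y : H) : \bar R :=
  ereal_inf [set curve_length c | c in C1_curve x y].

Definition director (x w : H) : H :=
  xget 0 [set v | metric_norm w v = 1 /\ expmap w (t *: v) @[t --> +oo] --> x].

(* A Borel measure on the sphere is represented by the Borel measure on [H]
   that it induces; measures occur as set functions, because [pushforward] is
   one. *)

(* The weak (Pettis) integral over the sphere; for bounded continuous integrands
   it exists by Riesz representation, also when [H] is not separable, and it is
   the Bochner integral when the latter exists. *)
Definition is_integral (mu : set (borel H) -> \bar R) (f : H -> H) (I : H) :
    Prop :=
  forall y, (\int[mu]_(x in sphere) (ip (f x) y)%:E = (ip I y)%:E)%E.
Definition hintegral (mu : set (borel H) -> \bar R) (f : H -> H) : H :=
  xget 0 (is_integral mu f).

Definition Fmu (mu : set (borel H) -> \bar R) (w : H) : H :=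
  hintegral mu (fun x => director x w).

Definition conformal_barycenter (mu : set (borel H) -> \bar R) (w : H) : Prop :=
  poincare_ball w /\ Fmu mu w = 0.

Definition nablaF (mu : set (borel H) -> \bar R) (w X : H) : H :=
  covariant_derivative (Fmu mu) w X.

Definition lambda_min (mu : set (borel H) -> \bar R) (w : H) : R :=
  inf [set metric w (- nablaF mu w X) X | X in [set X | metric_norm w X = 1]].

Definition sigma (w z : H) : H :=
  (1 - 2 * ip w z + `|w| ^+ 2 * `|z| ^+ 2)^-1 *:
  ((1 - `|w| ^+ 2) *: z - (1 + `|z| ^+ 2 - 2 * ip w z) *: w).

Definition shifted_measure (mu : set (borel H) -> \bar R) (w : H) :
    set (borel H) -> \bar R :=
  pushforward mu (sigma w : borel H -> borel H).

Definition op_inverse (A : H -> H) (y : H) : H := xget 0 [set x | A x = y].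

Variant newton_scheme := Newton | ShiftedNewton.

(* The operator inverted in one step from [w]. *)
Definition newton_operator (s : newton_scheme) (mu : set (borel H) -> \bar R)
    (w : H) : H -> H :=
  match s with
  | Newton => nablaF mu w
  | ShiftedNewton => nablaF (shifted_measure mu w) 0
  end.

Definition newton_step (s : newton_scheme) (mu : set (borel H) -> \bar R)
    (w : H) : H :=
  match s with
  | Newton =>
      expmap w (- op_inverse (newton_operator Newton mu w) (Fmu mu w))
  | ShiftedNewton =>
      sigma (- w) (expmap 0
        (- op_inverse (newton_operator ShiftedNewton mu w) (Fmu (shifted_measure mu w) 0)))
  end.

Definition newton_iterate (s : newton_scheme) (mu : set (borel H) -> \bar R)
    (w0 : H) (k : nat) : H :=
  iter k (newton_step s mu) w0.

Definition angular_distance (x y : H) : R := acos (ip x y).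

(* Couplings are Borel measures for the product topology: if [H] is not
   separable, the product sigma-algebra may be strictly smaller. *)
Definition coupling (mu1 mu2 : set (borel H) -> \bar R)
    (gamma : probability (borel (H * H)%type) R) : Prop :=
  forall A : set (borel H), measurable A ->
    gamma (fst @^-1` A) = mu1 A /\ gamma (snd @^-1` A) = mu2 A.

Definition angular_cost (yz : borel (H * H)%type) : \bar R :=
  (angular_distance yz.1 yz.2)%:E.

(* ['N[gamma]_+oo[f]] is the essential supremum of [f]. *)
Definition wasserstein (p : \bar R) (mu1 mu2 : set (borel H) -> \bar R) :
    \bar R :=
  ereal_inf [set ('N[gamma]_p[angular_cost])%E | gamma in coupling mu1 mu2].

End HilbertBall.

(* Main.v *)
(* For a unit vector [x], the director at [w] is [(1 - |w|^2) / 2] times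
   [sigma w x].  Hence, with [m w] and [M w] the mean and the second moment
   operator of [(sigma w)_# mu], one gets [|F w|_g = |m w|] and
   [nabla F w = M w - id], and both schemes perform the same step: the geodesic
   step of length [s] in direction [e], where [(id - M w) (s e) = m w].  Seen from
   [w], it is a boost [y (t)] of the points [y = sigma w x], along which
   [y' = <e, y> y - e].  Since [|y''| <= 1] and [<y, X>^2] has derivative at most
   [|X|^2], this gives [|m w'| <= s^2 / 2], and the lower bound of [id - M]
   decreases by at most [s].  The base point [w'] is reached from this picture by
   a rotation, which is avoided: [m] and the bound of [M] depend only on the Gram
   kernel [<sigma w' x, sigma w' x'>].  The step lengths therefore satisfy
   [s_k <= lambda (q / 4)^(2^k)], and their tails are summed.  Finally
   [w |-> sigma w x] is [2]-Lipschitz from the hyperbolic metric to the norm of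
   [H], and the push-forward of [mu] by [(sigma w_k, sigma ws)], where [ws] is the limit, is a coupling. *)
Require Import Defs.
From HB Require Import structures.
From mathcomp Require Import all_boot all_order all_algebra.
From mathcomp Require Import all_classical all_reals all_analysis.
From mathcomp Require Import measurable_realfun ess_sup_inf ring lra.
Import Order.TTheory GRing.Theory Num.Theory.
Import numFieldNormedType.Exports.
Set Implicit Arguments.
Unset Strict Implicit.
Unset Printing Implicit Defensive.
Local Open Scope classical_set_scope.
Local Open Scope ring_scope.

(** Christoffel forms, exponential map, directors, integrals and inverses are all picked by [xget]
    from defining predicates, so no formula is available before existence and, where the value
    matters, uniqueness are proved. For geodesics both come from the hyperboloid: there the
    nonlinear equation splits into scalar equations [p'' = s^2 p] with explicit solutions. In
    infinite dimension neither compactness nor a rank argument is at hand; weak integrals and the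
    inverse of the Newton operator both come from minimising a quadratic energy. Vector estimates
    are paired with a vector and become real estimates, which suits integrals that are only weak.
    Hyperbolic distance is handled through its cosine [coshdist], whose triangle inequality is
    algebraic; the infimum of lengths only has to be bounded above. The constants: all steps
    together have length at most [lambda / 3], so [2 / 3] of the coercivity survives, and
    [s^2 / 2 <= 2 / 3 * s^2] closes the induction. The same third pays for the Wasserstein bound,
    which loses a factor 2 (Lipschitz constant) times [3 / 2] (arc over chord). *)

Section InnerProduct.
Context {R : realType} {H : normedModType R} (ip : H -> H -> R).
Hypothesis ip_inner : inner_product ip.

Lemma ipC x y : ip x y = ip y x. Proof. by case: ip_inner. Qed.
Lemma ipDl x y z : ip (x + y) z = ip x z + ip y z. Proof. by case: ip_inner. Qed.
Lemma ipZl a x y : ip (a *: x) y = a * ip x y. Proof. by case: ip_inner. Qed.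
Lemma ipxx x : ip x x = `|x| ^+ 2. Proof. by case: ip_inner. Qed.
Lemma ipDr x y z : ip x (y + z) = ip x y + ip x z.
Proof. by rewrite ipC ipDl !(ipC x). Qed.
Lemma ipZr a x y : ip x (a *: y) = a * ip x y.
Proof. by rewrite ipC ipZl ipC. Qed.
Lemma ipNl x y : ip (- x) y = - ip x y.
Proof. by rewrite -scaleN1r ipZl mulN1r. Qed.
Lemma ipNr x y : ip x (- y) = - ip x y.
Proof. by rewrite ipC ipNl ipC. Qed.
Lemma ip0l y : ip 0 y = 0. Proof. by rewrite -(scale0r 0) ipZl mul0r. Qed.
Lemma ip0r y : ip y 0 = 0. Proof. by rewrite ipC ip0l. Qed.
Definition ipE := (ipDl, ipDr, ipNl, ipNr, ipZl, ipZr, ip0l, ip0r).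

Lemma ip_ge0 x : 0 <= ip x x. Proof. by rewrite ipxx sqr_ge0. Qed.
Lemma ip_eq0 x : ip x x = 0 -> x = 0.
Proof. by rewrite ipxx => /eqP; rewrite sqrf_eq0 normr_eq0 => /eqP. Qed.
Lemma ip_inj x y : (forall z, ip x z = ip y z) -> x = y.
Proof.
move=> h; apply/eqP; rewrite -subr_eq0; apply/eqP/ip_eq0.
by rewrite ipDl ipNl h subrr.
Qed.

Lemma ip_sqr_le x y : ip x y ^+ 2 <= ip x x * ip y y.
Proof.
have [->|y0] := eqVneq y 0; first by rewrite !ipE expr0n mulr0.
have yy : 0 < ip y y by rewrite ipxx exprn_gt0// normr_gt0.
have := ip_ge0 (x - (ip x y / ip y y) *: y).
rewrite !ipE (ipC y x) => h; rewrite -subr_ge0.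
have -> : ip x x * ip y y - ip x y ^+ 2 = (ip x x - 2 * (ip x y / ip y y) * ip x y
    + (ip x y / ip y y) ^+ 2 * ip y y) * ip y y.
  by field; rewrite gt_eqF.
by rewrite pmulr_lge0//; apply: le_trans h _; rewrite le_eqVlt; apply/orP; left; apply/eqP; ring.
Qed.

Lemma cauchy_schwarz x y : `|ip x y| <= `|x| * `|y|.
Proof.
rewrite -(@ler_pXn2r _ 2)// ?nnegrE ?mulr_ge0//.
by rewrite exprMn real_normK ?num_real// -!ipxx ip_sqr_le.
Qed.
Lemma ip_le x y : ip x y <= `|x| * `|y|.
Proof. exact: le_trans (ler_norm _) (cauchy_schwarz x y). Qed.

(** Recurring device: to bound a vector [d], bound the scalar [ip d d] by treating one copy of [d]
    as a fixed test vector, so that the mean value theorem and real integrals apply to the other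
    copy. *)
Lemma norm_le_ip x c : 0 <= c -> ip x x <= c * `|x| -> `|x| <= c.
Proof.
move=> c0; rewrite ipxx expr2; have [->//|x0] := eqVneq x 0.
  by rewrite normr0.
by rewrite ler_pM2r// normr_gt0.
Qed.

Lemma polarization x y : ip x y = (`|x + y| ^+ 2 - `|x - y| ^+ 2) / 4.
Proof. by rewrite -!ipxx !ipE (ipC y x); field. Qed.

(** [ip] is a bare function with algebraic laws; polarization transfers continuity to it from the
    norm. *)
Lemma cvg_ip (T : Type) (F : set_system T) (FF : Filter F) (f g : T -> H) a b :
  f @ F --> a -> g @ F --> b -> (fun t => ip (f t) (g t)) @ F --> ip a b.
Proof.
move=> fa gb; rewrite (polarization a b).
rewrite (_ : (fun t => _) =
  (fun t => (`|f t + g t| ^+ 2 - `|f t - g t| ^+ 2) / 4)); last first.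
  by apply/funext => t; exact: polarization.
apply: cvgMr_tmp; rewrite !expr2.
by apply: cvgB; apply: cvgM; apply: cvg_norm; [apply: cvgD..|apply: cvgB|apply: cvgB].
Qed.

Lemma cvg_line (V : normedModType R) (v a : V) :
  (fun h : R => h *: v + a) @ 0^' --> a.
Proof.
rewrite -[X in _ --> X]add0r -[X in X + a](scale0r v).
by apply: cvgD; [apply: cvgZr_tmp; exact: cvg_within|exact: cvg_cst].
Qed.

Lemma is_derive_ip (c d : R -> H) c' d' t :
  is_derive (t : R) (1 : R) c c' -> is_derive (t : R) (1 : R) d d' ->
  is_derive (t : R) (1 : R) (fun u => ip (c u) (d u)) (ip c' (d t) + ip (c t) d').
Proof.
move=> [dc <-] [dd <-].
suff h : h^-1 *: (ip (c (h *: 1 + t)) (d (h *: 1 + t)) - ip (c t) (d t))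
    @[h --> 0^'] --> ip ('D_1 c t) (d t) + ip (c t) ('D_1 d t).
  split; first by apply/cvg_ex; exists (ip ('D_1 c t) (d t) + ip (c t) ('D_1 d t)).
  exact: cvg_lim.
have -> : (fun h : R => h^-1 *: (ip (c (h *: 1 + t)) (d (h *: 1 + t)) - ip (c t) (d t)))
  = (fun h => ip (h^-1 *: (c (h *: 1 + t) - c t)) (d (h *: 1 + t)) +
              ip (c t) (h^-1 *: (d (h *: 1 + t) - d t))).
  by apply/funext => h; rewrite !ipE -[_ *: _]/(_ * _); ring.
apply: cvgD; apply: cvg_ip => //; last exact: cvg_cst.
have /differentiable_continuous : differentiable d t by apply/derivable1_diffP.
move=> dt; have hl := @cvg_line R^o (1 : R) t. exact: (cvg_comp _ _ hl dt).
Qed.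

Lemma is_derive_ipl (c : R -> H) c' x t :
  is_derive (t : R) (1 : R) c c' ->
  is_derive (t : R) (1 : R) (fun u => ip (c u) x) (ip c' x).
Proof.
move=> hc; have := is_derive_ip hc (is_derive_cst x t 1).
by rewrite ip0r addr0.
Qed.

End InnerProduct.

(** * Hyperbolic functions and the linear equation [p'' = s^2 p] *)

Section Hyperbolic.
Context {R : realType}.
Implicit Types (x y : R).

Definition cosh x : R := (expR x + expR (- x)) / 2.
Definition sinh x : R := (expR x - expR (- x)) / 2.

Lemma cosh0 : cosh 0 = 1. Proof. by rewrite /cosh oppr0 expR0; field. Qed.
Lemma sinh0 : sinh 0 = 0. Proof. by rewrite /sinh oppr0 expR0 subrr mul0r. Qed.

Lemma cosh2_sinh2 x : cosh x ^+ 2 - sinh x ^+ 2 = 1.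
Proof.
rewrite /cosh /sinh expRN; have := expR_gt0 x.
by move=> h; field; rewrite gt_eqF.
Qed.

Lemma coshD x y : cosh (x + y) = cosh x * cosh y + sinh x * sinh y.
Proof. by rewrite /cosh /sinh opprD !expRD; field. Qed.

Lemma cosh_ge1 x : 1 <= cosh x.
Proof.
have h := expR_gt0 x; rewrite /cosh expRN ler_pdivlMr// mul1r -subr_ge0.
have -> : expR x + (expR x)^-1 - 2 = (expR x - 1) ^+ 2 / expR x.
  by field; rewrite gt_eqF.
by rewrite divr_ge0 ?sqr_ge0// ltW.
Qed.

Lemma sinh_ge0 x : 0 <= x -> 0 <= sinh x.
Proof. by move=> x0; rewrite /sinh divr_ge0// subr_ge0 ler_expR; lra. Qed.

Lemma ler_cosh x y : 0 <= x -> x <= y -> cosh x <= cosh y.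
Proof.
move=> x0 xy; rewrite -(subrK x y) coshD.
have := cosh_ge1 (y - x); have := sinh_ge0 x0.
have : 0 <= sinh (y - x) by rewrite sinh_ge0// subr_ge0.
have := cosh_ge1 x; nra.
Qed.

Lemma cosh_inj_le x y : 0 <= x -> 0 <= y -> cosh x <= cosh y -> x <= y.
Proof.
move=> x0 y0 h; rewrite leNgt; apply/negP => yx.
have e : expR y < expR x by rewrite ltr_expR.
have ey : 1 <= expR y by rewrite -expR0 ler_expR.
move: h; rewrite /cosh !expRN => h.
have {}h : expR x + (expR x)^-1 <= expR y + (expR y)^-1 by lra.
have : 0 < (expR x - expR y) * (expR x * expR y - 1) / (expR x * expR y).
  by rewrite !(mulr_gt0, invr_gt0)//; nra.
have -> : (expR x - expR y) * (expR x * expR y - 1) / (expR x * expR y) =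
  expR x + (expR x)^-1 - (expR y + (expR y)^-1).
  by field; rewrite !gt_eqF ?expR_gt0.
lra.
Qed.

Lemma is_derive_expRM (s t : R) :
  is_derive t (1 : R) (fun u => expR (s * u)) (s * expR (s * t)).
Proof.
have h : is_derive t (1:R) (fun u => s * u) s.
  apply: (is_derive_eq (is_deriveZ _ (is_derive_id t (1 : R)))); exact: mulr1.
by apply: (is_derive_eq (is_derive1_comp _ h)); rewrite mulrC.
Qed.

Lemma is_derive_cosh (s t : R) :
  is_derive t (1 : R) (fun u => cosh (s * u)) (s * sinh (s * t)).
Proof.
rewrite (_ : (fun u => _) =
  (fun u => 2^-1 *: (expR (s * u) + expR (- s * u)))); last first.
  by apply/funext => u; rewrite /cosh mulrC mulNr.
apply: (is_derive_eq (is_deriveZ _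
  (is_deriveD (is_derive_expRM s t) (is_derive_expRM (- s) t)))).
by rewrite /sinh !mulNr -[_ *: _]/(_ * _); field.
Qed.

Lemma is_derive_sinh (s t : R) :
  is_derive t (1 : R) (fun u => sinh (s * u)) (s * cosh (s * t)).
Proof.
rewrite (_ : (fun u => _) =
  (fun u => 2^-1 *: (expR (s * u) - expR (- s * u)))); last first.
  by apply/funext => u; rewrite /sinh mulrC mulNr.
apply: (is_derive_eq (is_deriveZ _
  (is_deriveB (is_derive_expRM s t) (is_derive_expRM (- s) t)))).
by rewrite /cosh !mulNr -[_ *: _]/(_ * _); field.
Qed.

Lemma is_derive_const (f : R -> R) : (forall t, is_derive t (1 : R) f 0) ->
  forall t, f t = f 0.
Proof.
move=> h; have c a b : a <= b -> f a = f b.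
  move=> ab; have hc : {within `[a, b], continuous f}.
    apply: derivable_within_continuous => x _.
    by case: (h x).
  have [x _ /eqP] := @MVT_segment _ f (fun=> 0) a b ab (fun x _ => h x) hc.
  by rewrite mul0r subr_eq0 eq_sym => /eqP.
by move=> t; case: (leP 0 t) => [/c//|/ltW/c].
Qed.

(** Gives uniqueness for the lifted geodesic equation by an explicit formula, without a general
    theorem on differential equations. *)
Lemma second_order_ode (p p' : R -> R) (s : R) : s != 0 ->
  (forall t, is_derive t (1 : R) p (p' t)) ->
  (forall t, is_derive t (1 : R) p' (s ^+ 2 * p t)) ->
  forall t, p t = p 0 * cosh (s * t) + p' 0 / s * sinh (s * t).
Proof.
move=> s0 dp dp' t.
(* [A] and [B] transport the solution at time [u] back to time 0; they are conserved and equal [p 0]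
   and [p' 0]. *)
pose A := fun u => p u * cosh (s * u) - s^-1 *: (p' u * sinh (s * u)).
pose B := fun u => p' u * cosh (s * u) - s *: (p u * sinh (s * u)).
have hA u : is_derive u (1 : R) A 0.
  apply: (is_derive_eq (is_deriveB (is_deriveM (dp u) (is_derive_cosh s u))
    (is_deriveZ _ (is_deriveM (dp' u) (is_derive_sinh s u))))).
  by rewrite -![_ *: _]/(_ * _); field.
have hB u : is_derive u (1 : R) B 0.
  apply: (is_derive_eq (is_deriveB (is_deriveM (dp' u) (is_derive_cosh s u))
    (is_deriveZ _ (is_deriveM (dp u) (is_derive_sinh s u))))).
  by rewrite -![_ *: _]/(_ * _); field.
have eA := is_derive_const hA t; have eB := is_derive_const hB t.
have := cosh2_sinh2 (s * t); move: eA eB; rewrite /A /B mulr0 cosh0 sinh0.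
rewrite !mulr0 !mulr1 !scaler0 !subr0 -![_ *: _]/(_ * _) => <- <- e.
transitivity (p t * (cosh (s * t) ^+ 2 - sinh (s * t) ^+ 2)); last by field.
by rewrite e mulr1.
Qed.

(* This is [tanh (t / 2)], the Euclidean norm of a point at distance [t] from [0]. *)
Definition tanh2 (t : R) : R := (expR t - 1) / (expR t + 1).

Lemma tanh20 : tanh2 0 = 0.
Proof. by rewrite /tanh2 expR0 subrr mul0r. Qed.

Lemma cosh_tanh2 t : cosh t = (1 + tanh2 t ^+ 2) / (1 - tanh2 t ^+ 2).
Proof.
have h := expR_gt0 t; rewrite /cosh /tanh2 expRN; field.
by rewrite !gt_eqF//; nra.
Qed.

Lemma sinh_tanh2 t : sinh t = 2 * tanh2 t / (1 - tanh2 t ^+ 2).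
Proof.
have h := expR_gt0 t; rewrite /sinh /tanh2 expRN; field.
by rewrite !gt_eqF//; nra.
Qed.

Lemma tanh2_surj (a : R) : 0 <= a < 1 -> exists2 t, 0 <= t & tanh2 t = a.
Proof.
move=> /andP[a0 a1]; exists (ln ((1 + a) / (1 - a))).
  by rewrite ln_ge0// ler_pdivlMr; lra.
rewrite /tanh2 lnK ?posrE ?divr_gt0//; [|lra..].
by field; rewrite !gt_eqF; lra.
Qed.

Lemma cvg_tanh2 : tanh2 t @[t --> +oo] --> (1 : R).
Proof.
rewrite (_ : tanh2 = (fun t => (1 - expR (- t)) / (1 + expR (- t)))); last first.
  apply/funext => t; rewrite /tanh2 expRN; have h := expR_gt0 t.
  by field; rewrite !gt_eqF ?addr_gt0.
rewrite -[X in _ --> X](_ : (1 - 0) / (1 + 0) = 1 :> R); last by rewrite subr0 addr0 divr1.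
apply: cvgM; first by apply: cvgB; [exact: cvg_cst|exact: cvgr_expR].
apply: cvgV; first by rewrite addr0.
by apply: cvgD; [exact: cvg_cst|exact: cvgr_expR].
Qed.

End Hyperbolic.

(** The bound is on squared norms because both uses produce squares: the parallelogram identity for
    minimising sequences, and [coshdist_norm] for the iterates. *)
Lemma cvg_of_cauchy_bound {R : realType} {H : completeNormedModType R}
    (b : nat -> R) (u : nat -> H) :
  b @ \oo --> 0 ->
  (forall n m, (n <= m)%N -> `|u n - u m| ^+ 2 <= b n) -> cvg (u @ \oo).
Proof.
move=> b0 ub; apply: cauchy_cvg; apply: cauchy_exP => e e0.
have [N _ hN] : \forall n \near \oo, b n < e ^+ 2.
  by apply: (cvgr_lt _ b0); rewrite exprn_gt0.
exists (u N); exists N => // m /= Nm; rewrite -ball_normE /=.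
rewrite -(@ltr_pXn2r _ 2)// ?nnegrE ?(ltW e0)//.
by apply: le_lt_trans (ub _ _ Nm) _; apply: hN => /=.
Qed.

(** * Lax-Milgram for symmetric coercive forms, by energy minimisation *)

Section LaxMilgram.
Context {R : realType} {H : completeNormedModType R}.
Variables (a : H -> H -> R) (phi : H -> R) (al K C : R).
Hypothesis al0 : 0 < al.
Hypothesis aC : forall x y, a x y = a y x.
Hypothesis aDl : forall x y z, a (x + y) z = a x z + a y z.
Hypothesis aZl : forall k x z, a (k *: x) z = k * a x z.
Hypothesis a_ge : forall x, al * `|x| ^+ 2 <= a x x.
Hypothesis a_le : forall x y, `|a x y| <= C * `|x| * `|y|.
Hypothesis phiD : forall x y, phi (x + y) = phi x + phi y.
Hypothesis phiZ : forall k x, phi (k *: x) = k * phi x.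
Hypothesis phi_le : forall x, `|phi x| <= K * `|x|.

Let aDr x y z : a x (y + z) = a x y + a x z.
Proof. by rewrite aC aDl !(aC x). Qed.
Let aZr k x z : a x (k *: z) = k * a x z.
Proof. by rewrite aC aZl aC. Qed.
Let aNl x z : a (- x) z = - a x z.
Proof. by rewrite -scaleN1r aZl mulN1r. Qed.
Let a_sub x y : a (x - y) (x - y) = a x x - 2 * a x y + a y y.
Proof. by rewrite -(scaleN1r y) !(aDl, aDr, aZl, aZr) (aC y x); ring. Qed.
Let J x := a x x - 2 * phi x.

Let J_shift x y t : J (x + t *: y) = J x + t ^+ 2 * a y y + 2 * t * (a x y - phi y).
Proof. by rewrite /J !(aDl, aDr, aZl, aZr, phiD, phiZ) (aC y x); ring. Qed.

Let J_lb x : - (K ^+ 2 / al) <= J x.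
Proof.
have h1 := a_ge x; have h2 := le_trans (ler_norm _) (phi_le x).
have h3 : 0 <= (al * `|x| - K) ^+ 2 / al by rewrite divr_ge0 ?sqr_ge0// ltW.
have e : (al * `|x| - K) ^+ 2 / al = al * `|x| ^+ 2 - 2 * (K * `|x|) + K ^+ 2 / al.
  by field; rewrite gt_eqF.
rewrite /J; lra.
Qed.

Let d := inf (range J).

Let has_infJ : has_inf (range J).
Proof.
split; first by exists (J 0), 0.
by exists (- (K ^+ 2 / al)) => _ [x _ <-]; exact: J_lb.
Qed.

Let dJ x : d <= J x.
Proof. by apply: ge_inf; [case: has_infJ|exists x]. Qed.

(** Serves twice: with [a := ip] it is the Riesz representation behind weak integrals, and with [a]
    the form of [id - cov f] it makes the Newton operator surjective. The solution is the limit of a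
    minimising sequence of the energy [J]. *)
Lemma lax_milgram : exists x, forall y, a x y = phi y.
Proof.
have ex n : exists x, J x < d + n.+1%:R^-1.
  have n0 : 0 < n.+1%:R^-1 :> R by rewrite invr_gt0.
  by have [_ [x _ <-] h] := inf_adherent n0 has_infJ; exists x.
pose u n := xget 0 [set x | J x < d + n.+1%:R^-1].
have hu n : J (u n) < d + n.+1%:R^-1.
  by have [x hx] := ex n; exact: (@xgetPex _ 0 [set x | J x < _] (ex n)).
have close n m : al * `|u n - u m| ^+ 2 <= 2 * (n.+1%:R^-1 + m.+1%:R^-1).
  (* Parallelogram identity: the energy of the midpoint is at least [d], which forces two
     near-minimisers to be close. *)
  have := a_ge (u n - u m); rewrite a_sub; have := dJ (2^-1 *: (u n + u m)).
  have := hu n; have := hu m.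
  rewrite /J !(aDl, aDr, aZl, aZr, phiD, phiZ) (aC (u m) (u n)).
  by move: (n.+1%:R^-1) (m.+1%:R^-1) => i j; lra.
have inv0 : (fun n => n.+1%:R^-1 : R) @ \oo --> 0 by exact: cvg_harmonic.
have cu : cvg (u @ \oo).
  apply: (@cvg_of_cauchy_bound _ _ (fun n => 4 / al * n.+1%:R^-1)).
    by rewrite -[X in _ --> X](mulr0 (4 / al)); exact: (cvgMl_tmp inv0).
  move=> n m nm; rewrite -(ler_pM2l al0) [leRHS](_ : _ = 4 * n.+1%:R^-1); last by field; rewrite nat1r pnatr_eq0 (gt_eqF al0).
  apply: le_trans (close n m) _.
  have : m.+1%:R^-1 <= n.+1%:R^-1 :> R by rewrite lef_pV2 ?posrE// ler_nat.
  by move: (n.+1%:R^-1) (m.+1%:R^-1) => i j; lra.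
exists (lim (u @ \oo)) => y; apply/eqP; rewrite -subr_eq0 -normr_eq0 -sqrf_eq0.
(* The Euler-Lagrange residual is bounded along the sequence and only then passed to the limit. The
   bound compares [u n] with the best point on the line through it in direction [y]. *)
have bound n : (a (u n) y - phi y) ^+ 2 <= a y y * n.+1%:R^-1.
  have ay : 0 <= a y y by apply: le_trans (a_ge y); rewrite mulr_ge0 ?sqr_ge0 ?(ltW al0).
  set b := a (u n) y - phi y.
  move: (hu n); have : 0 < n.+1%:R^-1 :> R by rewrite invr_gt0.
  move: (n.+1%:R^-1) => i i0 hun.
  (* Here [J] is affine along the line; being bounded below, it has slope [b = 0]. *)
  have [ay0|ay0] := eqVneq (a y y) 0.
    have hb t : 0 <= i + 2 * t * b.
      have := dJ (u n + t *: y); rewrite J_shift ay0 mulr0 addr0 -/b.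
      lra.
    have [->|b0] := eqVneq b 0; first by rewrite expr0n ay0 mul0r.
    have := hb (- i / b).
    have -> : i + 2 * (- i / b) * b = - i by field.
    by rewrite oppr_ge0 leNgt i0.
  have := dJ (u n + (- b / a y y) *: y); rewrite J_shift -/b.
  have -> : J (u n) + (- b / a y y) ^+ 2 * a y y + 2 * (- b / a y y) * b =
    J (u n) - b ^+ 2 / a y y by field.
  move=> h; rewrite -ler_pdivrMl ?lt0r ?ay0// mulrC; lra.
have lim_a : (fun n => (a (u n) y - phi y) ^+ 2) @ \oo --> `|a (lim (u @ \oo)) y - phi y| ^+ 2.
  rewrite real_normK ?num_real// !expr2.
  suff h : (fun n => a (u n) y - phi y) @ \oo --> a (lim (u @ \oo)) y - phi y by exact: cvgM.
  apply: cvgB; last exact: cvg_cst.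
  apply/subr_cvg0.
  have hh : (fun n => C * `|u n - lim (u @ \oo)| * `|y|) @ \oo --> C * 0 * `|y|.
    apply: cvgMr_tmp; apply: cvgMl_tmp; rewrite -[X in _ --> X](normr0 H).
    by apply: cvg_norm; apply/subr_cvg0.
  apply/norm_cvg0P; apply: (@squeeze_cvgr _ _ _ _ (fun=> 0) (fun n => C * `|u n - lim (u @ \oo)| * `|y|)).
  - near=> n; rewrite normr_ge0 /=.
    by rewrite (_ : _ - _ = a (u n - lim (u @ \oo)) y) ?a_le// aDl aNl.
  - exact: cvg_cst.
  - by move: hh; rewrite mulr0 mul0r.
rewrite -subr_eq0 subr0 eq_le sqr_ge0 andbT.
apply: (ler_cvg_to lim_a (_ : (fun n => a y y * n.+1%:R^-1) @ \oo --> 0)).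
  rewrite -[X in _ --> X](mulr0 (a y y)); exact: (cvgMl_tmp inv0).
by near=> n; exact: bound.
Unshelve. all: by end_near.
Qed.

End LaxMilgram.

(** * Borel measurability of maps continuous off a finite set *)

Section Borel.
Implicit Types T U : ptopologicalType.

Lemma measurable_borel_open T (A : set T) :
  open A -> measurable (A : set (borel T)).
Proof. exact: sub_sigma_algebra. Qed.

Lemma measurable_borel_closed T (A : set T) :
  closed A -> measurable (A : set (borel T)).
Proof.
move=> cA; rewrite -[A]setCK; apply: measurableC.
by apply: measurable_borel_open; exact: closed_openC.
Qed.

(** Meant for [sigma w], which is a map on all of [H] with a pole outside the closed ball. The part
    of [V] in [N] is finite, hence closed; the rest is open. *)
Lemma measurable_preimage_cofinite T (N V : set T) : hausdorff_space T ->
  finite_set N -> (forall x, V x -> ~ N x -> nbhs x V) ->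
  measurable (V : set (borel T)).
Proof.
move=> hT fN nV.
have cl (A : set T) : finite_set A -> closed A.
  by move: A; apply/accessible_finite_set_closed; exact: hausdorff_accessible.
rewrite -[V](setUIDK _ N); apply: measurableU.
  apply: measurable_borel_closed; apply: cl; exact: finite_setIr.
apply: measurable_borel_open; rewrite openE => x [Vx Nx].
apply: filterI; first exact: nV.
by apply: open_nbhs_nbhs; split => //; apply: closed_openC; exact: cl.
Qed.

Lemma measurable_cofinite_continuous T U (N : set T) (f : T -> U) :
  hausdorff_space T -> finite_set N ->
  (forall x, ~ N x -> {for x, continuous f}) ->
  measurable_fun setT (f : borel T -> borel U).
Proof.
move=> hT fN cf; apply: (@measurability _ _ (borel T) (borel U) setT f (@open U)) => //.
move=> _ [V oV <-]; rewrite setTI.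
apply: (@measurable_preimage_cofinite T N) => // x Vx Nx; apply: cf => //.
exact: open_nbhs_nbhs.
Qed.

Lemma measurable_borel_continuous (R : realType) T (f : T -> R) :
  hausdorff_space T -> continuous f -> measurable_fun setT (f : borel T -> R).
Proof.
move=> hT cf; apply: (@measurability _ _ (borel T) R setT f _ (RGenOpens.measurableE R)).
move=> _ [_ [a [b ->] <-]]; rewrite setTI; apply: measurable_borel_open.
by apply: open_comp => [x _|]; [exact: cf|exact: interval_open].
Qed.

End Borel.

(** * Averages of bounded measurable functions over the sphere *)

Section SphereAverage.
Context {R : realType} {H : completeNormedModType R}.
Variable mu : probability (borel H) R.
Hypothesis mu_sphere : mu sphere = 1%E.
Notation S := (sphere : set H).

Lemma measurable_sphere : measurable (sphere : set (borel H)).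
Proof.
apply: measurable_borel_closed.
rewrite (_ : sphere = (fun x : H => `|x|) @^-1` [set x | x = 1])//.
apply: closed_comp; last exact: closed_eq.
by move=> x _; exact: (@norm_continuous _ H).
Qed.

(** An algebra of integrable functions: the bound makes it stable under products, which second
    moments require. *)
Definition admissible (phi : H -> R) :=
  measurable_fun (sphere : set (borel H)) (phi : borel H -> R) /\
  exists C, forall x, S x -> `|phi x| <= C.

Lemma admissible_integrable phi : admissible phi ->
  mu.-integrable (sphere : set (borel H)) (EFin \o phi).
Proof.
move=> [mphi [C hC]]; apply: measurable_bounded_integrable => //.
- exact: measurable_sphere.
- by rewrite [ltLHS](_ : _ = 1%E) ?ltry//; exact: mu_sphere.
- exists C; split; first exact: num_real.
  by move=> y Cy x Sx /=; apply: le_trans (ltW Cy); exact: hC.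
Qed.

Lemma admissible_cst c : admissible (fun=> c).
Proof. by split; [exact: measurable_cst|exists `|c|]. Qed.

Lemma admissibleD phi psi :
  admissible phi -> admissible psi -> admissible (fun x => phi x + psi x).
Proof.
move=> [m1 [C1 h1]] [m2 [C2 h2]]; split; first exact: measurable_funD.
exists (C1 + C2) => x Sx; apply: le_trans (ler_normD _ _) _.
by apply: lerD; [exact: h1|exact: h2].
Qed.

Lemma admissibleM phi psi :
  admissible phi -> admissible psi -> admissible (fun x => phi x * psi x).
Proof.
move=> [m1 [C1 h1]] [m2 [C2 h2]]; split; first exact: measurable_funM.
exists (C1 * C2) => x Sx; rewrite normrM.
by apply: ler_pM => //; [exact: h1|exact: h2].
Qed.

Lemma admissibleZ c phi : admissible phi -> admissible (fun x => c * phi x).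
Proof. by apply: admissibleM; exact: admissible_cst. Qed.

Lemma admissibleN phi : admissible phi -> admissible (fun x => - phi x).
Proof.
move=> h; rewrite (_ : (fun x => _) = (fun x => (-1) * phi x)).
  exact: admissibleZ.
by apply/funext => x; rewrite mulN1r.
Qed.

Lemma admissibleB phi psi :
  admissible phi -> admissible psi -> admissible (fun x => phi x - psi x).
Proof. by move=> h1 h2; apply: admissibleD => //; exact: admissibleN. Qed.

Definition avg (phi : H -> R) : R := \int[mu]_(x in S) phi x.

Lemma avgE phi : admissible phi ->
  (\int[mu]_(x in S) (phi x)%:E = (avg phi)%:E)%E.
Proof.
move=> h; rewrite /avg /Rintegral fineK//.
apply: integrable_fin_num; first exact: measurable_sphere.
exact: admissible_integrable.
Qed.

Lemma eq_avg phi psi : (forall x, S x -> phi x = psi x) -> avg phi = avg psi.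
Proof. by move=> h; apply: eq_Rintegral => x; rewrite inE => /h. Qed.

Lemma avg_cst c : avg (fun=> c) = c.
Proof.
rewrite /avg Rintegral_cst; last exact: measurable_sphere.
by rewrite [X in fine X](_ : _ = 1%E) ?mulr1//; exact: mu_sphere.
Qed.

Lemma avgD phi psi : admissible phi -> admissible psi ->
  avg (fun x => phi x + psi x) = avg phi + avg psi.
Proof.
by move=> h1 h2; apply: RintegralD; [exact: measurable_sphere|exact: admissible_integrable..].
Qed.

Lemma avgB phi psi : admissible phi -> admissible psi ->
  avg (fun x => phi x - psi x) = avg phi - avg psi.
Proof.
by move=> h1 h2; apply: RintegralB; [exact: measurable_sphere|exact: admissible_integrable..].
Qed.

Lemma avgZ c phi : admissible phi -> avg (fun x => c * phi x) = c * avg phi.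
Proof.
by move=> h; apply: RintegralZl; [exact: measurable_sphere|exact: admissible_integrable].
Qed.

Lemma ler_avg phi psi : admissible phi -> admissible psi ->
  (forall x, S x -> phi x <= psi x) -> avg phi <= avg psi.
Proof.
by move=> h1 h2 h; apply: le_Rintegral; [exact: measurable_sphere|exact: admissible_integrable|exact: admissible_integrable|].
Qed.

Lemma avg_ge0 phi : (forall x, S x -> 0 <= phi x) -> 0 <= avg phi.
Proof. by move=> h; apply: Rintegral_ge0. Qed.

Lemma avg_le phi C : admissible phi ->
  (forall x, S x -> phi x <= C) -> avg phi <= C.
Proof. by move=> h hC; rewrite -[C]avg_cst ler_avg//; exact: admissible_cst. Qed.

(** Excludes the zero space, so that even the zero vector has a unit direction in polar form. *)
Lemma sphere_nonempty : exists x : H, `|x| = 1.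
Proof.
apply: contrapT => h; have S0 : S = set0.
  by apply/seteqP; split => // x Sx; apply: h; exists x.
by move: mu_sphere; rewrite S0 measure0 => /eqP; rewrite eq_sym onee_eq0.
Qed.

End SphereAverage.

(** * Algebra of the shift transformations, Poisson kernel, and hyperbolic distance *)

Section Moebius.
Context {R : realType} {H : completeNormedModType R} (ip : H -> H -> R).
Hypothesis ip_inner : inner_product ip.
Notation sigma := (sigma ip).
Notation "''[' x , y ]" := (ip x y) (format "''[' x ,  y ]").
Let ipE := (ipDl ip_inner, ipDr ip_inner, ipNl ip_inner, ipNr ip_inner,
  ipZl ip_inner, ipZr ip_inner, ip0l ip_inner, ip0r ip_inner).
Let ipC := ipC ip_inner.
Let ipxx := ipxx ip_inner.

Lemma ball_ip w : poincare_ball w <-> '[w, w] < 1.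
Proof.
rewrite ipxx /poincare_ball /=; split=> [h|].
  by rewrite expr_lt1.
by rewrite expr_lt1.
Qed.

Lemma sphere_ip x : sphere x <-> '[x, x] = 1.
Proof.
rewrite ipxx /sphere /=; split=> [->|/eqP]; first by rewrite expr1n.
by rewrite sqrf_eq1 => /orP[/eqP //|/eqP h]; have := normr_ge0 x; rewrite h; lra.
Qed.

Definition sigma_den w z : R := 1 - 2 * '[w, z] + '[w, w] * '[z, z].

Lemma sigmaE w z : sigma w z = (sigma_den w z)^-1 *:
  ((1 - '[w, w]) *: z - (1 + '[z, z] - 2 * '[w, z]) *: w).
Proof. by rewrite /Defs.sigma /sigma_den -!ipxx. Qed.

Lemma sigma0 w : sigma w 0 = - w.
Proof.
rewrite sigmaE (_ : sigma_den w 0 = 1); last by rewrite /sigma_den !ipE; ring.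
by apply: (ip_inj ip_inner) => y; rewrite invr1 !ipE; ring.
Qed.

Lemma sigma0l z : sigma 0 z = z.
Proof.
rewrite sigmaE (_ : sigma_den 0 z = 1); last by rewrite /sigma_den !ipE; ring.
by apply: (ip_inj ip_inner) => y; rewrite invr1 !ipE; ring.
Qed.

Lemma sigma_den_gt0 w z : '[w, w] < 1 -> '[z, z] <= 1 -> 0 < sigma_den w z.
Proof.
move=> w1 z1; have e : sigma_den w z =
    (1 - '[w, w]) * (1 - '[z, z]) + '[w - z, w - z].
  by rewrite /sigma_den !ipE (ipC z w); ring.
have h0 := ip_ge0 ip_inner (w - z).
have h1 : 0 <= (1 - '[w, w]) * (1 - '[z, z]) by rewrite mulr_ge0// subr_ge0// ltW.
rewrite lt_def {2}e addr_ge0// andbT e paddr_eq0//.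
apply/negP => /andP[/eqP a /eqP /(ip_eq0 ip_inner)/subr0_eq wz].
by move: a; rewrite wz -expr2 => /eqP; rewrite sqrf_eq0 subr_eq0 -wz; lra.
Qed.

Lemma sigma_den_neq0 w z : '[w, w] < 1 -> '[z, z] <= 1 -> sigma_den w z != 0.
Proof. by move=> w1 z1; rewrite gt_eqF// sigma_den_gt0. Qed.

Lemma sigma_denN w z : sigma_den (- w) z = 1 + 2 * '[w, z] + '[w, w] * '[z, z].
Proof. by rewrite /sigma_den !ipE; ring. Qed.

(** Invariance of the ball and of the sphere, and the formula for the distance, all rest on this
    identity. *)
Lemma one_sub_sigma w z : sigma_den w z != 0 ->
  1 - '[sigma w z, sigma w z] =
  (1 - '[w, w]) * (1 - '[z, z]) / sigma_den w z.
Proof.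
by rewrite sigmaE /sigma_den => d0; rewrite !ipE (ipC z w); field.
Qed.

Lemma sigma_ball w z : '[w, w] < 1 -> '[z, z] < 1 ->
  '[sigma w z, sigma w z] < 1.
Proof.
move=> w1 z1; rewrite -subr_gt0 one_sub_sigma ?sigma_den_neq0 ?(ltW z1)//.
by rewrite divr_gt0 ?sigma_den_gt0 ?(ltW z1)// mulr_gt0// subr_gt0.
Qed.

Lemma sigma_sphere w x : '[w, w] < 1 -> '[x, x] = 1 ->
  '[sigma w x, sigma w x] = 1.
Proof.
move=> w1 x1; apply/eqP; rewrite eq_sym -subr_eq0.
by rewrite one_sub_sigma ?sigma_den_neq0 ?x1// subrr mulr0 mul0r.
Qed.

Lemma ipNN w : '[- w, - w] = '[w, w].
Proof. by rewrite !ipE opprK. Qed.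

Lemma sigmaK w z : '[w, w] < 1 -> '[z, z] <= 1 -> sigma (- w) (sigma w z) = z.
Proof.
move=> w1 z1; have d0 := sigma_den_neq0 w1 z1.
have d1 : '[sigma w z, sigma w z] <= 1.
  rewrite -subr_ge0 one_sub_sigma// divr_ge0 ?mulr_ge0 ?subr_ge0 ?(ltW w1)//.
  exact/ltW/sigma_den_gt0.
have d2 : sigma_den (- w) (sigma w z) != 0 by rewrite sigma_den_neq0// ipNN.
have e2 : sigma_den (- w) (sigma w z) = (1 - '[w, w]) ^+ 2 / sigma_den w z.
  rewrite sigma_denN sigmaE /sigma_den; move: d0; rewrite /sigma_den => d0.
  by rewrite !ipE (ipC z w); field.
apply: (ip_inj ip_inner) => y; rewrite (sigmaE (- w)) e2 ipNN.
have w0 : 1 - '[w, w] != 0 by rewrite subr_eq0 gt_eqF.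
move: d0; rewrite (sigmaE w z) /sigma_den => d0.
by rewrite !ipE (ipC z w); field; rewrite w0 d0.
Qed.

Lemma sigmaNK w z : '[w, w] < 1 -> '[z, z] <= 1 -> sigma w (sigma (- w) z) = z.
Proof. by move=> w1 z1; rewrite -{1}(opprK w) sigmaK// ipNN. Qed.

(** For a unit vector [x] this is [(1 - |w|^2) / |x - w|^2], the conformal factor of [sigma w] on
    the sphere at [x]. *)
Definition poisson w x : R := (1 - '[w, w]) / (1 - 2 * '[w, x] + '[w, w]).

Lemma poisson_den w x : '[w, w] < 1 -> '[x, x] = 1 ->
  0 < 1 - 2 * '[w, x] + '[w, w].
Proof.
by move=> w1 x1; have := @sigma_den_gt0 w x w1; rewrite /sigma_den x1 mulr1; apply.
Qed.

Lemma sigma_sphereE w x : '[x, x] = 1 -> sigma w x =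
  (1 - 2 * '[w, x] + '[w, w])^-1 *: ((1 - '[w, w]) *: x - (2 - 2 * '[w, x]) *: w).
Proof. by move=> x1; rewrite sigmaE /sigma_den x1 mulr1. Qed.

(** Squared chords are multiplied by the conformal factors of their two ends, so the Gram kernel
    sees [w] only through [poisson w]. *)
Lemma ip_sigma_sphere w x x' : '[w, w] < 1 -> '[x, x] = 1 -> '[x', x'] = 1 ->
  '[sigma w x, sigma w x'] = 1 - poisson w x * poisson w x' * (1 - '[x, x']).
Proof.
move=> w1 x1 x1'; rewrite !sigmaE /sigma_den /poisson !ipE x1 x1' !mulr1 (ipC x w).
have := poisson_den w1 x1; have := poisson_den w1 x1' => /gt_eqF h1 /gt_eqF h2.
by field; rewrite h1 h2.
Qed.

(** Chain rule for conformal factors, up to a rotation, which has factor one. *)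
Lemma poisson_cocycle w z x : '[w, w] < 1 -> '[z, z] < 1 -> '[x, x] = 1 ->
  poisson (sigma (- w) z) x = poisson z (sigma w x) * poisson w x.
Proof.
move=> w1 z1 x1; have nw1 : '[- w, - w] < 1 by rewrite ipNN.
have dz := sigma_den_neq0 nw1 (ltW z1).
have b := poisson_den (sigma_ball nw1 z1) x1.
have c := poisson_den z1 (sigma_sphere w1 x1).
have p := poisson_den w1 x1.
have w0 : 1 - '[w, w] != 0 by rewrite subr_eq0 gt_eqF.
have e1 := one_sub_sigma dz.
have e1' : '[sigma (- w) z, sigma (- w) z] =
  1 - (1 - '[w, w]) * (1 - '[z, z]) / sigma_den (- w) z by rewrite -(ipNN w) -e1; ring.
have den1 : 1 - 2 * '[sigma (- w) z, x] + '[sigma (- w) z, sigma (- w) z] =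
  (1 - 2 * '[z, sigma w x] + '[z, z]) * (1 - 2 * '[w, x] + '[w, w]) /
    sigma_den (- w) z.
  rewrite e1' (sigmaE (- w) z) (sigma_sphereE w x1) ipNN !ipE.
  rewrite ?(ipC z x) ?(ipC z w) ?(ipC x w).
  move: dz; rewrite sigma_denN => dz.
  by field; rewrite dz gt_eqF.
rewrite /poisson e1 ipNN den1; field.
by rewrite dz !gt_eqF.
Qed.

(** The two maps differ by an orthogonal map. It never has to be written down: by [poisson_cocycle]
    both maps have the same conformal factors, and these determine the Gram kernel. *)
Lemma ip_sigma_comp w z x x' : '[w, w] < 1 -> '[z, z] < 1 ->
  '[x, x] = 1 -> '[x', x'] = 1 ->
  '[sigma (sigma (- w) z) x, sigma (sigma (- w) z) x'] =
  '[sigma z (sigma w x), sigma z (sigma w x')].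
Proof.
move=> w1 z1 x1 x1'; have nw1 : '[- w, - w] < 1 by rewrite ipNN.
rewrite (ip_sigma_sphere (sigma_ball nw1 z1) x1 x1').
rewrite (ip_sigma_sphere z1 (sigma_sphere w1 x1) (sigma_sphere w1 x1')).
by rewrite (ip_sigma_sphere w1 x1 x1') !poisson_cocycle//; ring.
Qed.

(* The hyperbolic cosine of the distance between [a] and [b]. *)
Definition coshdist a b : R :=
  1 + 2 * '[a - b, a - b] / ((1 - '[a, a]) * (1 - '[b, b])).

(** [sigma (- w)] is an isometry taking [0] to [w]; the right-hand side is the value at the pair
    [0], [z]. *)
Lemma coshdist_sigma w z : '[w, w] < 1 -> '[z, z] < 1 ->
  coshdist w (sigma (- w) z) = (1 + '[z, z]) / (1 - '[z, z]).
Proof.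
move=> w1 z1; have nw1 : '[- w, - w] < 1 by rewrite ipNN.
have dz := sigma_den_neq0 nw1 (ltW z1).
have w0 : 1 - '[w, w] != 0 by rewrite subr_eq0 gt_eqF.
have z0 : 1 - '[z, z] != 0 by rewrite subr_eq0 gt_eqF.
rewrite /coshdist one_sub_sigma// ipNN sigmaE ipNN; move: dz; rewrite sigma_denN => dz.
by rewrite !ipE (ipC z w); field; rewrite dz w0 z0.
Qed.

(* Hyperboloid coordinates: the Lorentz product of [(t, y)] and [(t', y')] is
   [t t' - '[y, y']]. *)
Lemma lorentz_cauchy_schwarz (t : R) (y : H) (u v : R) (p q : H) :
  t ^+ 2 = 1 + '[y, y] -> t * u = '[y, p] -> t * v = '[y, q] ->
  ('[p, q] - u * v) ^+ 2 <= ('[p, p] - u ^+ 2) * ('[q, q] - v ^+ 2).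
Proof.
move=> ht hu hv.
(* [(t, y)] is a unit timelike vector, and the Lorentz form is negative semidefinite on its
   orthogonal complement. *)
have pos (a : R) r : t * a = '[y, r] -> 0 <= '[r, r] - a ^+ 2.
  move=> ha; have := ip_sqr_le ip_inner y r; rewrite -ha exprMn ht => h.
  have := ip_ge0 ip_inner y; have := ip_ge0 ip_inner r; have := sqr_ge0 a => *.
  have [yy0|yy0] := eqVneq '[y, y] 0.
    by move: h; rewrite yy0 mul0r addr0 mul1r; lra.
  have yy : 0 < '[y, y] by rewrite lt_def yy0.
  rewrite -(pmulr_rge0 _ yy); lra.
have comb (k : R) : 0 <= ('[p, p] - u ^+ 2) - 2 * k * ('[p, q] - u * v)
    + k ^+ 2 * ('[q, q] - v ^+ 2).
  have hk : t * (u - k * v) = '[y, p - k *: q].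
    by rewrite !ipE mulrBr hu mulrCA hv.
  have := pos _ _ hk; rewrite !ipE (ipC q p) => h; apply: le_trans h _.
  by rewrite le_eqVlt; apply/orP; left; apply/eqP; ring.
have := pos v q hv; rewrite le_eqVlt => /orP[/eqP q0|q0].
  have [->|b0] := eqVneq ('[p, q] - u * v) 0.
    by rewrite expr0n -q0 mulr0.
  (* With [q] null, the quadratic in [k] is affine; unless the mixed term vanishes, this [k] gives
     it the value [-1]. *)
  have := comb ((1 + ('[p, p] - u ^+ 2)) / (2 * ('[p, q] - u * v))).
  rewrite -q0 mulr0 addr0.
  have -> : '[p, p] - u ^+ 2 -
    2 * ((1 + ('[p, p] - u ^+ 2)) / (2 * ('[p, q] - u * v))) * ('[p, q] - u * v)
    = -1 by field.
  lra.
have := comb (('[p, q] - u * v) / ('[q, q] - v ^+ 2)).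
move=> h; rewrite -subr_ge0.
have := mulr_ge0 h (ltW q0); set l := (X in 0 <= X -> _).
suff -> : l = ('[p, p] - u ^+ 2) * ('[q, q] - v ^+ 2) - ('[p, q] - u * v) ^+ 2 by [].
by rewrite /l; field; rewrite gt_eqF.
Qed.

(** Hyperbolic law of cosines with the angle estimated: on the hyperboloid, the parts of [a] and [c]
    orthogonal to [b] have squared lengths [be^2 - 1] and [ga^2 - 1], and the Cauchy-Schwarz
    inequality for them yields the addition formula of [cosh]. *)
Lemma coshdist_triangle a b c r s : '[a, a] < 1 -> '[b, b] < 1 -> '[c, c] < 1 ->
  0 <= r -> 0 <= s -> coshdist a b <= cosh r -> coshdist b c <= cosh s ->
  coshdist a c <= cosh (r + s).
Proof.
move=> a1 b1 c1 r0 s0 hr hs.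
(* [(T x, Y x)] is the point of the hyperboloid over [x]. After [clearbody] only [KE] and [TY] are
   used, which keeps the algebra free of fractions. *)
pose T x := (1 + '[x, x]) / (1 - '[x, x]).
pose Y x := (2 / (1 - '[x, x])) *: x.
have n0 x : '[x, x] < 1 -> 1 - '[x, x] != 0 by move=> ?; rewrite subr_eq0 gt_eqF.
have KE x y : '[x, x] < 1 -> '[y, y] < 1 -> coshdist x y = T x * T y - '[Y x, Y y].
  move=> x1 y1; rewrite /coshdist /T /Y !ipE (ipC y x).
  by field; rewrite !n0.
have TY x : '[x, x] < 1 -> T x ^+ 2 = 1 + '[Y x, Y x].
  by move=> x1; rewrite /T /Y !ipE; field; exact: n0.
clearbody T Y.
set be := coshdist a b; set ga := coshdist b c.
have be1 : 1 <= be.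
  by rewrite lerDl mulr_ge0 ?invr_ge0 ?mulr_ge0 ?subr_ge0 ?(ltW a1) ?(ltW b1)//; exact: ip_ge0.
have ga1 : 1 <= ga.
  by rewrite lerDl mulr_ge0 ?invr_ge0 ?mulr_ge0 ?subr_ge0 ?(ltW c1) ?(ltW b1)//; exact: ip_ge0.
have hbe : be = T a * T b - '[Y a, Y b] by exact: KE.
have hga : ga = T b * T c - '[Y b, Y c] by exact: KE.
have := @lorentz_cauchy_schwarz (T b) (Y b) (T a - be * T b) (T c - ga * T b)
  (Y a - be *: Y b) (Y c - ga *: Y b) (TY b b1).
have TYa := TY a a1; have TYb := TY b b1; have TYc := TY c c1.
have -> : '[Y a - be *: Y b, Y a - be *: Y b] - (T a - be * T b) ^+ 2 = be ^+ 2 - 1.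
  rewrite !ipE (ipC (Y b) (Y a)).
  have -> : '[Y a, Y b] = T a * T b - be by rewrite hbe; ring.
  have -> : '[Y a, Y a] = T a ^+ 2 - 1 by rewrite TYa; ring.
  have -> : '[Y b, Y b] = T b ^+ 2 - 1 by rewrite TYb; ring.
  by ring.
have -> : '[Y c - ga *: Y b, Y c - ga *: Y b] - (T c - ga * T b) ^+ 2 = ga ^+ 2 - 1.
  rewrite !ipE (ipC (Y c) (Y b)).
  have -> : '[Y b, Y c] = T b * T c - ga by rewrite hga; ring.
  have -> : '[Y c, Y c] = T c ^+ 2 - 1 by rewrite TYc; ring.
  have -> : '[Y b, Y b] = T b ^+ 2 - 1 by rewrite TYb; ring.
  by ring.
have -> : '[Y a - be *: Y b, Y c - ga *: Y b] - (T a - be * T b) * (T c - ga * T b) =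
    be * ga - coshdist a c.
  rewrite KE// !ipE.
  have -> : '[Y a, Y b] = T a * T b - be by rewrite hbe; ring.
  have -> : '[Y b, Y c] = T b * T c - ga by rewrite hga; ring.
  have -> : '[Y b, Y b] = T b ^+ 2 - 1 by rewrite TYb; ring.
  by ring.
move=> /(_ _ _)-h.
have {}h : (be * ga - coshdist a c) ^+ 2 <= (be ^+ 2 - 1) * (ga ^+ 2 - 1).
  apply: h.
    rewrite !ipE (ipC (Y b) (Y a)).
    have -> : '[Y a, Y b] = T a * T b - be by rewrite hbe; ring.
    have -> : '[Y b, Y b] = T b ^+ 2 - 1 by rewrite TYb; ring.
    by ring.
  rewrite !ipE.
  have -> : '[Y b, Y c] = T b * T c - ga by rewrite hga; ring.
  have -> : '[Y b, Y b] = T b ^+ 2 - 1 by rewrite TYb; ring.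
  by ring.
rewrite coshD.
have cr := cosh2_sinh2 r; have cs := cosh2_sinh2 s.
have sr0 := sinh_ge0 r0; have ss0 := sinh_ge0 s0.
have h2 : (be ^+ 2 - 1) * (ga ^+ 2 - 1) <= (sinh r * sinh s) ^+ 2.
  have er : sinh r ^+ 2 = cosh r ^+ 2 - 1 by lra.
  have es : sinh s ^+ 2 = cosh s ^+ 2 - 1 by lra.
  rewrite exprMn er es.
  have sq (x y : R) : 1 <= x -> x <= y -> 0 <= x ^+ 2 - 1 <= y ^+ 2 - 1.
    by move=> x1 xy; apply/andP; split; nra.
  have /andP[? ?] := sq _ _ be1 hr; have /andP[? ?] := sq _ _ ga1 hs.
  exact: ler_pM.
have h3 : coshdist a c - be * ga <= sinh r * sinh s.
  have := le_trans h h2; have := mulr_ge0 sr0 ss0.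
  by move: (sinh r * sinh s) (be * ga) => S b0 S0 hS; nra.
have : be * ga <= cosh r * cosh s by apply: ler_pM => //; lra.
lra.
Qed.

(** The factors [1 - |a|^2] and [1 - |b|^2] are at most one. This turns closeness in the hyperbolic
    sense into closeness in the complete space [H]. *)
Lemma coshdist_norm a b : '[a, a] < 1 -> '[b, b] < 1 ->
  '[a - b, a - b] <= (coshdist a b - 1) / 2.
Proof.
move=> a1 b1; have := ip_ge0 ip_inner (a - b) => h.
have := ip_ge0 ip_inner a; have := ip_ge0 ip_inner b => hb ha.
have p : 0 < (1 - '[a, a]) * (1 - '[b, b]) by rewrite mulr_gt0// subr_gt0.
rewrite /coshdist [leRHS](_ : _ = '[a - b, a - b] / ((1 - '[a, a]) * (1 - '[b, b]))).
  rewrite ler_pdivlMr// ler_piMr// mulr_ile1//; lra.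
by field; rewrite !subr_eq0 !gt_eqF.
Qed.

Lemma coshdist0 w : '[w, w] < 1 -> coshdist 0 w = 2 / (1 - '[w, w]) - 1.
Proof.
move=> w1; rewrite /coshdist sub0r ipNN !ipE.
by field; rewrite subr_eq0 gt_eqF.
Qed.

Lemma coshdistxx w : coshdist w w = 1.
Proof. by rewrite /coshdist subrr !ipE mulr0 mul0r addr0. Qed.

End Moebius.

(** * One-sided mean value and Taylor estimates on the line *)

Section Calculus.
Context {R : realType}.

Lemma scale_mul (a b : R) : a *: b = a * b. Proof. by []. Qed.

Lemma is_derive_inv (f : R -> R) (df t : R) :
  is_derive t (1 : R) f df -> f t != 0 ->
  is_derive t (1 : R) (fun u => (f u)^-1) (- df / f t ^+ 2).
Proof.
move=> [dv <-] f0; split; first exact: derivableV.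
by rewrite deriveV// scale_mul mulrC mulrN mulNr.
Qed.

Lemma mvt_le (f df : R -> R) (a b C : R) : a <= b ->
  (forall t, t \in `[a, b] -> is_derive t (1 : R) f (df t)) ->
  (forall t, t \in `[a, b] -> df t <= C) -> f b - f a <= C * (b - a).
Proof.
move=> ab h dC; have hc : {within `[a, b], continuous f}.
  by apply: derivable_within_continuous => x xab; case: (h x xab).
have hoo x : x \in `]a, b[ -> is_derive x (1 : R) f (df x).
  by move=> /subset_itv_oo_cc; exact: h.
have [x xab ->] := @MVT_segment _ f df a b ab hoo hc.
by rewrite ler_wpM2r ?subr_ge0// dC.
Qed.

Lemma taylor2_le (f g h : R -> R) (s C : R) : 0 <= s ->
  (forall t, is_derive t (1 : R) f (g t)) ->
  (forall t, is_derive t (1 : R) g (h t)) ->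
  (forall t, h t <= C) -> f s - f 0 - s * g 0 <= C * s ^+ 2 / 2.
Proof.
move=> s0 df dg hC.
pose F := fun t => f t - (g 0 *: t + (C / 2) *: (t * t)).
have dF t : is_derive t (1 : R) F (g t - (g 0 + C * t)).
  apply: (is_derive_eq (is_deriveB (df t) (is_deriveD
    (is_deriveZ (g 0) (is_derive_id t 1))
    (is_deriveZ (C / 2) (is_deriveM (is_derive_id t 1) (is_derive_id t 1)))))).
  by rewrite !scale_mul; field.
have := @mvt_le F _ 0 s 0 s0 (fun t _ => dF t); rewrite mul0r /F !scale_mul => H.
suff : f s - (g 0 * s + C / 2 * (s * s)) - (f 0 - (g 0 * 0 + C / 2 * (0 * 0))) <= 0.
  rewrite -subr_ge0 => H1; rewrite -subr_ge0; apply: le_trans H1 _.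
  by rewrite le_eqVlt; apply/orP; left; apply/eqP; field.
apply: H => t; rewrite in_itv/= => /andP[t0 _].
have := @mvt_le g _ 0 t C t0 (fun u _ => dg u) (fun u _ => hC u); lra.
Qed.

Lemma is_derive_tanh2 (t : R) :
  is_derive t (1 : R) tanh2 ((1 - tanh2 t ^+ 2) / 2).
Proof.
have h := expR_gt0 t; have n0 : expR t + 1 != 0 by rewrite gt_eqF// addr_gt0.
have de : is_derive t (1 : R) expR (expR t) by exact: is_derive_expR.
have d1 := is_deriveD de (is_derive_cst (1 : R) t 1).
have d2 := is_deriveB de (is_derive_cst (1 : R) t 1).
apply: (is_derive_eq (is_deriveM d2 (is_derive_inv d1 n0))).
by rewrite /tanh2 !scale_mul ?fctE; field.
Qed.

End Calculus.

Section DeriveScale.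
Context {R : realType} {H : normedModType R}.

Lemma is_derive_scale (f : R -> R) (df t : R) (v : H) :
  is_derive t (1 : R) f df -> is_derive t (1 : R) (fun u => f u *: v) (df *: v).
Proof.
move=> [dv <-].
suff h : h^-1 *: (f (h *: 1 + t) *: v - f t *: v)
    @[h --> 0^'] --> ('D_1 f t) *: v.
  split; first by apply/cvg_ex; exists ('D_1 f t *: v).
  exact: cvg_lim.
have -> : (fun h : R => h^-1 *: (f (h *: 1 + t) *: v - f t *: v)) =
  (fun h => (h^-1 *: (f (h *: 1 + t) - f t)) *: v).
  by apply/funext => h; rewrite -scalerBl scalerA.
exact: cvgZr_tmp.
Qed.

End DeriveScale.

(** * Motion of [sigma c x] when the base point [c] moves *)

Section SigmaDerivative.
Context {R : realType} {H : completeNormedModType R} (ip : H -> H -> R).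
Hypothesis ip_inner : inner_product ip.
Notation sigma := (sigma ip).
Notation "''[' x , y ]" := (ip x y) (format "''[' x ,  y ]").
Let ipE := (ipDl ip_inner, ipDr ip_inner, ipNl ip_inner, ipNr ip_inner,
  ipZl ip_inner, ipZr ip_inner, ip0l ip_inner, ip0r ip_inner).
Let ipC := ipC ip_inner.
Let ipxx := ipxx ip_inner.

(* Velocity of [sigma c x] when [c] moves with velocity [v] measured in the
   conformal frame of the metric at [c]. *)
Definition dsigma (c y v : H) : H :=
  ('[v, y] *: y - v) + ('[v, y] *: c - '[c, y] *: v).

(** Stated against a fixed [eta], so that the quotient defining [sigma] is differentiated by scalar
    rules. *)
Lemma is_derive_sigma (c : R -> H) (c' x eta : H) (t : R) :
  is_derive t (1 : R) c c' -> '[c t, c t] < 1 -> '[x, x] = 1 ->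
  is_derive t (1 : R) (fun u => '[sigma (c u) x, eta])
    '[dsigma (c t) (sigma (c t) x) ((2 / (1 - '[c t, c t])) *: c'), eta].
Proof.
move=> dc c1 x1.
have -> : (fun u => '[sigma (c u) x, eta]) = (fun u =>
  ((1 - '[c u, c u]) * '[x, eta] - (2 - 2 * '[c u, x]) * '[c u, eta]) *
  (1 - 2 * '[c u, x] + '[c u, c u])^-1).
  by apply/funext => u; rewrite (sigma_sphereE ip_inner _ x1) !ipE; ring.
have dcc := is_derive_ip ip_inner dc dc.
have dcx := is_derive_ipl ip_inner x dc.
have dce := is_derive_ipl ip_inner eta dc.
have d1 (k : R) := is_derive_cst k t (1 : R).
have den0 : 1 - 2 * '[c t, x] + '[c t, c t] != 0.
  by rewrite gt_eqF// poisson_den.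
have dden := is_deriveD (is_deriveB (d1 1) (is_deriveM (d1 2) dcx)) dcc.
have dnum := is_deriveB (is_deriveM (is_deriveB (d1 1) dcc) (d1 '[x, eta]))
  (is_deriveM (is_deriveB (d1 2) (is_deriveM (d1 2) dcx)) dce).
apply: (is_derive_eq (is_deriveM dnum (is_derive_inv dden den0))).
have c0 : 1 - '[c t, c t] != 0 by rewrite subr_eq0 gt_eqF.
rewrite (sigma_sphereE ip_inner _ x1) /dsigma !ipE !scale_mul ?fctE.
rewrite (ipC (c t) c').
by field; rewrite den0 c0.
Qed.

(** The first bracket of [dsigma] is a boost, minus the projection of [v] tangent to the sphere at
    [y]; the second is an infinitesimal rotation. Each is at most [|v|], whence the constant 2. *)
Lemma norm_dsigma_le (c y v : H) : '[c, c] < 1 -> '[y, y] = 1 ->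
  `|dsigma c y v| <= 2 * `|v|.
Proof.
move=> c1 y1; have nv (p : H) : '[p, p] <= '[v, v] -> `|p| <= `|v|.
  by rewrite !ipxx ler_pXn2r// nnegrE.
rewrite /dsigma (_ : 2 * _ = `|v| + `|v|); last by ring.
apply: le_trans (ler_normD _ _) _; apply: lerD; apply: nv.
  rewrite !ipE y1 (ipC y v); have := sqr_ge0 '[v, y]; lra.
(* In the rotation bracket the components of [c] and [v] along [y] cancel. The Cauchy-Schwarz
   inequality for the remaining orthogonal components bounds it by [|v| |c|]. *)
have := ip_sqr_le ip_inner (v - '[v, y] *: y) (c - '[c, y] *: y).
have := ip_ge0 ip_inner v.
rewrite !ipE y1 (ipC y v) (ipC y c) (ipC c v); nra.
Qed.

Lemma sigma_lipschitz_curve (c c' : R -> H) (s : R) (x : H) : '[x, x] = 1 ->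
  (forall t, is_derive t (1 : R) c (c' t)) ->
  (forall t, '[c t, c t] < 1) ->
  (forall t, `|(2 / (1 - '[c t, c t])) *: c' t| <= s) ->
  `|sigma (c 1) x - sigma (c 0) x| <= 2 * s.
Proof.
move=> x1 dc cb cs; set d := _ - _.
have s0 : 0 <= s by apply: le_trans (cs 0).
apply: (norm_le_ip ip_inner); first by rewrite mulr_ge0.
rewrite {1}/d (ipDl ip_inner) (ipNl ip_inner).
pose df t := '[dsigma (c t) (sigma (c t) x) ((2 / (1 - '[c t, c t])) *: c' t), d].
have := @mvt_le _ (fun t => '[sigma (c t) x, d]) df 0 1 (2 * s * `|d|) ler01.
rewrite subr0 mulr1; apply=> t; first by move=> _; exact: is_derive_sigma.
move=> _; apply: le_trans (ip_le ip_inner _ _) _; rewrite ler_wpM2r//.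
apply: le_trans (norm_dsigma_le _ (cb t) (sigma_sphere ip_inner (cb t) x1)) _.
by rewrite ler_pM2l.
Qed.

Section Boost.
Variables (e y : H).
Hypotheses (e1 : '[e, e] = 1) (y1 : '[y, y] = 1).
Let c t : H := tanh2 t *: e.
Let Y t := sigma (c t) y.

Let cc t : '[c t, c t] = tanh2 t ^+ 2.
Proof. by rewrite /c !ipE e1; ring. Qed.

Let cb t : '[c t, c t] < 1.
Proof.
have h := expR_gt0 t; have p : 0 < (expR t + 1) ^+ 2.
  by rewrite exprn_gt0// addr_gt0.
by rewrite cc /tanh2 expr_div_n ltr_pdivrMr// mul1r; nra.
Qed.

Let Y1 t : '[Y t, Y t] = 1. Proof. exact: sigma_sphere. Qed.

Let Y0 : Y 0 = y.
Proof. by rewrite /Y /c tanh20 scale0r (sigma0l ip_inner). Qed.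

(** On a ray through the origin the velocity is parallel to the base point, so the rotation bracket
    of [dsigma] vanishes. The parameter has unit hyperbolic speed. *)
Lemma is_derive_boost eta t : is_derive t (1 : R)
  (fun u => '[sigma (tanh2 u *: e) y, eta])
  ('[sigma (tanh2 t *: e) y, e] * '[sigma (tanh2 t *: e) y, eta] - '[e, eta]).
Proof.
have dc := is_derive_scale e (is_derive_tanh2 t).
apply: (is_derive_eq (is_derive_sigma eta dc (cb t) y1)).
rewrite -/(c t) -/(Y t) cc.
have := cb t; rewrite cc => h.
have -> : (2 / (1 - tanh2 t ^+ 2)) *: (((1 - tanh2 t ^+ 2) / 2) *: e) = e.
  rewrite scalerA (_ : _ * _ = 1) ?scale1r//.
  by field; rewrite subr_eq0 gt_eqF.
have := Y1 t; move: (Y t) => z z1.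
by rewrite /dsigma /c !ipE (ipC z e); ring.
Qed.

Lemma boost_taylor (s : R) : 0 <= s ->
  `|sigma (tanh2 s *: e) y - y + s *: (e - '[y, e] *: y)| <= s ^+ 2 / 2.
Proof.
move=> s0; set r := _ + _.
apply: (norm_le_ip ip_inner); first by rewrite divr_ge0 ?sqr_ge0.
pose f t := '[Y t, r]; pose g t := '[Y t, e] * '[Y t, r] - '[e, r].
pose h t := ('[Y t, e] * '[Y t, e] - '[e, e]) * '[Y t, r] +
  '[Y t, e] * ('[Y t, e] * '[Y t, r] - '[e, r]).
have df t : is_derive t (1 : R) f (g t) by exact: is_derive_boost.
have dg t : is_derive t (1 : R) g (h t).
  apply: (is_derive_eq (is_deriveB (is_deriveM (is_derive_boost e t)
     (is_derive_boost r t)) (is_derive_cst '[e, r] t (1 : R)))).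
  by rewrite /h /Y /c !scale_mul /=; ring.
have hC t : h t <= `|r|.
  (* The left factor is the second derivative of [Y]. With [k = <Y, e>] its two summands are
     orthogonal, and its squared norm is [(1 - k^2)^2 + k^2 (1 - k^2) = 1 - k^2]. *)
  have -> : h t = '[('[Y t, e] * '[Y t, e] - '[e, e]) *: Y t +
      '[Y t, e] *: ('[Y t, e] *: Y t - e), r].
    by rewrite /h; move: (Y t) => z; rewrite !ipE; ring.
  apply: le_trans (ip_le ip_inner _ _) _; rewrite ler_piMl//.
  rewrite -(@ler_pXn2r _ 2)// ?nnegrE// expr1n -ipxx.
  have h2 := Y1 t; have := ip_sqr_le ip_inner (Y t) e; rewrite h2 e1 => h1.
  move: (Y t) h1 h2 => z h1 z1; rewrite !ipE z1 e1 (ipC e z).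
  have := sqr_ge0 '[z, e]; nra.
have := taylor2_le s0 df dg hC; rewrite /f /g Y0.
rewrite -/(c s) -/(Y s) => hh.
have -> : '[r, r] = '[Y s, r] - '[y, r] - s * ('[y, e] * '[y, r] - '[e, r]).
  rewrite {1}/r -/(c s) -/(Y s); move: (Y s) => z; rewrite !ipE; ring.
by rewrite [leRHS]mulrC mulrA.
Qed.

Lemma boost_sqr_le (s : R) (X : H) : 0 <= s ->
  '[sigma (tanh2 s *: e) y, X] ^+ 2 <= '[y, X] ^+ 2 + s * '[X, X].
Proof.
move=> s0; pose f t := '[Y t, X] * '[Y t, X].
pose g t := 2 * '[Y t, X] * ('[Y t, e] * '[Y t, X] - '[e, X]).
have df t : is_derive t (1 : R) f (g t).
  apply: (is_derive_eq (is_deriveM (is_derive_boost X t) (is_derive_boost X t))).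
  by rewrite /g /Y /c !scale_mul; ring.
have gC t : g t <= '[X, X].
  rewrite /g; have h2 := Y1 t; have := ip_sqr_le ip_inner (Y t) e; rewrite h2 e1 => h1.
  move: (Y t) h1 h2 => z h1 z1.
  (* With [b = <z, X>] and [p = <e, X> - <z, e> b], the derivative is [-2 b p <= b^2 + p^2]. A
     Bessel inequality for [z] and the orthogonal vector [e - <z, e> z], of length at most one,
     bounds this by [<X, X>]. *)
  have := ip_ge0 ip_inner (X - '[z, X] *: z - ('[e, X] - '[z, e] * '[z, X]) *: (e - '[z, e] *: z)).
  rewrite !ipE z1 e1 (ipC e z) (ipC X z) (ipC X e).
  have := sqr_ge0 '[z, e]; have := sqr_ge0 ('[z, X] + ('[e, X] - '[z, e] * '[z, X])).
  have := sqr_ge0 ('[e, X] - '[z, e] * '[z, X]).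
  move: '[X, X] '[z, X] '[e, X] '[z, e] h1 => a b d k; nra.
have := @mvt_le _ f g 0 s '[X, X] s0 (fun t _ => df t) (fun t _ => gC t).
by rewrite subr0 /f Y0 -!expr2 lerBlDl mulrC.
Qed.

End Boost.

End SigmaDerivative.

(** * The geodesic equation in the chart, and uniqueness of geodesics *)

Section Geodesics.
Context {R : realType} {H : completeNormedModType R} (ip : H -> H -> R).
Hypothesis ip_inner : inner_product ip.
Notation sigma := (sigma ip).
Notation "''[' x , y ]" := (ip x y) (format "''[' x ,  y ]").
Let ipE := (ipDl ip_inner, ipDr ip_inner, ipNl ip_inner, ipNr ip_inner,
  ipZl ip_inner, ipZr ip_inner, ip0l ip_inner, ip0r ip_inner).
Let ipC := ipC ip_inner.
Let ipxx := ipxx ip_inner.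

Lemma metricE w X Y : metric ip w X Y = 4 / (1 - '[w, w]) ^+ 2 * '[X, Y].
Proof. by rewrite /metric ipxx. Qed.

Lemma derive_line (V : normedModType R) (f : H -> V) (w X : H) (d : V) :
  is_derive (0 : R) (1 : R) (fun t : R => f (t *: X + w)) d -> 'D_X f w = d.
Proof.
move=> [_ <-]; rewrite /derive; congr (lim (_ @ 0^')); apply/funext => h /=.
by rewrite addr0 scale0r add0r [h *: 1]mulr1.
Qed.

Lemma is_derive_line (w X : H) (t : R) :
  is_derive t (1 : R) (fun u : R => u *: X + w) X.
Proof.
apply: (is_derive_eq (is_deriveD (is_derive_scale X (is_derive_id t (1 : R)))
  (is_derive_cst w t (1 : R)))).
by rewrite scale1r addr0.
Qed.

Lemma derive_metric (w X Y Z : H) : '[w, w] < 1 ->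
  'D_X (fun u => metric ip u Y Z) w =
  16 * '[w, X] * '[Y, Z] / (1 - '[w, w]) ^+ 3.
Proof.
move=> w1; apply: derive_line.
pose q := fun t : R => (1 - '[t *: X + w, t *: X + w])^-1.
rewrite (_ : (fun t => _) = (fun t => (4 * '[Y, Z]) *: (q t * q t))); last first.
  by apply/funext => t; rewrite metricE scale_mul /q expr2 invfM; ring.
have dl := is_derive_line w X 0.
have w0 : 1 - '[w, w] != 0 by rewrite subr_eq0 gt_eqF.
have n0 : 1 - '[0 *: X + w, 0 *: X + w] != 0 by rewrite scale0r add0r.
have dq := is_derive_inv (is_deriveB (is_derive_cst (1 : R) (0 : R) (1 : R))
  (is_derive_ip ip_inner dl dl)) n0.
apply: (is_derive_eq (is_deriveZ (4 * '[Y, Z]) (is_deriveM dq dq))).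
rewrite /q !scale_mul ?fctE scale0r !add0r (ipC X w).
by field.
Qed.

Lemma christoffelE (w X Y : H) : '[w, w] < 1 ->
  christoffel ip w X Y = (2 / (1 - '[w, w])) *:
    ('[w, X] *: Y + '[w, Y] *: X - '[X, Y] *: w).
Proof.
move=> w1; have w0 : 1 - '[w, w] != 0 by rewrite subr_eq0 gt_eqF.
set G0 := (X in _ = X).
have isC : is_christoffel ip w X Y G0.
  move=> Z; rewrite !derive_metric// metricE /G0 !ipE.
  by rewrite (ipC X Z) (ipC Y Z) (ipC w Z); field.
have ex : exists G, is_christoffel ip w X Y G by exists G0.
have hG := @xgetPex _ 0 (is_christoffel ip w X Y) ex.
apply: (ip_inj ip_inner) => Z.
have := hG Z; rewrite -(isC Z) !metricE.
have c0 : 2 * (4 / (1 - '[w, w]) ^+ 2) != 0.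
  by rewrite !mulf_neq0// ?invr_eq0 ?expf_neq0// pnatr_eq0.
by rewrite mulrA [in RHS]mulrA => /(mulfI c0).
Qed.

Lemma derive1_is (c c' : R -> H) : (forall t, is_derive t (1 : R) c (c' t)) ->
  derive1 c = c'.
Proof. by move=> h; apply/funext => t; rewrite derive1E; case: (h t). Qed.

Lemma geodesicP (c c' c'' : R -> H) :
  (forall t, is_derive t (1 : R) c (c' t)) ->
  (forall t, is_derive t (1 : R) c' (c'' t)) ->
  (forall t, '[c t, c t] < 1) ->
  (forall t, c'' t = - ((2 / (1 - '[c t, c t])) *:
    ((2 * '[c t, c' t]) *: c' t - '[c' t, c' t] *: c t))) ->
  geodesic ip c.
Proof.
move=> dc dc' cb eq t; rewrite (derive1_is dc) (derive1_is dc'); split.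
- exact/(ball_ip ip_inner).
- by case: (dc t).
- by case: (dc' t).
rewrite christoffelE// eq -scalerDl -mulr2n (_ : '[c t, c' t] *+ 2 = 2 * '[c t, c' t]).
  by rewrite addrC subrr.
by ring.
Qed.

Lemma geodesic_ode c : geodesic ip c -> exists c' c'' : R -> H,
  [/\ forall t, is_derive t (1 : R) c (c' t),
      forall t, is_derive t (1 : R) c' (c'' t),
      forall t, '[c t, c t] < 1,
      derive1 c = c' &
      forall t, c'' t = - ((2 / (1 - '[c t, c t])) *:
        ((2 * '[c t, c' t]) *: c' t - '[c' t, c' t] *: c t))].
Proof.
move=> gc; exists (derive1 c), (derive1 (derive1 c)).
have cb t : '[c t, c t] < 1 by apply/(ball_ip ip_inner); case: (gc t).
split => // t.
- by case: (gc t) => _ h _ _; rewrite derive1E; exact: derivableP.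
- by case: (gc t) => _ _ h _; rewrite derive1E; exact: derivableP.
case: (gc t) => _ _ _ /eqP; rewrite addr_eq0 => /eqP ->; congr (- _).
rewrite christoffelE// -scalerDl -mulr2n (_ : '[c t, derive1 c t] *+ 2 = 2 * '[c t, derive1 c t])//.
by ring.
Qed.

(** Linearises the geodesic equation. [(rho - 1, rho c)] is the hyperboloid point over [c], and
    along a geodesic each of its coordinates satisfies [p'' = speed2 * p] with the constant
    [speed2]. *)
Lemma geodesic_first_integrals (c c' c'' : R -> H) :
  (forall t, is_derive t (1 : R) c (c' t)) ->
  (forall t, is_derive t (1 : R) c' (c'' t)) ->
  (forall t, '[c t, c t] < 1) ->
  (forall t, c'' t = - ((2 / (1 - '[c t, c t])) *:
    ((2 * '[c t, c' t]) *: c' t - '[c' t, c' t] *: c t))) ->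
  let rho t := 2 / (1 - '[c t, c t]) in
  let speed2 := rho 0 ^+ 2 * '[c' 0, c' 0] in
  [/\ forall t, rho t ^+ 2 * '[c' t, c' t] = speed2,
      forall t, is_derive t (1 : R) (fun u => rho u - 1) (rho t ^+ 2 * '[c t, c' t]),
      forall t, is_derive t (1 : R) (fun u => rho u ^+ 2 * '[c u, c' u])
        (speed2 * (rho t - 1)),
      forall eta t, is_derive t (1 : R) (fun u => rho u * '[c u, eta])
        (rho t ^+ 2 * '[c t, c' t] * '[c t, eta] + rho t * '[c' t, eta]) &
      forall eta t, is_derive t (1 : R)
        (fun u => rho u ^+ 2 * '[c u, c' u] * '[c u, eta] + rho u * '[c' u, eta])
        (speed2 * (rho t * '[c t, eta]))].
Proof.
move=> dc dc' cb eqc rho speed2.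
have n0 t : 1 - '[c t, c t] != 0 by rewrite subr_eq0 gt_eqF.
have drho t : is_derive t (1 : R) rho (rho t ^+ 2 * '[c t, c' t]).
  apply: (is_derive_eq (is_deriveM (is_derive_cst (2 : R) t (1 : R))
    (is_derive_inv (is_deriveB (is_derive_cst (1 : R) t (1 : R))
    (is_derive_ip ip_inner (dc t) (dc t))) (n0 t)))).
  by rewrite /rho !scale_mul ?fctE (ipC (c' t) (c t)); field.
have dE t : is_derive t (1 : R) (fun u => rho u ^+ 2 * '[c' u, c' u]) 0.
  apply: (is_derive_eq (is_deriveM (is_deriveX 2 (drho t))
    (is_derive_ip ip_inner (dc' t) (dc' t)))).
  rewrite eqc /rho !scale_mul ?fctE !ipE (ipC (c' t) (c t)).
  by field.
have E t : rho t ^+ 2 * '[c' t, c' t] = speed2 by rewrite (is_derive_const dE).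
have drho' t : is_derive t (1 : R) (fun u => rho u ^+ 2 * '[c u, c' u])
    (speed2 * (rho t - 1)).
  apply: (is_derive_eq (is_deriveM (is_deriveX 2 (drho t))
    (is_derive_ip ip_inner (dc t) (dc' t)))).
  rewrite -(E t) eqc /rho !scale_mul ?fctE !ipE.
  by field.
split => //.
- move=> t; apply: (is_derive_eq (is_deriveB (drho t) (is_derive_cst (1 : R) t (1 : R)))).
  by rewrite subr0.
- move=> eta t; apply: (is_derive_eq (is_deriveM (drho t) (is_derive_ipl ip_inner eta (dc t)))).
  by rewrite !scale_mul; ring.
move=> eta t; apply: (is_derive_eq (is_deriveD
  (is_deriveM (drho' t) (is_derive_ipl ip_inner eta (dc t)))
  (is_deriveM (drho t) (is_derive_ipl ip_inner eta (dc' t))))).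
rewrite -(E t) eqc /rho !scale_mul ?fctE !ipE.
by field.
Qed.

(** [expmap] is an arbitrary choice among endpoints of geodesics with the given initial data; this
    makes the choice unambiguous. The lifted coordinates agree by [second_order_ode], first [rho]
    and then [rho c]. *)
Lemma geodesic_unique (c1 c2 : R -> H) : geodesic ip c1 -> geodesic ip c2 ->
  c1 0 = c2 0 -> derive1 c1 0 = derive1 c2 0 -> c1 = c2.
Proof.
move=> /geodesic_ode[v1 [a1 [d1 d1' b1 -> eq1]]].
move=> /geodesic_ode[v2 [a2 [d2 d2' b2 -> eq2]]] e0 e1.
have [E1 f1 g1 p1 q1] := geodesic_first_integrals d1 d1' b1 eq1.
have [E2 f2 g2 p2 q2] := geodesic_first_integrals d2 d2' b2 eq2.
apply/funext => t; apply: (ip_inj ip_inner) => eta.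
have rho_gt0 (c : R -> H) u : '[c u, c u] < 1 -> 0 < 2 / (1 - '[c u, c u]).
  by move=> h; rewrite divr_gt0// subr_gt0.
move: E1 f1 g1 p1 q1 E2 f2 g2 p2 q2 => /=.
rewrite -e0 -e1; set k := _ ^+ 2 * '[v1 0, v1 0].
move=> E1 f1 g1 p1 q1 E2 f2 g2 p2 q2.
(* The explicit solutions divide by the speed, so zero speed is separate: both curves are
   constant. *)
have [k0|k0] := eqVneq k 0.
  have v0 (c v : R -> H) u : '[c u, c u] < 1 ->
      (2 / (1 - '[c u, c u])) ^+ 2 * '[v u, v u] = k -> v u = 0.
    move=> h /eqP; rewrite k0 mulf_eq0 sqrf_eq0 gt_eqF ?rho_gt0//=.
    by move=> /eqP /(ip_eq0 ip_inner).
  have cst (c v : R -> H) : (forall u, '[c u, c u] < 1) ->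
      (forall u, (2 / (1 - '[c u, c u])) ^+ 2 * '[v u, v u] = k) ->
      (forall u, is_derive u (1 : R) c (v u)) -> '[c t, eta] = '[c 0, eta].
    move=> h h' dc; apply: (@is_derive_const _ (fun u => '[c u, eta])) => u.
    apply: (is_derive_eq (is_derive_ipl ip_inner eta (dc u))).
    by rewrite (v0 c v u (h u) (h' u)) (ip0l ip_inner).
  by rewrite (cst c1 v1)// (cst c2 v2)// e0.
have kp : 0 < k.
  by rewrite lt_def k0 mulr_ge0 ?sqr_ge0// (ip_ge0 ip_inner).
pose s := Num.sqrt k; have s0 : s != 0 by rewrite gt_eqF// sqrtr_gt0.
have ks : k = s ^+ 2 by rewrite sqr_sqrtr// ltW.
rewrite ks in g1 q1 g2 q2.
have F1 := second_order_ode s0 f1 g1 t.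
have F2 := second_order_ode s0 f2 g2 t.
have P1 := second_order_ode s0 (p1 eta) (q1 eta) t.
have P2 := second_order_ode s0 (p2 eta) (q2 eta) t.
move: F1 F2 P1 P2; rewrite -e0 -e1 => <- F2 <- P2.
have := rho_gt0 c1 t (b1 t) => r0.
have er : 2 / (1 - '[c1 t, c1 t]) = 2 / (1 - '[c2 t, c2 t]) by lra.
by move: P2; rewrite -er => /(mulfI (lt0r_neq0 r0)) ->.
Qed.

End Geodesics.

(** * Existence: the geodesic from [w] in direction [e] *)

Section GeodesicLine.
Context {R : realType} {H : completeNormedModType R} (ip : H -> H -> R).
Hypothesis ip_inner : inner_product ip.
Notation sigma := (sigma ip).
Notation "''[' x , y ]" := (ip x y) (format "''[' x ,  y ]").
Let ipE := (ipDl ip_inner, ipDr ip_inner, ipNl ip_inner, ipNr ip_inner,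
  ipZl ip_inner, ipZr ip_inner, ip0l ip_inner, ip0r ip_inner).
Let ipC := ipC ip_inner.
Variables (w e : H) (s : R).
Hypotheses (w1 : '[w, w] < 1) (e1 : '[e, e] = 1).

(* [(f t, N t)] is the speed-[s] geodesic of the hyperboloid that projects
   to the geodesic from [w] in direction [e]; the projection is [N / (1 + f)]. *)
Let rho : R := 2 / (1 - '[w, w]).
Let k : R := rho * '[w, e].
Let f (t : R) : R := (rho - 1) * cosh (s * t) + k * sinh (s * t).
Let f1 (t : R) : R := (rho - 1) * sinh (s * t) + k * cosh (s * t).
Let A (t : R) : R := rho * cosh (s * t) + k * sinh (s * t).
Let A1 (t : R) : R := rho * sinh (s * t) + k * cosh (s * t).
Let a t := A t / (1 + f t).
Let b t := sinh (s * t) / (1 + f t).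
Let a1 t := s * (A1 t - a t * f1 t) / (1 + f t).
Let b1 t := s * (cosh (s * t) - b t * f1 t) / (1 + f t).
Let c t : H := a t *: w + b t *: e.
Let c1 t : H := a1 t *: w + b1 t *: e.

Let w0 : 1 - '[w, w] != 0. Proof. by rewrite subr_eq0 gt_eqF. Qed.

Let tau_lt1 (t : R) : 0 < 1 - tanh2 t ^+ 2.
Proof.
have h := expR_gt0 t; have p : 0 < (expR t + 1) ^+ 2.
  by rewrite exprn_gt0// addr_gt0.
by rewrite /tanh2 expr_div_n subr_gt0 ltr_pdivrMr// mul1r; nra.
Qed.

Let den t : 0 < sigma_den ip (- w) (tanh2 (s * t) *: e).
Proof.
apply: (sigma_den_gt0 ip_inner); first by rewrite ipNN.
by rewrite !ipE e1 mulr1 -expr2 -subr_ge0 ltW.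
Qed.

Let fE t : 1 + f t = 2 * sigma_den ip (- w) (tanh2 (s * t) *: e) /
  ((1 - '[w, w]) * (1 - tanh2 (s * t) ^+ 2)).
Proof.
rewrite (sigma_denN ip_inner) !ipE e1 /f /k /rho cosh_tanh2 sinh_tanh2.
by field; rewrite w0 gt_eqF.
Qed.

Let f_gt0 t : 0 < 1 + f t.
Proof. by rewrite fE divr_gt0 ?mulr_gt0 ?subr_gt0// -subr_gt0. Qed.

Let f0 t : 1 + f t != 0. Proof. by rewrite gt_eqF. Qed.

Let cE t : c t = sigma (- w) (tanh2 (s * t) *: e).
Proof.
have d0 := den t; have tau := tau_lt1 (s * t).
apply: (ip_inj ip_inner) => y; rewrite (sigmaE ip_inner) /c /a /b fE.
move: d0; rewrite (sigma_denN ip_inner) (ipNN ip_inner) !ipE e1 mulr1 /A /k /rho.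
rewrite cosh_tanh2 sinh_tanh2 => d0.
by field; rewrite w0 !gt_eqF.
Qed.

Let df t : is_derive t (1 : R) (fun u => 1 + f u) (s * f1 t).
Proof.
apply: (is_derive_eq (is_deriveD (is_derive_cst (1 : R) t (1 : R)) (is_deriveD
  (is_deriveZ (rho - 1) (is_derive_cosh s t)) (is_deriveZ k (is_derive_sinh s t))))).
by rewrite /f1 !scale_mul; ring.
Qed.

Let df1 t : is_derive t (1 : R) f1 (s * f t).
Proof.
apply: (is_derive_eq (is_deriveD
  (is_deriveZ (rho - 1) (is_derive_sinh s t)) (is_deriveZ k (is_derive_cosh s t)))).
by rewrite /f !scale_mul; ring.
Qed.

Let dA t : is_derive t (1 : R) A (s * A1 t).
Proof.
apply: (is_derive_eq (is_deriveD
  (is_deriveZ rho (is_derive_cosh s t)) (is_deriveZ k (is_derive_sinh s t)))).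
by rewrite /A1 !scale_mul; ring.
Qed.

Let dA1 t : is_derive t (1 : R) A1 (s * A t).
Proof.
apply: (is_derive_eq (is_deriveD
  (is_deriveZ rho (is_derive_sinh s t)) (is_deriveZ k (is_derive_cosh s t)))).
by rewrite /A !scale_mul; ring.
Qed.

(** The equation for [P / (1 + f)] is linear and has the same coefficients for every lifted
    coordinate [P], so it passes from the coefficients [a] and [b] to the curve [c]. *)
Let projection_derive (P P1 : R -> R) :
  (forall t, is_derive t (1 : R) P (s * P1 t)) ->
  (forall t, is_derive t (1 : R) P1 (s * P t)) ->
  let p t := P t / (1 + f t) in
  let p1 t := s * (P1 t - p t * f1 t) / (1 + f t) in
  (forall t, is_derive t (1 : R) p (p1 t)) /\
  (forall t, is_derive t (1 : R) p1
     (s ^+ 2 * p t / (1 + f t) - 2 * s * f1 t / (1 + f t) * p1 t)).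
Proof.
move=> dP dP1 p p1.
have dp t : is_derive t (1 : R) p (p1 t).
  apply: (is_derive_eq (is_deriveM (dP t) (is_derive_inv (df t) (f0 t)))).
  by rewrite /p1 /p !scale_mul ?fctE; field; rewrite ?f0 ?pnatr_eq0.
split=> // t.
apply: (is_derive_eq (is_deriveM (is_deriveZ s (is_deriveB (dP1 t)
  (is_deriveM (dp t) (df1 t)))) (is_derive_inv (df t) (f0 t)))).
by rewrite /p1 /p !scale_mul ?fctE ?scale_mul /= ?scale_mul; field; rewrite ?f0 ?pnatr_eq0.
Qed.

Let dc t : is_derive t (1 : R) c (c1 t).
Proof.
have [da _] := projection_derive dA dA1.
have [db _] := projection_derive (is_derive_sinh s) (is_derive_cosh s).
exact: (is_deriveD (is_derive_scale w (da t)) (is_derive_scale e (db t))).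
Qed.

Let dc1 t : is_derive t (1 : R) c1
  ((s ^+ 2 / (1 + f t)) *: c t - (2 * s * f1 t / (1 + f t)) *: c1 t).
Proof.
have [_ da] := projection_derive dA dA1.
have [_ db] := projection_derive (is_derive_sinh s) (is_derive_cosh s).
apply: (is_derive_eq (is_deriveD (is_derive_scale w (da t)) (is_derive_scale e (db t)))).
apply: (ip_inj ip_inner) => y; rewrite -/(a t) -/(b t) -/(a1 t) -/(b1 t).
by rewrite /c /c1 !ipE; ring.
Qed.

(** With [NN1] and [N1N1]: the lift stays on the hyperboloid, its velocity is tangent, and that
    velocity has Lorentz length [s]. *)
Let NN t : '[A t *: w + sinh (s * t) *: e, A t *: w + sinh (s * t) *: e] = f t ^+ 2 - 1.
Proof.
rewrite !ipE e1 (ipC e w) /A /f /k /rho.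
rewrite cosh_tanh2 sinh_tanh2; have := tau_lt1 (s * t) => tau.
by field; rewrite w0 gt_eqF.
Qed.

Let NN1 t : '[A t *: w + sinh (s * t) *: e, A1 t *: w + cosh (s * t) *: e] = f t * f1 t.
Proof.
rewrite !ipE e1 (ipC e w) /A /A1 /f /f1 /k /rho.
rewrite cosh_tanh2 sinh_tanh2; have := tau_lt1 (s * t) => tau.
by field; rewrite w0 gt_eqF.
Qed.

Let N1N1 t : '[A1 t *: w + cosh (s * t) *: e, A1 t *: w + cosh (s * t) *: e] = f1 t ^+ 2 + 1.
Proof.
rewrite !ipE e1 (ipC e w) /A1 /f1 /k /rho.
rewrite cosh_tanh2 sinh_tanh2; have := tau_lt1 (s * t) => tau.
by field; rewrite w0 gt_eqF.
Qed.

Let cN t : c t = (1 + f t)^-1 *: (A t *: w + sinh (s * t) *: e).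
Proof. by rewrite scalerDr !scalerA /c /a /b ![_^-1 * _]mulrC. Qed.

Let c1N t : c1 t = (s / (1 + f t)) *:
  ((A1 t *: w + cosh (s * t) *: e) - f1 t *: c t).
Proof.
apply: (ip_inj ip_inner) => y.
by rewrite /c1 /c /a1 /b1 !ipE; ring.
Qed.

Let cc t : '[c t, c t] = 1 - 2 / (1 + f t).
Proof. by rewrite cN (ipZl ip_inner) (ipZr ip_inner) NN; field; rewrite ?f0 ?pnatr_eq0. Qed.

Let cN1 t : '[c t, A1 t *: w + cosh (s * t) *: e] = f t * f1 t / (1 + f t).
Proof. by rewrite cN (ipZl ip_inner) NN1 mulrC. Qed.

Let cc1 t : '[c t, c1 t] = s * f1 t / (1 + f t) ^+ 2.
Proof.
rewrite c1N (ipZr ip_inner) (ipDr ip_inner) (ipNr ip_inner) (ipZr ip_inner) cN1 cc.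
by field; rewrite ?f0 ?pnatr_eq0.
Qed.

Let c1c1 t : '[c1 t, c1 t] = s ^+ 2 / (1 + f t) ^+ 2.
Proof.
rewrite c1N; have := N1N1 t; have := cN1 t; have := cc t.
move: (_ + _ *: e) (c t) => N1 z h1 h2 h3.
rewrite !ipE (ipC N1 z) h1 h2 h3.
by field; rewrite ?f0 ?pnatr_eq0.
Qed.

(** The geodesic is the image under [sigma (- w)] of a ray from [0]. Its initial direction is still
    [e] because the derivative of [sigma (- w)] at [0] is a positive multiple of the identity. *)
Lemma geodesic_line : exists c c' : R -> H,
  [/\ geodesic ip c, forall t, is_derive t (1 : R) c (c' t),
      forall t, c t = sigma (- w) (tanh2 (s * t) *: e),
      c' 0 = (s * (1 - '[w, w]) / 2) *: e &
      forall t, (2 / (1 - '[c t, c t])) ^+ 2 * '[c' t, c' t] = s ^+ 2].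
Proof.
exists c, c1; split => //.
- apply: (geodesicP ip_inner dc dc1) => t.
    by rewrite cc gtrBl divr_gt0.
  rewrite cc cc1 c1c1; apply: (ip_inj ip_inner) => y.
  move: (c t) (c1 t) => z z1; rewrite !ipE.
  by field; rewrite f0 (_ : _ - _ = 2) ?pnatr_eq0//; ring.
- apply: (ip_inj ip_inner) => y; rewrite /c1 /a1 /b1 /a /b /A /A1 /f /f1.
  rewrite mulr0 cosh0 sinh0 !ipE /k /rho.
  by field; rewrite w0 (_ : _ + (_ + _) = 2) ?pnatr_eq0//; ring.
- by move=> t; rewrite cc c1c1; field; rewrite f0 (_ : _ - _ = 2) ?pnatr_eq0//; ring.
Qed.

End GeodesicLine.

(** * Exponential map, directors, and geodesic distance in closed form *)

Section ExponentialMap.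
Context {R : realType} {H : completeNormedModType R} (ip : H -> H -> R).
Hypothesis ip_inner : inner_product ip.
Notation sigma := (sigma ip).
Notation "''[' x , y ]" := (ip x y) (format "''[' x ,  y ]").
Let ipE := (ipDl ip_inner, ipDr ip_inner, ipNl ip_inner, ipNr ip_inner,
  ipZl ip_inner, ipZr ip_inner, ip0l ip_inner, ip0r ip_inner).
Let ipxx := ipxx ip_inner.

Lemma cvg_sigma (T : Type) (F : set_system T) (FF : Filter F) (f : T -> H) w z :
  sigma_den ip w z != 0 -> f @ F --> z ->
  (fun t => sigma w (f t)) @ F --> sigma w z.
Proof.
move=> d0 fz; rewrite (sigmaE ip_inner).
rewrite (_ : (fun t => _) = (fun t => (sigma_den ip w (f t))^-1 *:
  ((1 - '[w, w]) *: f t - (1 + '[f t, f t] - 2 * '[w, f t]) *: w))); last first.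
  by apply/funext => t; rewrite (sigmaE ip_inner).
have c (k : H) : (fun=> k) @ F --> k by exact: cvg_cst.
have cr (k : R) : (fun=> k) @ F --> k by exact: cvg_cst.
have wf : (fun t => 2 * '[w, f t]) @ F --> 2 * '[w, z].
  by apply: cvgM => //; apply: (cvg_ip ip_inner).
have ff : (fun t => '[f t, f t]) @ F --> '[z, z] by apply: (cvg_ip ip_inner).
apply: cvgZ.
  apply: cvgV => //; apply: cvgD; first exact: cvgB.
  exact: cvgM.
apply: cvgB; apply: cvgZ => //.
by apply: cvgB => //; apply: cvgD.
Qed.

Lemma tanh2_sqr_lt1 (e : H) (t : R) : '[e, e] = 1 ->
  '[tanh2 t *: e, tanh2 t *: e] < 1.
Proof.
move=> e1; rewrite !ipE e1 mulr1 -expr2.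
have h := expR_gt0 t; have p : 0 < (expR t + 1) ^+ 2.
  by rewrite exprn_gt0// addr_gt0.
by rewrite /tanh2 expr_div_n ltr_pdivrMr// mul1r; nra.
Qed.

Lemma expmap_polar (w e : H) (s : R) : '[w, w] < 1 -> '[e, e] = 1 ->
  expmap ip w ((s * (1 - '[w, w]) / 2) *: e) = sigma (- w) (tanh2 s *: e).
Proof.
move=> w1 e1; have [c [c' [gc dc cE c'0 _]]] := geodesic_line ip_inner s w1 e1.
have c0 : c 0 = w.
  by rewrite cE mulr0 tanh20 scale0r (sigma0 ip_inner) opprK.
have c1 : c 1 = sigma (- w) (tanh2 s *: e) by rewrite cE mulr1.
set v := (_ *: e); pose P := [set z | exists d, [/\ geodesic ip d, d 0 = w, derive1 d 0 = v & d 1 = z]].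
have ex : exists z, P z.
  by exists (c 1), c; split => //; rewrite (derive1_is dc) c'0.
have [d [gd d0 dd0 d1]] := @xgetPex _ 0 P ex.
rewrite /expmap -[LHS]d1.
by rewrite -c1 (geodesic_unique ip_inner gd gc) ?d0 ?c0// dd0 (derive1_is dc) c'0.
Qed.

Lemma metric_normE w X : '[w, w] < 1 -> metric_norm ip w X = 2 / (1 - '[w, w]) * `|X|.
Proof.
move=> w1; rewrite /metric_norm (metricE ip_inner) (ipxx X).
have -> : 4 / (1 - '[w, w]) ^+ 2 * `|X| ^+ 2 = (2 / (1 - '[w, w]) * `|X|) ^+ 2.
  by field; rewrite subr_eq0 gt_eqF.
by rewrite sqrtr_sqr ger0_norm// mulr_ge0// divr_ge0// subr_ge0 ltW.
Qed.

Hypothesis nontrivial : exists x : H, `|x| = 1.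

Lemma unit_direction (v : H) : exists2 e, '[e, e] = 1 & v = `|v| *: e.
Proof.
have [->|v0] := eqVneq v 0.
  by have [x x1] := nontrivial; exists x; rewrite ?ipxx ?x1 ?expr1n// normr0 scale0r.
exists (`|v|^-1 *: v); last by rewrite scalerA divff ?scale1r// normr_eq0.
by rewrite !ipE ipxx; field; rewrite normr_eq0.
Qed.

Lemma expmapE w v : '[w, w] < 1 -> exists2 e, '[e, e] = 1 /\ v = `|v| *: e &
  expmap ip w v = sigma (- w) (tanh2 (metric_norm ip w v) *: e).
Proof.
move=> w1; have [e e1 ve] := unit_direction v; exists e => //.
rewrite -(expmap_polar _ w1 e1) metric_normE// {1}ve; congr (expmap ip w (_ *: _)).
by field; rewrite subr_eq0 gt_eqF.
Qed.

Lemma cvg_ray w e : '[w, w] < 1 -> '[e, e] = 1 ->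
  (fun t : R => sigma (- w) (tanh2 t *: e)) @ +oo --> sigma (- w) e.
Proof.
move=> w1 e1; apply: cvg_sigma.
  by rewrite (sigma_den_neq0 ip_inner) ?e1// (ipNN ip_inner).
rewrite -[X in _ --> X]scale1r; apply: cvgZr_tmp; exact: cvg_tanh2.
Qed.

(** The unit-speed geodesic from [w] in direction [e] tends to [sigma (- w) e], and [sigma w]
    inverts this on the sphere. That settles existence and uniqueness of the direction with limit
    [x]. *)
Lemma directorE (x w : H) : '[w, w] < 1 -> '[x, x] = 1 ->
  director ip x w = ((1 - '[w, w]) / 2) *: sigma w x.
Proof.
move=> w1 x1; have w0 : 0 < 1 - '[w, w] by rewrite subr_gt0.
have nw1 : '[- w, - w] < 1 by rewrite (ipNN ip_inner).
have s1 := sigma_sphere ip_inner w1 x1.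
have ray e t : t *: (((1 - '[w, w]) / 2) *: e) = (t * (1 - '[w, w]) / 2) *: e.
  by rewrite scalerA mulrA.
pose P := [set v | metric_norm ip w v = 1 /\ expmap ip w (t *: v) @[t --> +oo] --> x].
have ex : exists v, P v.
  exists (((1 - '[w, w]) / 2) *: sigma w x); split.
    rewrite metric_normE// normrZ ger0_norm ?divr_ge0 ?(ltW w0)//.
    rewrite (_ : `|sigma w x| = 1); last by apply/(sphere_ip ip_inner).
    by field; rewrite gt_eqF.
  rewrite (_ : (fun t => _) = (fun t : R => sigma (- w) (tanh2 t *: sigma w x))); last first.
    by apply/funext => t; rewrite ray expmap_polar.
  by rewrite -[X in _ --> X](@sigmaK _ _ _ ip_inner w x w1) ?x1//; exact: cvg_ray.
have [v1 vx] := @xgetPex _ 0 P ex.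
rewrite -/P -/(director ip x w) in v1 vx *; set v := director ip x w.
rewrite -/v in v1 vx.
have [e e1 ve] := unit_direction v.
have nv : `|v| = (1 - '[w, w]) / 2.
  move: v1; rewrite metric_normE// => h.
  transitivity ((1 - '[w, w]) / 2 * (2 / (1 - '[w, w]) * `|v|)).
    by field; rewrite gt_eqF.
  by rewrite h mulr1.
have : (fun t : R => sigma (- w) (tanh2 t *: e)) @ +oo --> x.
  rewrite (_ : (fun t => _) = (fun t => expmap ip w (t *: v)))//.
  by apply/funext => t; rewrite ve nv ray expmap_polar.
move=> /(cvg_unique (@norm_hausdorff _ H) (cvg_ray w1 e1)) xe.
by rewrite ve nv -xe (sigmaNK ip_inner) ?e1.
Qed.

(** [sigma a] moves [a] to [0], where geodesics are rays; the ray to [sigma a b] is carried back. *)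
Lemma geodesic_between (a b : H) : '[a, a] < 1 -> '[b, b] < 1 ->
  exists s c c', [/\ 0 <= s, cosh s = coshdist ip a b, c 0 = a, c 1 = b &
    [/\ geodesic ip c, forall t, is_derive t (1 : R) c (c' t),
        forall t, '[c t, c t] < 1 &
        forall t, metric_norm ip (c t) (c' t) = s]].
Proof.
move=> a1 b1; set z := sigma a b.
have z1 : '[z, z] < 1 by exact: sigma_ball.
have [e e1 ze] := unit_direction z.
have [|s s0 ts] := @tanh2_surj _ `|z|.
  by rewrite normr_ge0 /=; apply/(ball_ip ip_inner).
have [c [c' [gc dc cE c'0 sp]]] := geodesic_line ip_inner s a1 e1.
have cb t : '[c t, c t] < 1.
  by rewrite cE (sigma_ball ip_inner)// ?(ipNN ip_inner)// tanh2_sqr_lt1.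
have bE : b = sigma (- a) z by rewrite (sigmaK ip_inner)// ltW.
exists s, c, c'; split => //.
- by rewrite bE coshdist_sigma// cosh_tanh2 ts ipxx.
- by rewrite cE mulr0 tanh20 scale0r (sigma0 ip_inner) opprK.
- by rewrite cE mulr1 ts -ze.
split => // t; have := sp t; rewrite metric_normE// (ipxx (c' t)) -exprMn => /eqP.
have p0 : 0 <= 2 / (1 - '[c t, c t]) by rewrite divr_ge0// subr_ge0 ltW.
by rewrite (eqrXn2 (isT : (0 < 2)%N) (mulr_ge0 p0 (normr_ge0 _)) s0) => /eqP.
Qed.

(** One competitor curve suffices for an upper bound on the infimum; it has constant speed [s],
    hence length [s]. *)
Lemma geodesic_distance_le (a b : H) (r : R) : '[a, a] < 1 -> '[b, b] < 1 ->
  0 <= r -> coshdist ip a b <= cosh r -> (geodesic_distance ip a b <= r%:E)%E.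
Proof.
move=> a1 b1 r0 hr.
have [s [c [c' [s0 ds c0 c1 [gc dc cb sp]]]]] := geodesic_between a1 b1.
have sr : s <= r by apply: cosh_inj_le => //; rewrite ds.
apply: (@le_trans _ _ s%:E); last by rewrite lee_fin.
apply: ereal_inf_lbound; exists c.
  split => //.
    by move=> t _; split; [apply/(ball_ip ip_inner)|case: (dc t)].
  apply: continuous_subspaceT => t; apply: differentiable_continuous.
  by apply/derivable1_diffP; case: (gc t).
rewrite /curve_length (derive1_is dc).
under eq_integral do rewrite sp.
rewrite integral_cst//= lebesgue_measure_itv/= lte_fin ltr01.
by rewrite oppr0 adde0 mule1.
Qed.

Lemma geodesic_distance_ge0 (a b : H) : (0 <= geodesic_distance ip a b)%E.
Proof.
apply: le_ereal_inf_tmp => _ [c _ <-]; apply: integral_ge0 => t _.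
by rewrite lee_fin sqrtr_ge0.
Qed.

Lemma sigma_lipschitz (a b x : H) (r : R) : '[a, a] < 1 -> '[b, b] < 1 ->
  '[x, x] = 1 -> 0 <= r -> coshdist ip a b <= cosh r ->
  `|sigma b x - sigma a x| <= 2 * r.
Proof.
move=> a1 b1 x1 r0 hr.
have [s [c [c' [s0 ds <- <- [gc dc cb sp]]]]] := geodesic_between a1 b1.
have sr : s <= r by apply: cosh_inj_le => //; rewrite ds.
apply: le_trans (_ : 2 * s <= _); last by rewrite ler_pM2l.
apply: (sigma_lipschitz_curve ip_inner x1 dc cb) => t.
rewrite normrZ ger0_norm ?divr_ge0 ?subr_ge0 ?(ltW (cb t))//.
by rewrite -metric_normE// sp.
Qed.

End ExponentialMap.

(** * Weak integrals of vector fields, and what their Gram kernel determines *)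

Section VectorAverage.
Context {R : realType} {H : completeNormedModType R} (ip : H -> H -> R).
Hypothesis ip_inner : inner_product ip.
Notation sigma := (sigma ip).
Notation "''[' x , y ]" := (ip x y) (format "''[' x ,  y ]").
Let ipE := (ipDl ip_inner, ipDr ip_inner, ipNl ip_inner, ipNr ip_inner,
  ipZl ip_inner, ipZr ip_inner, ip0l ip_inner, ip0r ip_inner).
Let ipC := ipC ip_inner.
Let ipxx := ipxx ip_inner.

Lemma continuous_ipl (y : H) : continuous (fun x : H => '[x, y]).
Proof. by move=> x; apply: (cvg_ip ip_inner) => //; exact: cvg_cst. Qed.

(** The denominator vanishes only at the inverse point of [w] in the unit sphere. For [w = 0], the
    convention [0^-1 = 0] merely excludes the origin. *)
Lemma continuous_sigma w z : z <> '[w, w]^-1 *: w -> {for z, continuous (sigma w)}.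
Proof.
move=> zN; apply: (cvg_sigma ip_inner) => //.
apply/eqP => d0; apply: zN.
have [w0|w0] := eqVneq '[w, w] 0.
  move: d0; rewrite /sigma_den w0 (ip_eq0 ip_inner w0) !ipE => /eqP.
  by rewrite mulr0 mul0r subr0 addr0 oner_eq0.
apply/subr0_eq/(ip_eq0 ip_inner); apply: (mulfI w0); rewrite mulr0 -d0.
by rewrite /sigma_den !ipE (ipC z w); field.
Qed.

Lemma measurable_sigma w :
  measurable_fun setT (sigma w : borel H -> borel H).
Proof.
apply: (@measurable_cofinite_continuous H H [set '[w, w]^-1 *: w]).
- exact: norm_hausdorff.
- exact: finite_set1.
by move=> z /= zN; exact: continuous_sigma.
Qed.

(** Covers [sigma w], compositions of such maps, and [id] (for the shifted measure) at once. *)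
Definition sphere_map (f : H -> H) :=
  measurable_fun setT (f : borel H -> borel H) /\
  (forall x, '[x, x] = 1 -> '[f x, f x] = 1).

Lemma sphere_map_sigma w : '[w, w] < 1 -> sphere_map (sigma w).
Proof.
by move=> w1; split; [exact: measurable_sigma|move=> x; exact: sigma_sphere].
Qed.

Lemma sphere_map_comp f g : sphere_map f -> sphere_map g ->
  sphere_map (fun x => g (f x)).
Proof.
move=> [mf hf] [mg hg]; split; last by move=> x /hf/hg.
exact: (measurableT_comp mg mf).
Qed.

Lemma sphere_map_id : sphere_map id.
Proof. by split=> //; exact: measurable_id. Qed.

Lemma norm1_ip (x : H) : '[x, x] = 1 -> `|x| = 1.
Proof. by move/(sphere_ip ip_inner). Qed.

Lemma admissible_sphere_map f (y : H) : sphere_map f ->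
  admissible (fun x => '[f x, y]).
Proof.
move=> [mf hf]; split.
  apply: measurable_funTS.
  have my : measurable_fun setT ((fun x => '[x, y]) : borel H -> R).
    by apply: measurable_borel_continuous; [exact: norm_hausdorff|exact: continuous_ipl].
  exact: (measurableT_comp my mf).
exists `|y| => x /(sphere_ip ip_inner)/hf/norm1_ip fx.
by apply: le_trans (cauchy_schwarz ip_inner _ _) _; rewrite fx mul1r.
Qed.

Definition vadmissible (f : H -> H) :=
  (forall y, admissible (fun x => '[f x, y])) /\
  exists C, forall x, sphere x -> `|f x| <= C.

Lemma vadmissible_sphere_map f : sphere_map f -> vadmissible f.
Proof.
move=> sf; split; first by move=> y; exact: admissible_sphere_map.
exists 1 => x /(sphere_ip ip_inner) x1; case: sf => _ /(_ _ x1)/norm1_ip ->.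
by [].
Qed.

Lemma vadmissible_scale phi f : admissible phi -> vadmissible f ->
  vadmissible (fun x => phi x *: f x).
Proof.
move=> ap [af [C hC]]; split.
  move=> y; rewrite (_ : (fun x => _) = (fun x => phi x * '[f x, y])).
    exact: admissibleM.
  by apply/funext => x; rewrite (ipZl ip_inner).
case: ap => _ [K hK]; exists (K * C) => x Sx; rewrite normrZ.
by apply: ler_pM => //; [exact: hK|exact: hC].
Qed.

Section Measure.
Variable mu : probability (borel H) R.
Hypothesis mu_sphere : mu sphere = 1%E.
Notation avg := (avg mu).
Notation hint := (hintegral ip mu).

Lemma is_integral_avg f I : vadmissible f ->
  (forall y, avg (fun x => '[f x, y]) = '[I, y]) -> is_integral ip mu f I.
Proof.
move=> [af _] h y; rewrite -h; apply: avgE => //; exact: af.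
Qed.

Lemma is_integral_unique f I J :
  is_integral ip mu f I -> is_integral ip mu f J -> I = J.
Proof.
move=> hI hJ; apply: (ip_inj ip_inner) => y.
by have := hI y; rewrite hJ => -[].
Qed.

Lemma hintegral_eq f I : is_integral ip mu f I -> hint f = I.
Proof.
move=> hI; apply: (@is_integral_unique f) => //.
exact: (@xgetPex _ 0 (is_integral ip mu f) (ex_intro _ I hI)).
Qed.

Lemma is_integral_congr f g I : (forall x, sphere x -> f x = g x) ->
  is_integral ip mu f I -> is_integral ip mu g I.
Proof.
move=> fg hI y; rewrite -hI; apply: eq_integral => x; rewrite inE => Sx.
by rewrite fg.
Qed.

Lemma avg_norm_le phi C : admissible phi ->
  (forall x, sphere x -> `|phi x| <= C) -> `|avg phi| <= C.
Proof.
move=> ap hC; rewrite ler_norml; apply/andP; split.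
  rewrite -[- C](avg_cst mu_sphere); apply: ler_avg => //.
    exact: admissible_cst.
  by move=> x /hC; rewrite ler_norml => /andP[].
by apply: avg_le => // x /hC; rewrite ler_norml => /andP[].
Qed.

(** Riesz representation of the bounded functional [y |-> avg <f, y>] shows that the weak integral
    exists; afterwards vector averages are computed entirely by pairing. *)
Lemma hintegral_ip f y : vadmissible f ->
  '[hint f, y] = avg (fun x => '[f x, y]).
Proof.
move=> vf; have [af [C hC]] := vf.
have [] := @lax_milgram R H ip (fun y => avg (fun x => '[f x, y])) 1 C 1.
- exact: ltr01.
- exact: ipC.
- exact: ipDl ip_inner.
- exact: ipZl ip_inner.
- by move=> x; rewrite mul1r ipxx.
- by move=> x z; rewrite mul1r; exact: cauchy_schwarz.
- move=> u v; rewrite -(avgD mu_sphere)//.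
  by apply: eq_avg => x _; rewrite (ipDr ip_inner).
- move=> k u; rewrite -(avgZ mu_sphere)//.
  by apply: eq_avg => x _; rewrite (ipZr ip_inner).
- move=> u; apply: avg_norm_le => // x Sx.
  apply: le_trans (cauchy_schwarz ip_inner _ _) _.
  by rewrite ler_wpM2r// hC.
move=> I hI; rewrite -hI; congr ('[_, _]); apply: hintegral_eq.
exact: is_integral_avg.
Qed.

Lemma hintegral_is_integral f : vadmissible f -> is_integral ip mu f (hint f).
Proof. by move=> vf; apply: is_integral_avg => // y; rewrite hintegral_ip. Qed.

Lemma eq_hintegral f g : vadmissible f ->
  (forall x, sphere x -> f x = g x) -> hint g = hint f.
Proof.
move=> vf fg; apply: hintegral_eq.
exact: is_integral_congr fg (hintegral_is_integral vf).
Qed.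

(* Only the Gram kernel of [f] enters the norm of an average of [f]. *)
Lemma gram_norm phi f g : admissible phi -> vadmissible f -> vadmissible g ->
  (forall x x', sphere x -> sphere x' -> '[f x, f x'] = '[g x, g x']) ->
  `|hint (fun x => phi x *: f x)| = `|hint (fun x => phi x *: g x)|.
Proof.
move=> ap vf vg fg.
have E k : vadmissible k -> '[hint (fun x => phi x *: k x), hint (fun x => phi x *: k x)]
    = avg (fun x => phi x * avg (fun x' => phi x' * '[k x', k x])).
  move=> vk; rewrite hintegral_ip; last exact: vadmissible_scale.
  apply: eq_avg => x _; rewrite (ipZl ip_inner); congr (_ * _).
  rewrite ipC hintegral_ip; last exact: vadmissible_scale.
  by apply: eq_avg => x' _; rewrite (ipZl ip_inner).
apply/eqP; rewrite -(eqrXn2 (isT : (0 < 2)%N))// -!ipxx !E//; apply/eqP.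
apply: eq_avg => x Sx; congr (_ * _); apply: eq_avg => x' Sx'.
by rewrite fg.
Qed.

Lemma gram_mean f g : vadmissible f -> vadmissible g ->
  (forall x x', sphere x -> sphere x' -> '[f x, f x'] = '[g x, g x']) ->
  `|hint f| = `|hint g|.
Proof.
move=> vf vg fg.
rewrite -(@eq_hintegral f (fun x => 1 *: f x))//; last by move=> x; rewrite scale1r.
rewrite -(@eq_hintegral g (fun x => 1 *: g x))//; last by move=> x; rewrite scale1r.
by apply: gram_norm => //; exact: admissible_cst.
Qed.

(* [f] and [g] have isometric synthesis operators [phi |-> int phi f], so the
   frame bound passes from [g] to [f] by [T^* T] versus [T T^*] duality. *)
Lemma gram_frame_bound f g (L : R) : 0 <= L -> vadmissible f -> vadmissible g ->
  (forall x x', sphere x -> sphere x' -> '[f x, f x'] = '[g x, g x']) ->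
  (forall X, avg (fun x => '[g x, X] * '[g x, X]) <= L * '[X, X]) ->
  forall X, avg (fun x => '[f x, X] * '[f x, X]) <= L * '[X, X].
Proof.
move=> L0 vf vg fg hL X.
apply/ler_addgt0Pr => eps eps0.
have X0 := ip_ge0 ip_inner X.
(* [L] may be zero, and the argument divides by the bound. *)
suff h (K : R) : L < K -> avg (fun x => '[f x, X] * '[f x, X]) <= K * '[X, X].
  have p : 0 < '[X, X] + 1 by rewrite ltr_wpDl.
  apply: le_trans (h (L + eps / ('[X, X] + 1)) _) _.
    by rewrite ltrDl divr_gt0.
  rewrite mulrDl lerD2l -[leRHS]mulr1 -mulrA ler_pM2l// mulrC ler_pdivrMr//.
  by rewrite mul1r lerDl.
move=> LK; have K0 : 0 < K by exact: le_lt_trans LK.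
(* [phi] is the analysis of [X] by [f], and [Y] is its synthesis by [g], equal in norm to its
   synthesis by [f]. So [P <= |Y| |X|], and it remains to see [|Y|^2 <= K P]. *)
pose phi x := '[f x, X].
have ap : admissible phi by case: vf => + _; exact.
set P := avg _; pose Y := hint (fun x => phi x *: g x).
have nY := gram_norm ap vf vg fg.
have P0 : 0 <= P by apply: avg_ge0 => x _; rewrite -expr2 sqr_ge0.
have PE : P = '[hint (fun x => phi x *: f x), X].
  rewrite hintegral_ip; last exact: vadmissible_scale.
  by apply: eq_avg => x _; rewrite (ipZl ip_inner).
have PY : P <= `|Y| * `|X| by rewrite PE /Y -nY; exact: ip_le.
have YP : '[Y, Y] <= K * P.
  have ag : admissible (fun x => '[g x, Y]) by case: vg => + _; exact.
  (* Completing the square at [K^-1 <g, Y>]: the frame bound of [g] at [Y] leaves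
     [K^-1 |Y|^2 <= P]. *)
  have : 0 <= avg (fun x => (phi x - K^-1 * '[g x, Y]) * (phi x - K^-1 * '[g x, Y])).
    by apply: avg_ge0 => x _; rewrite -expr2 sqr_ge0.
  rewrite (_ : avg _ = P - 2 / K * '[Y, Y] + (K^-1 * K^-1) * avg (fun x => '[g x, Y] * '[g x, Y])).
    have := hL Y => hY; have Y0 := ip_ge0 ip_inner Y => h.
    have h1 : avg (fun x => '[g x, Y] * '[g x, Y]) <= K * '[Y, Y].
      by apply: le_trans hY _; rewrite ler_wpM2r// ltW.
    have h2 : (K^-1 * K^-1) * avg (fun x => '[g x, Y] * '[g x, Y]) <= (K^-1 * K^-1) * (K * '[Y, Y]).
      by rewrite ler_wpM2l// mulr_ge0// invr_ge0 ltW.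
    have h3 : (K^-1 * K^-1) * (K * '[Y, Y]) = K^-1 * '[Y, Y] by field; rewrite gt_eqF.
    rewrite h3 in h2.
    have h4 : K^-1 * '[Y, Y] <= P.
      have : 2 / K * '[Y, Y] = K^-1 * '[Y, Y] + K^-1 * '[Y, Y] by field; rewrite gt_eqF.
      lra.
    by rewrite -ler_pdivrMl.
  rewrite (_ : '[Y, Y] = avg (fun x => phi x * '[g x, Y])); last first.
    rewrite {1}/Y hintegral_ip; last exact: vadmissible_scale.
    by apply: eq_avg => x _; rewrite (ipZl ip_inner).
  have a1 := admissibleM ap ap; have a2 := admissibleM ap ag; have a3 := admissibleM ag ag.
  rewrite /P -(avgZ mu_sphere (2 / K) a2) -(avgB mu_sphere a1 (admissibleZ (2 / K) a2)).
  rewrite -(avgZ mu_sphere (K^-1 * K^-1) a3).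
  rewrite -(avgD mu_sphere (admissibleB a1 (admissibleZ (2 / K) a2)) (admissibleZ _ a3)).
  by apply: eq_avg => x _; rewrite /phi; field; rewrite gt_eqF.
have : P ^+ 2 <= K * P * '[X, X].
  apply: le_trans (_ : '[Y, Y] * '[X, X] <= _); last by rewrite ler_wpM2r.
  by rewrite !ipxx -exprMn ler_pXn2r ?nnegrE ?mulr_ge0.
have [->|Pn0] := eqVneq P 0; first by rewrite mulr_ge0// ltW.
rewrite expr2 mulrAC ler_pM2r// lt_def Pn0; exact: P0.
Qed.

End Measure.
End VectorAverage.

(** * Derivative of [Fmu] and the formula [cov - id] for its covariant derivative *)

Section Covariant.
Context {R : realType} {H : completeNormedModType R} (ip : H -> H -> R).
Hypothesis ip_inner : inner_product ip.
Notation sigma := (sigma ip).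
Notation "''[' x , y ]" := (ip x y) (format "''[' x ,  y ]").
Let ipE := (ipDl ip_inner, ipDr ip_inner, ipNl ip_inner, ipNr ip_inner,
  ipZl ip_inner, ipZr ip_inner, ip0l ip_inner, ip0r ip_inner).
Let ipC := ipC ip_inner.

Definition director_field (x w : H) : H := ((1 - '[w, w]) / 2) *: sigma w x.

(** Derivative of [director_field] in direction [Z], with [y] in place of [sigma w x]. The prefactor
    [(1 - |w|^2) / 2] has cancelled the conformal factor in the velocity, so no denominator is
    left. *)
Definition director_derive (y w Z : H) : H := dsigma ip w y Z - '[w, Z] *: y.

Lemma is_derive_director (x w Z eta : H) (u : R) : '[x, x] = 1 ->
  '[u *: Z + w, u *: Z + w] < 1 ->
  is_derive u (1 : R) (fun u => '[director_field x (u *: Z + w), eta])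
    '[director_derive (sigma (u *: Z + w) x) (u *: Z + w) Z, eta].
Proof.
move=> x1 c1; have dl := is_derive_line w Z u.
rewrite (_ : (fun u => _) = (fun u => (2^-1 *: (1 - '[u *: Z + w, u *: Z + w])) *
   '[sigma (u *: Z + w) x, eta])); last first.
  by apply/funext => t; rewrite /director_field (ipZl ip_inner) scale_mul [2^-1 * _]mulrC.
apply: (is_derive_eq (is_deriveM (is_deriveZ 2^-1 (is_deriveB
  (is_derive_cst (1 : R) u (1 : R)) (is_derive_ip ip_inner dl dl)))
  (is_derive_sigma ip_inner eta dl c1 x1))).
have n0 : 1 - '[u *: Z + w, u *: Z + w] != 0 by rewrite subr_eq0 gt_eqF.
rewrite !scale_mul ?fctE /= ?scale_mul /director_derive /dsigma.
move: (u *: Z + w) (sigma (u *: Z + w) x) n0 => c y n0; rewrite !ipE (ipC Z c).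
by field.
Qed.

Lemma norm_director_derive_sub (y y0 c c0 Z : H) (r : R) :
  `|y| = 1 -> `|y0| = 1 -> `|c| <= 1 -> `|c0| <= 1 ->
  `|y - y0| <= 2 * r -> `|c - c0| <= r ->
  `|director_derive y c Z - director_derive y0 c0 Z| <= 13 * r * `|Z|.
Proof.
move=> y1 y01 c1 c01 yr cr.
have r0 : 0 <= r by apply: le_trans cr.
(* Telescoping. In the order [h1] to [h7] the terms contribute [2 + 2 + 2 + 1 + 3 + 1 + 2 = 13]. *)
have -> : director_derive y c Z - director_derive y0 c0 Z =
  '[Z, y - y0] *: y + '[Z, y0] *: (y - y0)
  + ('[Z, y - y0] *: c + '[Z, y0] *: (c - c0))
  - (('[c - c0, y] + '[c0, y - y0]) *: Z)
  - ('[c - c0, Z] *: y + '[c0, Z] *: (y - y0)).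
  apply: (ip_inj ip_inner) => z.
  by rewrite /director_derive /dsigma !ipE; ring.
have cs u v (a b : R) : `|u| <= a -> `|v| <= b -> `|'[u, v]| <= a * b.
  by move=> ua vb; apply: le_trans (cauchy_schwarz ip_inner _ _) _; exact: ler_pM.
have sc (k a b : R) (v : H) : `|k| <= a -> `|v| <= b -> `|k *: v| <= a * b.
  by move=> ua vb; rewrite normrZ; exact: ler_pM.
have [z1 [y1' y01']] : `|Z| <= `|Z| /\ `|y| <= 1 /\ `|y0| <= 1 by rewrite y1 y01.
have h1 := sc _ _ _ _ (cs _ _ _ _ z1 yr) y1'.
have h2 := sc _ _ _ _ (cs _ _ _ _ z1 y01') yr.
have h3 := sc _ _ _ _ (cs _ _ _ _ z1 yr) c1.
have h4 := sc _ _ _ _ (cs _ _ _ _ z1 y01') cr.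
have h5 := sc _ _ _ _ (le_trans (ler_normD _ _) (lerD (cs _ _ _ _ cr y1') (cs _ _ _ _ c01 yr))) z1.
have h6 := sc _ _ _ _ (cs _ _ _ _ cr z1) y1'.
have h7 := sc _ _ _ _ (cs _ _ _ _ c01 z1) yr.
apply: le_trans (ler_normB _ _) _.
apply: le_trans (lerD (le_trans (ler_normB _ _) (lerD (le_trans (ler_normD _ _)
  (lerD (le_trans (ler_normD _ _) (lerD h1 h2)) (le_trans (ler_normD _ _) (lerD h3 h4)))) h5))
  (le_trans (ler_normD _ _) (lerD h6 h7))) _.
by rewrite le_eqVlt; apply/orP; left; apply/eqP; ring.
Qed.

(** The remainder is uniform in [x], so it can be averaged directly; this takes the place of
    exchanging a limit with an integral. *)
Lemma director_taylor (x w Z : H) (r : R) : '[x, x] = 1 -> '[w, w] < 1 -> 0 <= r ->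
  (forall u : R, u \in `[0, 1] -> [/\ '[u *: Z + w, u *: Z + w] < 1,
     coshdist ip w (u *: Z + w) <= cosh r & `|u *: Z| <= r]) ->
  `|director_field x (Z + w) - director_field x w - director_derive (sigma w x) w Z|
    <= 13 * r * `|Z|.
Proof.
move=> x1 w1 r0 hu; set d := _ - _.
have C0 : 0 <= 13 * r * `|Z| by rewrite !mulr_ge0.
have nontrivial : exists x : H, `|x| = 1 by exists x; exact/(sphere_ip ip_inner).
apply: (norm_le_ip ip_inner) => //.
(* The first-order remainder along the segment, paired with its own final value [d]: its increment
   is [<d, d>]. *)
pose f u := '[director_field x (u *: Z + w), d] - u * '[director_derive (sigma w x) w Z, d].
pose g (u : R) := '[director_derive (sigma (u *: Z + w) x) (u *: Z + w) Z, d]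
  - '[director_derive (sigma w x) w Z, d].
have df (u : R) : u \in `[0, 1] -> is_derive u (1 : R) f (g u).
  move=> /hu[c1 _ _]; have d1 := is_derive_director d x1 c1.
  have d2 := is_deriveM (is_derive_id u (1 : R))
    (is_derive_cst '[director_derive (sigma w x) w Z, d] u (1 : R)).
  have d3 := is_deriveB d1 d2.
  apply: (is_derive_eq d3).
  by rewrite /g !scale_mul /=; ring.
have := @mvt_le _ f g 0 1 (13 * r * `|Z| * `|d|) ler01 df.
have -> : f 1 - f 0 = '[d, d].
  have dE (p q v : H) : '[p - q - v, d] = '[p, d] - '[q, d] - '[v, d].
    by rewrite !(ipDl ip_inner) !(ipNl ip_inner).
  by rewrite /f scale0r add0r scale1r mul1r mul0r subr0 {5}/d dE; ring.
rewrite subr0 mulr1; apply => u u01; have [c1 cd cr] := hu u u01.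
rewrite /g -(ipNl ip_inner) -(ipDl ip_inner).
apply: le_trans (ip_le ip_inner _ _) _; rewrite ler_wpM2r//.
have nle (v : H) : '[v, v] < 1 -> `|v| <= 1 by move/(ball_ip ip_inner)/ltW.
apply: norm_director_derive_sub.
- exact/(sphere_ip ip_inner)/sigma_sphere.
- exact/(sphere_ip ip_inner)/sigma_sphere.
- exact: nle.
- exact: nle.
- exact: sigma_lipschitz.
- by rewrite addrK.
Qed.

Lemma near_coshdist (w : H) (r : R) : '[w, w] < 1 -> 0 < r ->
  exists2 del : R, 0 < del & forall Z : H, `|Z| < del ->
  [/\ '[Z + w, Z + w] < 1, coshdist ip w (Z + w) <= cosh r & `|Z| <= r].
Proof.
move=> w1 r0.
have cst (k : R) : (fun=> k) @ nbhs (0 : H) --> k by exact: cvg_cst.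
have cv (k : H) : (fun=> k) @ nbhs (0 : H) --> k by exact: cvg_cst.
have cZ : (fun Z : H => Z + w) @ nbhs (0 : H) --> w.
  by rewrite -[X in _ --> X]add0r; apply: cvgD => //; exact: cvg_id.
have cZZ : (fun Z : H => '[Z + w, Z + w]) @ nbhs (0 : H) --> '[w, w].
  exact: (cvg_ip ip_inner).
have n0 : 1 - '[w, w] != 0 by rewrite subr_eq0 gt_eqF.
have cK : (fun Z : H => coshdist ip w (Z + w)) @ nbhs (0 : H) --> (1 : R).
  rewrite -(coshdistxx ip_inner w) /coshdist; apply: cvgD => //; apply: cvgM.
    by apply: cvgM => //; apply: (cvg_ip ip_inner); apply: cvgB.
  apply: cvgV; first by rewrite mulf_neq0.
  by apply: cvgM => //; apply: cvgB.
have r1 : 1 < cosh r.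
  by rewrite ltNge; apply/negP; rewrite -(@cosh0 R) => /(cosh_inj_le (ltW r0) (lexx 0)); rewrite leNgt r0.
have cn : (fun Z : H => `|Z|) @ nbhs (0 : H) --> (0 : R).
  by rewrite -[X in _ --> X](normr0 H); apply: cvg_norm; exact: cvg_id.
have : \forall Z \near (0 : H),
  [/\ '[Z + w, Z + w] < 1, coshdist ip w (Z + w) <= cosh r & `|Z| <= r].
  near=> Z; split; near: Z.
  - exact: (cvgr_lt _ cZZ).
  - exact: (cvgr_le _ cK).
  - exact: (cvgr_le _ cn).
move=> /nbhs_ballP[del /= del0 hdel]; exists del => // Z Zd.
by apply: hdel; rewrite -ball_normE /= sub0r normrN.
Unshelve. all: by end_near.
Qed.

Lemma director_taylor_near (w : H) (r : R) : '[w, w] < 1 -> 0 < r ->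
  exists2 del : R, 0 < del & forall Z : H, `|Z| < del -> '[Z + w, Z + w] < 1 /\
  forall x, '[x, x] = 1 ->
  `|director_field x (Z + w) - director_field x w - director_derive (sigma w x) w Z|
    <= 13 * r * `|Z|.
Proof.
move=> w1 r0; have [del del0 h] := near_coshdist w1 r0.
exists del => // Z Zd; split; first by case: (h Z Zd).
move=> x x1; apply: director_taylor => //; first exact: ltW.
move=> u; rewrite in_itv /= => /andP[u0 u1]; apply: h.
by rewrite normrZ ger0_norm//; apply: le_lt_trans Zd; rewrite ler_piMl.
Qed.

Section Measure.
Variable mu : probability (borel H) R.
Hypothesis mu_sphere : mu sphere = 1%E.
Notation avg := (avg mu).
Notation hint := (hintegral ip mu).

Definition mean (f : H -> H) : H := hint f.
Definition cov (f : H -> H) (X : H) : H := hint (fun x => '[f x, X] *: f x).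

Lemma mean_ip f y : sphere_map ip f -> '[mean f, y] = avg (fun x => '[f x, y]).
Proof. by move=> sf; apply: hintegral_ip => //; exact: vadmissible_sphere_map. Qed.

Lemma vadmissible_cov f X : sphere_map ip f -> vadmissible ip (fun x => '[f x, X] *: f x).
Proof.
move=> sf; apply: vadmissible_scale => //; last exact: vadmissible_sphere_map.
exact: admissible_sphere_map.
Qed.

Lemma cov_ip f X y : sphere_map ip f ->
  '[cov f X, y] = avg (fun x => '[f x, X] * '[f x, y]).
Proof.
move=> sf; rewrite /cov (hintegral_ip ip_inner mu_sphere); last exact: vadmissible_cov.
by apply: eq_avg => x _; rewrite (ipZl ip_inner).
Qed.

Lemma vadmissible_director w : '[w, w] < 1 ->
  vadmissible ip (fun x => director_field x w).
Proof.
move=> w1; apply: (vadmissible_scale ip_inner).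
  exact: admissible_cst.
apply: vadmissible_sphere_map => //; exact: sphere_map_sigma.
Qed.

Lemma FmuE w : '[w, w] < 1 ->
  Fmu ip mu w = ((1 - '[w, w]) / 2) *: mean (sigma w).
Proof.
move=> w1; have nontrivial := sphere_nonempty mu_sphere.
rewrite /Fmu (eq_hintegral ip_inner mu_sphere (vadmissible_director w1)); last first.
  by move=> x /(sphere_ip ip_inner) x1; rewrite directorE.
apply: (ip_inj ip_inner) => y.
rewrite (hintegral_ip ip_inner mu_sphere); last exact: vadmissible_director.
have sw := sphere_map_sigma ip_inner w1.
rewrite (ipZl ip_inner) mean_ip// -(avgZ mu_sphere); last exact: admissible_sphere_map.
by apply: eq_avg => x _; rewrite (ipZl ip_inner).
Qed.

(** The derivative of [Fmu] in the chart. The last three terms come from the frame and are exactly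
    what the Christoffel term removes in [nablaFE]. *)
Let Lderive w Z := cov (sigma w) Z - Z + '[Z, mean (sigma w)] *: w
  - '[w, mean (sigma w)] *: Z - '[w, Z] *: mean (sigma w).

Lemma avg_director_derive w Z y : '[w, w] < 1 ->
  admissible (fun x => '[director_derive (sigma w x) w Z, y]) /\
  avg (fun x => '[director_derive (sigma w x) w Z, y]) = '[Lderive w Z, y].
Proof.
move=> w1; have sw := sphere_map_sigma ip_inner w1.
have aZ := admissible_sphere_map ip_inner Z sw.
have ay := admissible_sphere_map ip_inner y sw.
have aw := admissible_sphere_map ip_inner w sw.
have a1 := admissibleM aZ ay.
have a2 := admissible_cst (- '[Z, y]) : admissible (fun _ : H => - '[Z, y]).
have a3 := admissibleZ '[w, y] aZ.
have a4 := admissibleZ (- '[Z, y]) aw.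
have a5 := admissibleZ (- '[w, Z]) ay.
have a12 := admissibleD a1 a2; have a123 := admissibleD a12 a3.
have a1234 := admissibleD a123 a4.
have a12345 := admissibleD a1234 a5.
have E : (fun x => '[director_derive (sigma w x) w Z, y]) = (fun x =>
   '[sigma w x, Z] * '[sigma w x, y] + (- '[Z, y]) + '[w, y] * '[sigma w x, Z]
   + (- '[Z, y]) * '[sigma w x, w] + (- '[w, Z]) * '[sigma w x, y]).
  apply/funext => x; rewrite /director_derive /dsigma.
  move: (sigma w x) => v; rewrite !ipE (ipC Z v) (ipC w v); ring.
rewrite E; split => //.
rewrite (avgD mu_sphere a1234 a5) (avgD mu_sphere a123 a4) (avgD mu_sphere a12 a3).
rewrite (avgD mu_sphere a1 a2) (avg_cst mu_sphere) !(avgZ mu_sphere)//.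
rewrite /Lderive -cov_ip// -!mean_ip//.
move: (mean _) (cov _ _) => m C; rewrite !ipE (ipC Z m) (ipC w m).
by ring.
Qed.

Lemma Fmu_taylor w Z C : '[w, w] < 1 -> '[Z + w, Z + w] < 1 ->
  (forall x, '[x, x] = 1 -> `|director_field x (Z + w) - director_field x w
     - director_derive (sigma w x) w Z| <= C) ->
  `|Fmu ip mu (Z + w) - Fmu ip mu w - Lderive w Z| <= C.
Proof.
move=> w1 Zw1 hC.
have nontrivial := sphere_nonempty mu_sphere.
have FE v : '[v, v] < 1 -> Fmu ip mu v = hint (fun x => director_field x v).
  move=> v1; apply: (eq_hintegral ip_inner mu_sphere (vadmissible_director v1)).
  by move=> x /(sphere_ip ip_inner) x1; rewrite directorE.
have [av _] := vadmissible_director Zw1; have [aw _] := vadmissible_director w1.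
have C0 : 0 <= C.
  have [x /(sphere_ip ip_inner) x1] := nontrivial.
  exact: le_trans (hC x x1).
set d := _ - _; apply: (norm_le_ip ip_inner) => //.
have [al El] := avg_director_derive Z d w1.
have -> : '[d, d] = avg (fun x => '[director_field x (Z + w), d]
    - '[director_field x w, d] - '[director_derive (sigma w x) w Z, d]).
  rewrite (avgB mu_sphere (admissibleB (av d) (aw d)) al) (avgB mu_sphere (av d) (aw d)) El.
  rewrite -!(hintegral_ip ip_inner mu_sphere); try exact: vadmissible_director.
  by rewrite -!FE// -!(ipNl ip_inner) -!(ipDl ip_inner).
apply: (avg_le mu_sphere); first exact: (admissibleB (admissibleB (av d) (aw d)) al).
move=> x /(sphere_ip ip_inner) x1; rewrite -!(ipNl ip_inner) -!(ipDl ip_inner).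
apply: le_trans (ip_le ip_inner _ _) _; rewrite ler_wpM2r//.
exact: hC.
Qed.

Lemma cov_scale f h X : sphere_map ip f -> cov f (h *: X) = h *: cov f X.
Proof.
move=> sf; apply: (ip_inj ip_inner) => y; rewrite cov_ip// (ipZl ip_inner) cov_ip//.
rewrite -(avgZ mu_sphere); last by apply: admissibleM; exact: admissible_sphere_map.
by apply: eq_avg => x _; rewrite (ipZr ip_inner) mulrA.
Qed.

Lemma derive_Fmu w X : '[w, w] < 1 -> 'D_X (Fmu ip mu) w = Lderive w X.
Proof.
move=> w1; apply: cvg_lim; first exact: norm_hausdorff.
apply/cvgrPdist_le => eps eps0.
have X1 : 0 < `|X| + 1 by rewrite ltr_wpDl.
(* Chosen so that the remainder [13 r |h X|] is at most [eps |h|]; the added one covers [X = 0]. *)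
have r0 : 0 < eps / (13 * (`|X| + 1)) by rewrite divr_gt0// mulr_gt0.
have [del del0 hdel] := director_taylor_near w1 r0.
have d0 : 0 < del / (`|X| + 1) by rewrite divr_gt0.
apply/nbhs_ballP; exists (del / (`|X| + 1)) => //= h.
rewrite -ball_normE /= sub0r normrN => hd h0.
have hX : `|h *: X| < del.
  rewrite normrZ; apply: le_lt_trans (_ : `|h| * (`|X| + 1) < _).
    by rewrite ler_wpM2l// lerDl.
  by rewrite -ltr_pdivlMr.
have [hw ht] := hdel _ hX.
have := Fmu_taylor w1 hw ht.
have LZ : Lderive w (h *: X) = h *: Lderive w X.
  rewrite /Lderive cov_scale; last exact: sphere_map_sigma.
  by apply: (ip_inj ip_inner) => y; rewrite !ipE; ring.
rewrite LZ => hh; rewrite distrC.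
have -> : h^-1 *: (Fmu ip mu (h *: X + w) - Fmu ip mu w) - Lderive w X =
  h^-1 *: (Fmu ip mu (h *: X + w) - Fmu ip mu w - h *: Lderive w X).
  by rewrite [in RHS]scalerBr scalerA mulVf// scale1r.
rewrite normrZ normfV ler_pdivrMl ?normr_gt0//.
apply: le_trans hh _; rewrite normrZ.
have -> : 13 * (eps / (13 * (`|X| + 1))) * (`|h| * `|X|) =
  `|h| * eps * (`|X| / (`|X| + 1)) by field; rewrite gt_eqF.
by rewrite ler_piMr ?mulr_ge0 ?(ltW eps0)// ler_pdivrMr// mul1r lerDl.
Qed.

Lemma nablaFE w X : '[w, w] < 1 -> nablaF ip mu w X = cov (sigma w) X - X.
Proof.
move=> w1; rewrite /nablaF /covariant_derivative derive_Fmu// christoffelE// FmuE//.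
have w0 : 1 - '[w, w] != 0 by rewrite subr_eq0 gt_eqF.
rewrite /Lderive; apply: (ip_inj ip_inner) => y.
move: (mean _) (cov _ _) => m C; rewrite !ipE.
by field.
Qed.

End Measure.
End Covariant.

(** * Coercivity of [id - cov], and the effect of one Newton step *)

Section NewtonStep.
Context {R : realType} {H : completeNormedModType R} (ip : H -> H -> R).
Hypothesis ip_inner : inner_product ip.
Notation sigma := (sigma ip).
Notation "''[' x , y ]" := (ip x y) (format "''[' x ,  y ]").
Let ipE := (ipDl ip_inner, ipDr ip_inner, ipNl ip_inner, ipNr ip_inner,
  ipZl ip_inner, ipZr ip_inner, ip0l ip_inner, ip0r ip_inner).
Let ipC := ipC ip_inner.
Let ipxx := ipxx ip_inner.

Section Coercivity.
Variable mu : probability (borel H) R.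
Hypothesis mu_sphere : mu sphere = 1%E.
Notation avg := (avg mu).
Notation mean := (mean ip mu).
Notation cov := (cov ip mu).

(** Written with [ip]: the conformal factor of the metric cancels, so bounds at different base
    points can be compared. *)
Definition coercive (f : H -> H) (lam : R) :=
  forall X, lam * '[X, X] <= '[X, X] - '[cov f X, X].

Lemma cov_ge0 f X : sphere_map ip f -> 0 <= '[cov f X, X].
Proof.
move=> sf; rewrite (cov_ip ip_inner mu_sphere _ _ sf).
by apply: avg_ge0 => x _; rewrite -expr2 sqr_ge0.
Qed.

Lemma cov_sym f X Y : sphere_map ip f -> '[cov f X, Y] = '[cov f Y, X].
Proof.
move=> sf; rewrite !(cov_ip ip_inner mu_sphere _ _ sf).
by apply: eq_avg => x _; rewrite mulrC.
Qed.

Lemma cov_le f X Y : sphere_map ip f -> `|'[cov f X, Y]| <= `|X| * `|Y|.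
Proof.
move=> sf; rewrite (cov_ip ip_inner mu_sphere _ _ sf).
apply: (avg_norm_le mu_sphere).
  by apply: admissibleM; exact: admissible_sphere_map.
move=> x /(sphere_ip ip_inner) x1; have := sf.2 x x1 => /(norm1_ip ip_inner) f1.
rewrite normrM; apply: ler_pM => //.
  by apply: le_trans (cauchy_schwarz ip_inner _ _) _; rewrite f1 mul1r.
by apply: le_trans (cauchy_schwarz ip_inner _ _) _; rewrite f1 mul1r.
Qed.

Lemma covD f X Y : sphere_map ip f -> cov f (X + Y) = cov f X + cov f Y.
Proof.
move=> sf; apply: (ip_inj ip_inner) => Z.
have a (V : H) := admissible_sphere_map ip_inner V sf.
rewrite (ipDl ip_inner) !(cov_ip ip_inner mu_sphere _ _ sf).
rewrite -(avgD mu_sphere (admissibleM (a X) (a Z)) (admissibleM (a Y) (a Z))).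
by apply: eq_avg => x _; rewrite (ipDr ip_inner) mulrDl.
Qed.

(** The form of [id - cov f] is symmetric and coercive; the sign of [b] flips because the Newton
    operator is [cov f - id]. *)
Lemma coercive_solve f lam b : sphere_map ip f -> 0 < lam -> coercive f lam ->
  exists X, cov f X - X = b.
Proof.
move=> sf lam0 cf.
have [] := @lax_milgram R H (fun X Y => '[X, Y] - '[cov f X, Y])
  (fun Y => - '[b, Y]) lam `|b| 2 lam0.
- by move=> X Y; rewrite (ipC X) (cov_sym _ _ sf).
- by move=> X Y Z; rewrite (covD _ _ sf) !(ipDl ip_inner); ring.
- by move=> k X Z; rewrite (cov_scale ip_inner mu_sphere _ _ sf) !(ipZl ip_inner); ring.
- by move=> X; rewrite -ipxx; exact: cf.
- move=> X Y; apply: le_trans (ler_normB _ _) _.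
  have := cauchy_schwarz ip_inner X Y; have := cov_le X Y sf; lra.
- by move=> X Y; rewrite (ipDr ip_inner); ring.
- by move=> k X; rewrite (ipZr ip_inner); ring.
- by move=> X; rewrite normrN; exact: cauchy_schwarz.
move=> X hX; exists X; apply: (ip_inj ip_inner) => Y.
by have := hX Y; rewrite (ipDl ip_inner) (ipNl ip_inner); lra.
Qed.

Lemma coercive_inj f lam : sphere_map ip f -> 0 < lam -> coercive f lam ->
  injective (fun X => cov f X - X).
Proof.
move=> sf lam0 cf X Y /= e; apply/eqP; rewrite -subr_eq0; apply/eqP.
apply: (ip_eq0 ip_inner); apply/eqP; rewrite eq_le (ip_ge0 ip_inner) andbT.
rewrite -(pmulr_rle0 _ lam0); apply: le_trans (cf _) _.
have -> : cov f (X - Y) = cov f X - cov f Y.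
  by rewrite -(scaleN1r Y) (covD _ _ sf) (cov_scale ip_inner mu_sphere _ _ sf) scaleN1r.
have -> : cov f X = cov f Y - Y + X by rewrite -e subrK.
by move: (cov f Y) => C; rewrite !ipE (ipC Y X); lra.
Qed.

Lemma op_inverseP (A : H -> H) : injective A -> (forall b, exists X, A X = b) ->
  bijective A /\ forall b, A (op_inverse A b) = b.
Proof.
move=> inj sur; have h b : A (op_inverse A b) = b.
  exact: (@xgetPex _ 0 [set X | A X = b] (sur b)).
by split=> //; exists (op_inverse A) => // X; apply: inj.
Qed.

Lemma coercive_le f lam lam' : lam' <= lam -> coercive f lam -> coercive f lam'.
Proof.
move=> h cf X; apply: le_trans (cf X).
by rewrite ler_wpM2r// (ip_ge0 ip_inner).
Qed.

Lemma lambda_min_coercive w : '[w, w] < 1 -> 0 < lambda_min ip mu w ->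
  coercive (sigma w) (lambda_min ip mu w) /\ lambda_min ip mu w <= 1.
Proof.
move=> w1 lam0; have sw := sphere_map_sigma ip_inner w1.
have w0 : 0 < 1 - '[w, w] by rewrite subr_gt0.
set V := [set metric ip w (- nablaF ip mu w X) X | X in [set X | metric_norm ip w X = 1]].
have VE X : metric ip w (- nablaF ip mu w X) X =
    4 / (1 - '[w, w]) ^+ 2 * ('[X, X] - '[cov (sigma w) X, X]).
  rewrite (metricE ip_inner) (nablaFE ip_inner mu_sphere _ w1).
  by move: (cov _ X) => C; rewrite !ipE; ring.
have c0 : 0 < 4 / (1 - '[w, w]) ^+ 2 by rewrite divr_gt0// exprn_gt0.
have lbV : has_lbound V.
  exists 0 => _ [X _ <-]; rewrite VE mulr_ge0 ?(ltW c0)// subr_ge0.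
  apply: le_trans (ler_norm _) _; apply: le_trans (cov_le X X sw) _.
  by rewrite ipxx expr2.
have scal X : X != 0 -> lambda_min ip mu w * '[X, X] <= '[X, X] - '[cov (sigma w) X, X].
  move=> X0; have nX : 0 < `|X| by rewrite normr_gt0.
  (* Rescales [X] to unit Riemannian length, as the infimum requires. *)
  pose k := (1 - '[w, w]) / (2 * `|X|).
  have k0 : 0 < k by rewrite divr_gt0// mulr_gt0.
  have : lambda_min ip mu w <= metric ip w (- nablaF ip mu w (k *: X)) (k *: X).
    apply: ge_inf => //; exists (k *: X) => //=.
    rewrite (metric_normE ip_inner)// normrZ gtr0_norm// /k.
    by field; rewrite !gt_eqF.
  rewrite VE (cov_scale ip_inner mu_sphere _ _ sw) !ipE => h.
  have kk : 4 / (1 - '[w, w]) ^+ 2 * (k * k) = '[X, X]^-1.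
    by rewrite (ipxx X) /k; field; rewrite !gt_eqF.
  rewrite -ler_pdivlMr; last by rewrite (ipxx X) exprn_gt0.
  by rewrite -kk; apply: le_trans h _; rewrite le_eqVlt; apply/orP; left; apply/eqP; ring.
split.
  move=> X; have [->|X0] := eqVneq X 0; last exact: scal.
  by rewrite !ipE mulr0 subrr.
(* [cov] is positive semidefinite, so the bound at any unit vector gives [lambda_min <= 1]. *)
have [x /(sphere_ip ip_inner) x1] := sphere_nonempty mu_sphere.
have x0 : x != 0.
  by apply/eqP => x0; move: x1; rewrite x0 !ipE => /eqP; rewrite eq_sym oner_eq0.
have := scal x x0; have := cov_ge0 x sw; rewrite x1; lra.
Qed.

Section Step.
Variables (w e : H) (s lam : R).
Hypotheses (w1 : '[w, w] < 1) (e1 : '[e, e] = 1) (s0 : 0 <= s).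
Hypotheses (lam0 : 0 < lam) (lam1 : lam <= 1) (cw : coercive (sigma w) lam).
Hypothesis newton_eq : s *: e - cov (sigma w) (s *: e) = mean (sigma w).
Let z : H := tanh2 s *: e.
Let w' := sigma (- w) z.
Let sw := sphere_map_sigma ip_inner w1.
Let z1 : '[z, z] < 1. Proof. exact: tanh2_sqr_lt1. Qed.

Lemma step_ball : '[w', w'] < 1.
Proof. by apply: (sigma_ball ip_inner) => //; rewrite ipNN. Qed.
Let sw' := sphere_map_sigma ip_inner step_ball.
Let sg : sphere_map ip (fun x => sigma z (sigma w x)).
Proof. by apply: sphere_map_comp => //; exact: sphere_map_sigma. Qed.

Lemma step_coshdist : coshdist ip w w' = cosh s.
Proof. by rewrite coshdist_sigma// cosh_tanh2 /z !ipE e1 mulr1 -expr2. Qed.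

Lemma step_length : lam * s <= `|mean (sigma w)|.
Proof.
have [->|sn0] := eqVneq s 0; first by rewrite mulr0.
have sp : 0 < s by rewrite lt_def sn0.
have := cw (s *: e); rewrite -(ipNl ip_inner) -(ipDl ip_inner) newton_eq !(ipZl ip_inner) !(ipZr ip_inner) e1 => h.
have : '[mean (sigma w), e] <= `|mean (sigma w)|.
  by apply: le_trans (ip_le ip_inner _ _) _; rewrite (norm1_ip ip_inner e1) mulr1.
apply: le_trans; rewrite -(ler_pM2l sp); apply: le_trans h.
by rewrite mulr1; rewrite le_eqVlt; apply/orP; left; apply/eqP; ring.
Qed.

Let gram x x' : sphere x -> sphere x' ->
  '[sigma w' x, sigma w' x'] = '[sigma z (sigma w x), sigma z (sigma w x')].
Proof. by move=> /(sphere_ip ip_inner) ? /(sphere_ip ip_inner) ?; exact: ip_sigma_comp. Qed.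

Lemma step_mean : `|mean (sigma w')| <= s ^+ 2 / 2.
Proof.
rewrite (gram_mean ip_inner mu_sphere (vadmissible_sphere_map ip_inner sw')
  (vadmissible_sphere_map ip_inner sg) gram).
apply: (norm_le_ip ip_inner); first by rewrite divr_ge0// sqr_ge0.
set G := hintegral _ _ _.
rewrite {1}/G (mean_ip ip_inner mu_sphere G sg).
have a (V : H) := admissible_sphere_map ip_inner V sw.
have ag := admissible_sphere_map ip_inner G sg.
have aM := admissibleZ s (admissibleM (a e) (a G)).
have aL := admissibleD (admissibleB (a G) (admissible_cst (s * '[e, G]))) aM.
pose r x := sigma z (sigma w x) - sigma w x + s *: (e - '[sigma w x, e] *: sigma w x).
(* The Newton equation makes the first-order part of the new mean vanish; only the Taylor remainder
   of the boost survives. *)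
have linear_part : avg (fun x => '[sigma w x, G] - s * '[e, G]
    + s * ('[sigma w x, e] * '[sigma w x, G])) = 0.
  rewrite (avgD mu_sphere (admissibleB (a G) (admissible_cst _)) aM).
  rewrite (avgB mu_sphere (a G) (admissible_cst _)) (avg_cst mu_sphere).
  rewrite (avgZ mu_sphere _ (admissibleM (a e) (a G))).
  rewrite -(mean_ip ip_inner mu_sphere G sw) -(cov_ip ip_inner mu_sphere e G sw).
  rewrite -newton_eq (cov_scale ip_inner mu_sphere _ _ sw).
  by move: (cov _ e) => C; rewrite !ipE; ring.
have ar : admissible (fun x => '[r x, G]).
  rewrite (_ : (fun x => _) = (fun x => '[sigma z (sigma w x), G] - ('[sigma w x, G] - s * '[e, G]
    + s * ('[sigma w x, e] * '[sigma w x, G])))); first exact: admissibleB.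
  apply/funext => x; rewrite /r; move: (sigma z (sigma w x)) (sigma w x) => u v.
  by rewrite !ipE; ring.
have -> : avg (fun x => '[sigma z (sigma w x), G]) = avg (fun x => '[r x, G]).
  rewrite -[RHS]addr0 -linear_part -(avgD mu_sphere ar aL).
  apply: eq_avg => x _; rewrite /r; move: (sigma z (sigma w x)) (sigma w x) => u v.
  by rewrite !ipE; ring.
apply: (avg_le mu_sphere) => // x /(sphere_ip ip_inner) x1.
apply: le_trans (ip_le ip_inner _ _) _; rewrite ler_wpM2r//.
exact: (boost_taylor ip_inner e1 (sigma_sphere ip_inner w1 x1) s0).
Qed.

Lemma step_coercive : coercive (sigma w') (lam - s).
Proof.
have L0 : 0 <= 1 - lam + s by have := lam1; have := s0; lra.
suff h X : '[cov (sigma w') X, X] <= (1 - lam + s) * '[X, X].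
  by move=> X; have := h X; lra.
rewrite (cov_ip ip_inner mu_sphere _ _ sw').
apply: (gram_frame_bound ip_inner mu_sphere L0 (vadmissible_sphere_map ip_inner sw')
  (vadmissible_sphere_map ip_inner sg) gram) => Y.
have a := admissible_sphere_map ip_inner Y sw.
have ag := admissible_sphere_map ip_inner Y sg.
apply: le_trans (_ : avg (fun x => '[sigma w x, Y] * '[sigma w x, Y] + s * '[Y, Y]) <= _).
  apply: (ler_avg mu_sphere).
  - exact: admissibleM.
  - by apply: admissibleD; [exact: admissibleM|exact: admissible_cst].
  move=> x /(sphere_ip ip_inner) x1; rewrite -!expr2.
  exact: (boost_sqr_le ip_inner e1 (sigma_sphere ip_inner w1 x1) Y s0).
rewrite (avgD mu_sphere (admissibleM a a) (admissible_cst _)) (avg_cst mu_sphere).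
rewrite -(cov_ip ip_inner mu_sphere _ _ sw).
have := cw Y; lra.
Qed.

End Step.
End Coercivity.
End NewtonStep.

(** * Shifted measures, and the common form of the two schemes *)

Section NewtonIteration.
Context {R : realType} {H : completeNormedModType R} (ip : H -> H -> R).
Hypothesis ip_inner : inner_product ip.
Notation sigma := (sigma ip).
Notation "''[' x , y ]" := (ip x y) (format "''[' x ,  y ]").
Let ipE := (ipDl ip_inner, ipDr ip_inner, ipNl ip_inner, ipNr ip_inner,
  ipZl ip_inner, ipZr ip_inner, ip0l ip_inner, ip0r ip_inner).
Variable mu : probability (borel H) R.
Hypothesis mu_sphere : mu sphere = 1%E.
Notation mean := (mean ip).
Notation cov := (cov ip).

Lemma preimage_sigma_sphere w : '[w, w] < 1 -> sigma w @^-1` sphere = sphere.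
Proof.
move=> w1; apply/seteqP; split => z /= /(sphere_ip ip_inner) h;
  apply/(sphere_ip ip_inner); last exact: sigma_sphere.
(* The preimage is taken in all of [H]. At the pole the inverse of zero is zero, so [sigma w z = 0]
   is off the sphere; elsewhere [one_sub_sigma] decides. *)
have [d0|d0] := eqVneq (sigma_den ip w z) 0.
  move: h; rewrite (sigmaE ip_inner) d0 invr0 scale0r !ipE => /eqP.
  by rewrite eq_sym oner_eq0.
have /eqP := one_sub_sigma ip_inner d0.
rewrite h subrr eq_sym mulf_eq0 invr_eq0 (negbTE d0) orbF mulf_eq0 !subr_eq0.
by rewrite gt_eqF//= => /eqP.
Qed.

Lemma shifted_probability w : exists nu : probability (borel H) R,
  (nu : set (borel H) -> \bar R) = shifted_measure ip mu w.
Proof.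
pose X : {mfun borel H >-> borel H} := MeasurableFun.Pack
  (MeasurableFun.Class (isMeasurableFun.Build _ _ _ _ _ (measurable_sigma ip_inner w))).
by exists (distribution mu X).
Qed.

Section Shifted.
Variables (w : H) (nu : probability (borel H) R).
Hypotheses (w1 : '[w, w] < 1).
Hypothesis nuE : (nu : set (borel H) -> \bar R) = shifted_measure ip mu w.

Lemma shifted_sphere : nu sphere = 1%E.
Proof.
transitivity (shifted_measure ip mu w sphere); first by rewrite -nuE.
by rewrite /shifted_measure /pushforward preimage_sigma_sphere.
Qed.

Lemma integral_shifted (phi : H -> R) :
  measurable_fun setT (phi : borel H -> R) -> admissible (fun x => phi (sigma w x)) ->
  (\int[shifted_measure ip mu w]_(x in sphere) (phi x)%:E =
   \int[mu]_(x in sphere) (phi (sigma w x))%:E)%E.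
Proof.
move=> mphi aphi.
have := @integral_pushforward _ _ _ _ R (sigma w : borel H -> borel H)
  (measurable_sigma ip_inner w) mu sphere (EFin \o phi).
rewrite preimage_sigma_sphere//; apply.
- exact/measurable_EFinP.
- exact: admissible_integrable.
- exact: measurable_sphere.
Qed.

Lemma avg_shifted (phi : H -> R) :
  measurable_fun setT (phi : borel H -> R) -> admissible (fun x => phi (sigma w x)) ->
  avg nu phi = avg mu (fun x => phi (sigma w x)).
Proof.
move=> mphi aphi; rewrite /avg /Rintegral; congr fine.
by rewrite -integral_shifted// -nuE.
Qed.

Let sw := sphere_map_sigma ip_inner w1.

Lemma measurable_ipl (y : H) : measurable_fun setT ((fun x => '[x, y]) : borel H -> R).
Proof.
by apply: measurable_borel_continuous; [exact: norm_hausdorff|exact: continuous_ipl].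
Qed.

Lemma mean_shifted : mean nu id = mean mu (sigma w).
Proof.
apply: (ip_inj ip_inner) => y.
rewrite (mean_ip ip_inner shifted_sphere y (sphere_map_id ip)).
rewrite (mean_ip ip_inner mu_sphere y sw).
by apply: avg_shifted; [exact: measurable_ipl|exact: admissible_sphere_map].
Qed.

Lemma cov_shifted X : cov nu id X = cov mu (sigma w) X.
Proof.
apply: (ip_inj ip_inner) => y.
rewrite (cov_ip ip_inner shifted_sphere X y (sphere_map_id ip)).
rewrite (cov_ip ip_inner mu_sphere X y sw).
apply: (@avg_shifted (fun x => '[x, X] * '[x, y])).
  by apply: measurable_funM; exact: measurable_ipl.
by apply: admissibleM; exact: admissible_sphere_map.
Qed.

End Shifted.

Lemma ip00 : '[0, 0] < 1. Proof. by rewrite !ipE. Qed.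

Lemma newton_operatorE (s : newton_scheme) w : '[w, w] < 1 ->
  newton_operator ip s mu w = (fun X => cov mu (sigma w) X - X).
Proof.
move=> w1; apply/funext => X; case: s => /=; first exact: nablaFE.
have [nu nuE] := shifted_probability w; rewrite -nuE.
rewrite (nablaFE ip_inner (shifted_sphere w1 nuE) X ip00).
have -> : sigma 0 = id by apply/funext => x; exact: sigma0l.
by rewrite (cov_shifted w1 nuE).
Qed.

Lemma newton_step_polar (sch : newton_scheme) w lam : '[w, w] < 1 ->
  0 < lam -> coercive ip mu (sigma w) lam ->
  exists s e, [/\ 0 <= s, '[e, e] = 1,
    s *: e - cov mu (sigma w) (s *: e) = mean mu (sigma w) &
    newton_step ip sch mu w = sigma (- w) (tanh2 s *: e)].
Proof.
move=> w1 lam0 cw; have sw := sphere_map_sigma ip_inner w1.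
have nontrivial := sphere_nonempty mu_sphere.
have w0 : 0 < 1 - '[w, w] by rewrite subr_gt0.
have inj := coercive_inj ip_inner mu_sphere sw lam0 cw.
have [_ inv] := op_inverseP inj (fun b => coercive_solve ip_inner mu_sphere b sw lam0 cw).
(* [k] is the ratio of [Fmu] to the mean: [(1 - |w|^2) / 2] at [w], and [2^-1] at the origin for the
   shifted measure. Division by [k] turns the norm [n] of the update into its Riemannian length. *)
have key (k : R) (e : H) (n : R) : k != 0 ->
    - op_inverse (fun X => cov mu (sigma w) X - X) (k *: mean mu (sigma w)) = n *: e ->
    (n / k) *: e - cov mu (sigma w) ((n / k) *: e) = mean mu (sigma w).
  move=> k0; have := inv (k *: mean mu (sigma w)); set u := op_inverse _ _ => hu ue.
  have -> : (n / k) *: e = (- k^-1) *: u.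
    by rewrite mulrC -scalerA -ue scalerN scaleNr.
  rewrite (cov_scale ip_inner mu_sphere _ _ sw) -scalerBr.
  have -> : u - cov mu (sigma w) u = - (k *: mean mu (sigma w)) by rewrite -hu opprB.
  by rewrite scaleNr scalerN opprK scalerA mulVf// scale1r.
case: sch.
  have [e [e1 ve] vE] := expmapE ip_inner nontrivial
    (- op_inverse (newton_operator ip Newton mu w) (Fmu ip mu w)) w1.
  exists (metric_norm ip w (- op_inverse (newton_operator ip Newton mu w) (Fmu ip mu w))), e.
  split => //; first exact: sqrtr_ge0.
  have k0 : (1 - '[w, w]) / 2 != 0 by rewrite mulf_neq0// ?gt_eqF// invr_gt0.
  rewrite (metric_normE ip_inner)//.
  have -> (v : R) : 2 / (1 - '[w, w]) * v = v / ((1 - '[w, w]) / 2).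
    by field; rewrite gt_eqF.
  apply: key => //; rewrite -ve; congr (- _).
  by rewrite (newton_operatorE _ w1) (FmuE ip_inner mu_sphere w1).
have [nu nuE] := shifted_probability w.
have FE : Fmu ip (shifted_measure ip mu w) 0 = 2^-1 *: mean mu (sigma w).
  rewrite -nuE (FmuE ip_inner (shifted_sphere w1 nuE) ip00).
  have -> : sigma 0 = id by apply/funext => x; exact: sigma0l.
  by rewrite (mean_shifted w1 nuE) !ipE subr0 div1r.
set v := - op_inverse (newton_operator ip ShiftedNewton mu w) (2^-1 *: mean mu (sigma w)).
have [e [e1 ve] vE] := expmapE ip_inner nontrivial v ip00.
exists (metric_norm ip 0 v), e; split => //; first exact: sqrtr_ge0.
  rewrite (metric_normE ip_inner _ ip00) !ipE subr0 divr1 mulrC -{1}(invrK 2).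
  rewrite -{2}(invrK 2); apply: key; first by rewrite invr_eq0 pnatr_eq0.
  by rewrite -ve /v (newton_operatorE _ w1).
by rewrite /= FE -/(newton_operator ip ShiftedNewton mu w) -/v vE oppr0 (sigma0l ip_inner).
Qed.

End NewtonIteration.

(** * Quadratic convergence of the iterates *)

Section Convergence.
Context {R : realType} {H : completeNormedModType R} (ip : H -> H -> R).
Hypothesis ip_inner : inner_product ip.
Notation sigma := (sigma ip).
Notation "''[' x , y ]" := (ip x y) (format "''[' x ,  y ]").
Variable mu : probability (borel H) R.
Hypothesis mu_sphere : mu sphere = 1%E.
Notation mean := (mean ip mu).
Variables (sch : newton_scheme) (w0 : H) (lam q : R).
Hypotheses (w01 : '[w0, w0] < 1) (lam0 : 0 < lam) (lam1 : lam <= 1).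
Hypotheses (q0 : 0 <= q) (q1 : q < 1).
Hypothesis cw0 : coercive ip mu (sigma w0) lam.
Hypothesis mean_w0 : `|mean (sigma w0)| <= lam ^+ 2 * (q / 4).
Notation w := (newton_iterate ip sch mu w0).

Let eps k : R := (q / 4) ^+ (2 ^ k)%N.
(* By [eps (k+1) = (eps k)^2 <= eps k / 4], the number [4/3 * eps k] bounds the
   sum of all [eps j] with [j >= k]. *)
Let tail k : R := 4 / 3 * eps k.
(** Coercivity left at step [k]: each step costs at most its length, and the lengths before [k] sum
    to at most [lam * (tail 0 - tail k)]. Since [tail 0 <= 1 / 3], at least [2 / 3 * lam]
    remains. *)
Let lamk k : R := lam * (1 - (tail 0 - tail k)).

Let epsS k : eps k.+1 = eps k ^+ 2.
Proof. by rewrite /eps expnSr exprM. Qed.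

Let eps_bound k : 0 <= eps k <= 1 / 4.
Proof.
elim: k => [|k /andP[h0 h1]].
  by rewrite /eps expn0 expr1; have := q0; have := q1; lra.
by rewrite epsS sqr_ge0 /=; nra.
Qed.

Let tail_step k : eps k + tail k.+1 <= tail k.
Proof. by rewrite /tail epsS; have /andP[] := eps_bound k; nra. Qed.

Let lamk_ge k : 2 / 3 * lam <= lamk k.
Proof.
rewrite /lamk /tail; have /andP[] := eps_bound k; have /andP[] := eps_bound 0.
have := lam0; nra.
Qed.

Let lamk_le k : lamk k <= 1.
Proof.
have mono j : tail j <= tail 0.
  elim: j => // j; apply: le_trans; apply: le_trans (tail_step j).
  by rewrite lerDr; case/andP: (eps_bound j).
apply: le_trans lam1; rewrite /lamk; have := mono k; have := lam0; nra.
Qed.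

(** The mean bound is stated as [lamk k] times the intended step length, so that [step_length]
    divides it out. *)
Let invariant k : [/\ '[w k, w k] < 1, coercive ip mu (sigma (w k)) (lamk k),
  `|mean (sigma (w k))| <= lamk k * (lam * eps k) &
  '[w k.+1, w k.+1] < 1 /\ coshdist ip (w k) (w k.+1) <= cosh (lam * eps k)].
Proof.
have step j : '[w j, w j] < 1 -> coercive ip mu (sigma (w j)) (lamk j) ->
  `|mean (sigma (w j))| <= lamk j * (lam * eps j) ->
  [/\ '[w j.+1, w j.+1] < 1, coshdist ip (w j) (w j.+1) <= cosh (lam * eps j),
    coercive ip mu (sigma (w j.+1)) (lamk j.+1) &
    `|mean (sigma (w j.+1))| <= lamk j.+1 * (lam * eps j.+1)].
  move=> wj cj mj; have lj0 : 0 < lamk j.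
    by apply: lt_le_trans (lamk_ge j); have := lam0; lra.
  have [s [e [s0 e1 eq we]]] := newton_step_polar ip_inner mu_sphere sch wj lj0 cj.
  have {}we : w j.+1 = sigma (- w j) (tanh2 s *: e) by rewrite -we.
  have sl : s <= lam * eps j.
    rewrite -(ler_pM2l lj0); apply: le_trans mj.
    exact: (step_length ip_inner e1 s0 cj eq).
  rewrite we; split.
  - exact: (step_ball ip_inner s wj e1).
  - by rewrite (step_coshdist ip_inner s wj e1); exact: ler_cosh.
  - apply: (coercive_le ip_inner _ (step_coercive ip_inner mu_sphere wj e1 s0 (lamk_le j) cj)).
    rewrite /lamk; have := tail_step j; have := lam0; nra.
  apply: le_trans (step_mean ip_inner mu_sphere wj e1 s0 eq) _.
  have h := lamk_ge j.+1; have /andP[h0 _] := eps_bound j.+1.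
  (* The new mean is at most [s^2 / 2 <= lam^2 * eps j.+1 / 2], and [1 / 2 <= 2 / 3]. *)
  apply: (@le_trans _ _ (2 / 3 * lam * (lam * eps j.+1))).
    rewrite epsS in h0 *; have := lam0; nra.
  by rewrite ler_wpM2r// mulr_ge0// ltW.
have [a b c] : [/\ '[w k, w k] < 1, coercive ip mu (sigma (w k)) (lamk k) &
    `|mean (sigma (w k))| <= lamk k * (lam * eps k)].
  elim: k => [|k [a b c]]; last by have [] := step k a b c.
  rewrite /lamk subrr subr0 mulr1; split=> //.
  apply: le_trans mean_w0 _; rewrite /eps expn0 expr1.
  by rewrite le_eqVlt; apply/orP; left; apply/eqP; ring.
by split=> //; have [] := step k a b c.
Qed.

Lemma iterate_ball k : '[w k, w k] < 1. Proof. by case: (invariant k). Qed.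

Lemma iterate_bijective k : bijective (newton_operator ip sch mu (w k)).
Proof.
have [a b _ _] := invariant k.
have l0 : 0 < lamk k by apply: lt_le_trans (lamk_ge k); have := lam0; lra.
have sw := sphere_map_sigma ip_inner a.
rewrite (newton_operatorE ip_inner mu_sphere)//.
exact: (op_inverseP (coercive_inj ip_inner mu_sphere sw l0 b)
  (fun y => coercive_solve ip_inner mu_sphere y sw l0 b)).1.
Qed.

Let tail_ge0 k : 0 <= tail k.
Proof. by rewrite mulr_ge0//; case/andP: (eps_bound k). Qed.

Let iterate_coshdist k n : 0 <= tail k - tail (k + n)%N /\
  coshdist ip (w k) (w (k + n)%N) <= cosh (lam * (tail k - tail (k + n)%N)).
Proof.
elim: n => [|n [h0 IH]]; first by rewrite addn0 subrr mulr0 cosh0 coshdistxx.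
have [_ _ _ [_ st]] := invariant (k + n)%N; have ts := tail_step (k + n)%N.
have /andP[e0 _] := eps_bound (k + n)%N; rewrite addnS; split; first by lra.
have l0 := ltW lam0.
apply: le_trans (coshdist_triangle ip_inner (iterate_ball k) (iterate_ball _)
  (iterate_ball _) (mulr_ge0 l0 h0) (mulr_ge0 l0 e0) IH st) _.
apply: ler_cosh; first by rewrite -mulrDr mulr_ge0// addr_ge0.
by rewrite -mulrDr ler_wpM2l//; lra.
Qed.

(** Bounds the remaining path length: the third is [4 / 3] from the geometric tail times [1 / 4], a
    bound for [4^-1 ^+ (2 ^ k)]. *)
Definition radius k : R := lam * (q ^+ (2 ^ k)%N / 3).

Lemma radius_ge0 k : 0 <= radius k.
Proof. by rewrite mulr_ge0 ?(ltW lam0)// divr_ge0// exprn_ge0. Qed.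

Let tail_radius k : lam * tail k <= radius k.
Proof.
rewrite /radius ler_wpM2l ?(ltW lam0)// /tail /eps exprMn.
have h : 4^-1 ^+ (2 ^ k)%N <= 4^-1 :> R.
  rewrite -[leRHS]expr1; apply: ler_wiXn2l; rewrite ?invr_ge0 ?invf_le1 ?ler1n//.
  by rewrite expn_gt0.
have := exprn_ge0 (2 ^ k)%N q0; nra.
Qed.

Lemma iterate_dist k j : (k <= j)%N ->
  coshdist ip (w k) (w j) <= cosh (radius k).
Proof.
move=> /subnKC <-; have [h0 h] := iterate_coshdist k (j - k)%N.
apply: le_trans h _; apply: ler_cosh; first by rewrite mulr_ge0// ltW.
apply: le_trans (tail_radius k); rewrite ler_wpM2l ?(ltW lam0)//.
by rewrite gerBl tail_ge0.
Qed.

Lemma cvg_qpow : q ^+ (2 ^ k)%N @[k --> \oo] --> (0 : R).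
Proof.
apply: (@squeeze_cvgr _ _ _ _ (fun=> 0) (fun k => q ^+ k)).
- near=> k; rewrite exprn_ge0//=; apply: ler_wiXn2l => //; first exact: ltW.
  exact/ltnW/ltn_expl.
- exact: cvg_cst.
by apply: cvg_expr; rewrite ger0_norm.
Unshelve. all: by end_near.
Qed.

Lemma cvg_radius : radius k @[k --> \oo] --> (0 : R).
Proof.
rewrite -[X in _ --> X](mulr0 lam); apply: cvgMl_tmp.
rewrite -[X in _ --> X](mul0r 3^-1); apply: cvgMr_tmp; exact: cvg_qpow.
Qed.

Lemma cvg_cosh_radius : cosh (radius k) @[k --> \oo] --> (1 : R).
Proof.
have c : {for (0 : R), continuous (@cosh R)}.
  have := is_derive_cosh (1 : R) 0; rewrite (_ : (fun u => cosh (1 * u)) = cosh).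
    by move=> [d _]; apply: differentiable_continuous; exact/derivable1_diffP.
  by apply/funext => u; rewrite mul1r.
rewrite -(@cosh0 R); exact: (cvg_comp _ _ cvg_radius c).
Qed.

Lemma cvg_coshdist (u : nat -> H) (a b : H) : '[a, a] < 1 -> '[b, b] < 1 ->
  u @ \oo --> b -> coshdist ip a (u n) @[n --> \oo] --> coshdist ip a b.
Proof.
move=> a1 b1 ub; rewrite /coshdist.
have cst (k : R) : (fun=> k) @ \oo --> k by exact: cvg_cst.
have d : (fun n => a - u n) @ \oo --> a - b by apply: cvgB => //; exact: cvg_cst.
apply: cvgD => //; apply: cvgM.
  by apply: cvgM => //; exact: (cvg_ip ip_inner).
apply: cvgV; first by rewrite mulf_neq0// subr_eq0 gt_eqF.
by apply: cvgM => //; apply: cvgB => //; exact: (cvg_ip ip_inner).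
Qed.

Lemma iterate_limit : exists ws : H,
  [/\ '[ws, ws] < 1, mean (sigma ws) = 0 &
      forall k, coshdist ip (w k) ws <= cosh (radius k)].
Proof.
have nontrivial := sphere_nonempty mu_sphere.
have cw : cvg (w @ \oo).
  apply: (@cvg_of_cauchy_bound _ _ (fun n => (cosh (radius n) - 1) / 2)).
    rewrite -[X in _ --> X](mul0r 2^-1) -(subrr 1); apply: cvgMr_tmp.
    by apply: cvgB; [exact: cvg_cosh_radius|exact: cvg_cst].
  move=> n m nm; rewrite -(ipxx ip_inner).
  apply: le_trans (coshdist_norm ip_inner (iterate_ball n) (iterate_ball m)) _.
  by rewrite ler_pM2r ?invr_gt0// lerD2r; exact: iterate_dist.
set ws := lim (w @ \oo) in cw; exists ws.
have wsE : w @ \oo --> ws by exact: cw.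
(* A limit in [H] of points of the ball could lie on the sphere. A uniform bound on the hyperbolic
   distance to [0] keeps [|w k|] away from one. *)
have ws1 : '[ws, ws] < 1.
  have [r0 [_ [_ [r00 e0 _ _ _]]]] := geodesic_between ip_inner nontrivial (ip00 ip_inner) w01.
  pose C := cosh (r0 + radius 0).
  have C1 : 1 <= C by exact: cosh_ge1.
  have hC k : '[w k, w k] <= 1 - 2 / (C + 1).
    have h : coshdist ip 0 (w k) <= C.
      apply: (coshdist_triangle ip_inner (ip00 ip_inner) w01 (iterate_ball k) r00
        (radius_ge0 0)); first by rewrite e0.
      exact: (iterate_dist (leq0n k)).
    move: h; rewrite (coshdist0 ip_inner (iterate_ball k)) => h.
    have p : 0 < 1 - '[w k, w k] by rewrite subr_gt0 iterate_ball.
    have {}h : 2 / (1 - '[w k, w k]) <= C + 1 by lra.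
    rewrite lerBrDl addrC -lerBrDl ler_pdivrMr; last by lra.
    by move: h; rewrite ler_pdivrMr// mulrC; lra.
  apply: le_lt_trans (_ : 1 - 2 / (C + 1) < 1); last first.
    by rewrite gtrBl divr_gt0//; lra.
  apply: (@ler_cvg_to nat \oo _ R (fun k => '[w k, w k]) (fun=> 1 - 2 / (C + 1))).
  - exact: (cvg_ip ip_inner).
  - exact: cvg_cst.
  - by near=> k; exact: hC.
have dist k : coshdist ip (w k) ws <= cosh (radius k).
  apply: (@ler_cvg_to nat \oo _ R (fun j => coshdist ip (w k) (w j)) (fun=> cosh (radius k))).
  - exact: (cvg_coshdist (iterate_ball k) ws1 wsE).
  - exact: cvg_cst.
  - by near=> j; apply: iterate_dist; near: j; exact: nbhs_infty_ge.
split=> //; apply/eqP; rewrite -normr_eq0 eq_le normr_ge0 andbT.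
(* The mean is 2-Lipschitz in the base point, and at [w k] it is itself at most [radius k]. *)
have bound k : `|mean (sigma ws)| <= 2 * radius k + radius k.
  have sk := sphere_map_sigma ip_inner (iterate_ball k).
  have ss := sphere_map_sigma ip_inner ws1.
  have d : `|mean (sigma ws) - mean (sigma (w k))| <= 2 * radius k.
    have C0 : 0 <= 2 * radius k by rewrite mulr_ge0// radius_ge0.
    set D := _ - _; apply: (norm_le_ip ip_inner) => //.
    have aS := admissible_sphere_map ip_inner D ss.
    have aK := admissible_sphere_map ip_inner D sk.
    rewrite {1}/D (ipDl ip_inner) (ipNl ip_inner) !(mean_ip ip_inner mu_sphere)//.
    rewrite -(avgB mu_sphere aS aK).
    apply: (avg_le mu_sphere); first exact: admissibleB.
    move=> x /(sphere_ip ip_inner) x1; rewrite -(ipNl ip_inner) -(ipDl ip_inner).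
    apply: le_trans (ip_le ip_inner _ _) _; rewrite ler_wpM2r//.
    apply: (sigma_lipschitz ip_inner nontrivial (iterate_ball k) ws1 x1) => //.
    exact: radius_ge0.
  rewrite -[mean (sigma ws)](subrK (mean (sigma (w k)))).
  apply: le_trans (ler_normD _ _) _; apply: lerD => //.
  have [_ _ m _] := invariant k; apply: le_trans m _.
  apply: le_trans (tail_radius k); have /andP[h0 _] := eps_bound k.
  apply: (@le_trans _ _ (lam * eps k)).
    by rewrite ler_piMl ?lamk_le// mulr_ge0// ltW.
  by rewrite ler_wpM2l ?(ltW lam0)// /tail; lra.
apply: (@ler_cvg_to nat \oo _ R (fun=> `|mean (sigma ws)|) (fun k => 2 * radius k + radius k)).
- exact: cvg_cst.
- rewrite -[X in _ --> X](addr0 0) -{1}(mulr0 2).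
  by apply: cvgD; [apply: cvgMl_tmp|]; exact: cvg_radius.
- by near=> k; exact: bound.
Unshelve. all: by end_near.
Qed.

End Convergence.

(** * Comparison of angle and chord *)

Section AngleChord.
Context {R : realType}.

Lemma cos_ge_quadratic (x : R) : 0 <= x -> 1 - x ^+ 2 / 2 <= cos x.
Proof.
move=> x0.
have d (t : R) : is_derive t (1 : R) (fun u => - cos u) (sin t).
  by apply: (is_derive_eq (is_deriveN (is_derive_cos t))); rewrite opprK.
have := @taylor2_le R (fun t => - cos t) sin cos x 1 x0 d
  (fun t => is_derive_sin t) (fun t => cos_le1 t).
rewrite cos0 sin0; lra.
Qed.

(** On this interval [cos t >= 1 - (3 / 4)^2 / 2 = 23 / 32 > 2 / 3]. *)
Lemma sin_ge_linear (x : R) : 0 <= x <= 3 / 4 -> 2 / 3 * x <= sin x.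
Proof.
move=> /andP[x0 x1].
have d (t : R) : is_derive t (1 : R) (fun u => (2 / 3) *: u - sin u) (2 / 3 - cos t).
  apply: (is_derive_eq (is_deriveB (is_deriveZ (2 / 3) (is_derive_id t (1 : R)))
    (is_derive_sin t))).
  by rewrite scale_mul mulr1.
have := @mvt_le R (fun t => (2 / 3) *: t - sin t) _ 0 x 0 x0 (fun t _ => d t).
rewrite !scale_mul mulr0 sin0 mul0r => h.
suff : 2 / 3 * x - sin x - (0 - 0) <= 0 by lra.
apply: h => t; rewrite in_itv /= => /andP[t0 tx].
by have := cos_ge_quadratic t0; nra.
Qed.

(** For unit vectors with inner product [x], the lower bound on [x] says that their chord is at most
    [c]. *)
Lemma acos_le_chord (x c : R) : 0 <= c <= 1 -> 1 - c ^+ 2 / 2 <= x <= 1 ->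
  acos x <= 3 / 2 * c.
Proof.
move=> /andP[c0 c1] /andP[xc x1].
have xb : -1 <= x <= 1 by rewrite x1 andbT; nra.
rewrite leNgt; apply/negP => lt.
have piR := @pi_ge2 R.
have A : acos x \in `[0, pi] by rewrite in_itv /= acos_ge0// acos_lepi.
have B : 3 / 2 * c \in `[0, pi] by rewrite in_itv /=; apply/andP; split; lra.
have h : cos (acos x) < cos (3 / 2 * c) by rewrite ltr_cos.
move: h; rewrite acosK; last by rewrite in_itv.
(* Half angle: [cos (3 c / 2) = 1 - 2 sin^2 (3 c / 4)], and [sin (3 c / 4) >= c / 2] gives at most
   [1 - c^2 / 2]. *)
have -> : 3 / 2 * c = (3 / 4 * c) *+ 2 by rewrite -[RHS]mulr_natl; field.
rewrite cos_mulr2n -[X in X - 1]mulr_natl.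
have := @sin_ge_linear (3 / 4 * c); have := cos2Dsin2 (3 / 4 * c).
move: (cos _) (sin _) => k l kl /(_ _)-hl.
have {}hl : 2 / 3 * (3 / 4 * c) <= l by apply: hl; lra.
by move=> h; nra.
Qed.

End AngleChord.

(** * Almost sure bounds control every p-norm of a probability *)

Section LnormBound.
Context d (T : measurableType d) (R : realType) (gamma : probability T R).
Import HBNNSimple.

(* No measurability of [g] is needed, since the integral is a supremum over
   simple functions below [g]. *)
Lemma integral_le_ae_bound (g : T -> \bar R) (K : R) : 0 <= K ->
  (forall x, 0 <= g x)%E -> (\forall x \ae gamma, g x <= K%:E)%E ->
  (\int[gamma]_x g x <= K%:E)%E.
Proof.
move=> K0 g0 gK; rewrite ge0_integralTE//; apply: ge_ereal_sup => _ [h /= hg <-].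
rewrite -integralT_nnsfun.
have : (\int[gamma]_x (cst K%:E x) = K%:E)%E.
  rewrite integral_cst//= [X in (_ * X)%E](_ : _ = 1%E) ?mule1//.
  exact: probability_setT.
move=> <-; apply: ae_ge0_le_integral => //.
- by move=> x _; rewrite lee_fin.
- exact/measurable_EFinP.
- by apply: filterS gK => x gx _; apply: le_trans (hg x) gx.
Qed.

Lemma Lnorm_le_ae_bound (f : T -> \bar R) (K : R) (p : \bar R) :
  0 <= K -> (1 <= p)%E -> (\forall x \ae gamma, `|f x| <= K%:E)%E ->
  ('N[gamma]_p[f] <= K%:E)%E.
Proof.
move=> K0 p1 fK; rewrite unlock; case: p p1 => [p| |//]; last first.
  move=> _; rewrite [X in (0 < X)%E](_ : _ = 1%E) ?lte01; last exact: probability_setT.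
  exact/ess_supP.
rewrite lee_fin => p1; have p0 : 0 < p by exact: lt_le_trans p1.
have h : (\int[gamma]_x (`|f x| `^ p) <= (K `^ p)%:E)%E.
  apply: integral_le_ae_bound; first exact: powR_ge0.
    by move=> x; exact: poweR_ge0.
  apply: filterS fK => x fx; rewrite -poweR_EFin.
  by apply: gt0_ler_poweR => //; [exact: ltW|rewrite in_itv /= abse_ge0 leey|rewrite in_itv /= lee_fin K0 leey].
have i0 : (0 <= \int[gamma]_x (`|f x| `^ p))%E.
  by apply: integral_ge0 => x _; exact: poweR_ge0.
apply: le_trans (_ : (((K `^ p)%:E) `^ p^-1)%E <= _)%E.
  by apply: gt0_ler_poweR => //; [rewrite invr_ge0 ltW|rewrite in_itv /= i0 leey|rewrite in_itv /= lee_fin powR_ge0 leey].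
by rewrite poweR_EFin -powRrM divff ?gt_eqF// powRr1.
Qed.

End LnormBound.

(** * Wasserstein distance between two shifts of the same measure *)

Section Wasserstein.
Context {R : realType} {H : completeNormedModType R} (ip : H -> H -> R).
Hypothesis ip_inner : inner_product ip.
Notation sigma := (sigma ip).
Notation "''[' x , y ]" := (ip x y) (format "''[' x ,  y ]").
Variable mu : probability (borel H) R.
Hypothesis mu_sphere : mu sphere = 1%E.

(* The product as a normed space, so that its pointed topology is inferred. *)
Let HH : normedModType R := (H * H)%type.

(** The target carries the Borel sets of the product topology, possibly more than the product
    sigma-algebra, so the pair is treated as one map continuous off two poles. *)
Lemma measurable_sigma_pair a b : measurable_fun setT
  ((fun x => (sigma a x, sigma b x)) : borel H -> borel (H * H)%type).
Proof.
apply: (@measurable_cofinite_continuous H HH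
  [set '[a, a]^-1 *: a; '[b, b]^-1 *: b]).
- exact: norm_hausdorff.
- exact: finite_set2.
move=> x /= /not_orP[xa xb]; apply: cvg_pair.
  exact: continuous_sigma.
exact: continuous_sigma.
Qed.

(** Unit vectors at chord at most [c], for [c >= 0], described by [ip] so that the set is visibly
    closed. *)
Let close_pairs (c : R) : set (H * H) :=
  [set yz | [/\ `|yz.1| = 1, `|yz.2| = 1 & 1 - c ^+ 2 / 2 <= '[yz.1, yz.2]]].

Let measurable_close_pairs c :
  measurable (close_pairs c : set (borel (H * H)%type)).
Proof.
apply: (@measurable_borel_closed HH).
have cf : continuous (fun yz : H * H => `|yz.1|).
  by move=> yz; apply: cvg_norm; exact: cvg_fst.
have cs : continuous (fun yz : H * H => `|yz.2|).
  by move=> yz; apply: cvg_norm; exact: cvg_snd.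
have ci : continuous (fun yz : H * H => '[yz.1, yz.2]).
  by move=> yz; apply: (cvg_ip ip_inner); [exact: cvg_fst|exact: cvg_snd].
rewrite (_ : close_pairs c = ((fun yz : H * H => `|yz.1|) @^-1` [set t | t = 1]
  `&` (fun yz : H * H => `|yz.2|) @^-1` [set t | t = 1])
  `&` (fun yz : H * H => '[yz.1, yz.2]) @^-1` [set t | 1 - c ^+ 2 / 2 <= t]).
  by apply: closedI; [apply: closedI|]; apply: preimage_closed;
    [|exact: closed_eq| |exact: closed_eq| |exact: closed_ge] => yz _;
    [exact: cf|exact: cs|exact: ci].
by apply/seteqP; split=> yz /=; [case|move=> [[]]].
Qed.

Lemma wasserstein_le (a b : H) (r : R) (p : \bar R) : '[a, a] < 1 -> '[b, b] < 1 ->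
  0 <= r <= 1 / 3 -> coshdist ip a b <= cosh r -> (1 <= p)%E ->
  (wasserstein ip p (shifted_measure ip mu a) (shifted_measure ip mu b)
    <= (3 * r)%:E)%E.
Proof.
move=> a1 b1 /andP[r0 r1] hr p1.
pose X : {mfun borel H >-> borel (H * H)%type} := MeasurableFun.Pack
  (MeasurableFun.Class (isMeasurableFun.Build _ _ _ _ _ (measurable_sigma_pair a b))).
pose gamma : probability (borel (H * H)%type) R := distribution mu X.
apply: (@le_trans _ _ ('N[gamma]_p[angular_cost ip])%E).
  apply: ereal_inf_lbound; exists gamma => //.
apply: Lnorm_le_ae_bound => //; first by rewrite mulr_ge0.
pose c := 2 * r.
(* The image of the sphere lies in [close_pairs c], so the complement is null for the coupling; on
   [close_pairs c] the angle is at most [3 / 2 * c = 3 * r]. One almost sure bound serves every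
   [p]. *)
exists (~` close_pairs c); split.
- by apply: measurableC; exact: measurable_close_pairs.
- have : (mu (X @^-1` (~` close_pairs c)) <= mu (~` sphere))%E.
    apply: le_measure; rewrite ?inE.
    + rewrite -[X in measurable X]setTI; apply: measurable_sigma_pair => //.
      by apply: measurableC; exact: measurable_close_pairs.
    + by apply: measurableC; exact: measurable_sphere.
    move=> x /= nx Sx; apply: nx.
    have x1 : '[x, x] = 1 by exact/(sphere_ip ip_inner).
    have sa := sigma_sphere ip_inner a1 x1; have sb := sigma_sphere ip_inner b1 x1.
    split; [exact: (norm1_ip ip_inner)|exact: (norm1_ip ip_inner)|].
    have nontrivial : exists x : H, `|x| = 1 by exists x.
    have /= := sigma_lipschitz ip_inner nontrivial a1 b1 x1 r0 hr; rewrite -/c => h.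
    have h2 : `|sigma b x - sigma a x| ^+ 2 <= c ^+ 2.
      by rewrite ler_pXn2r ?nnegrE// mulr_ge0.
    move: h2; rewrite -(ipxx ip_inner); move: (sigma a x) (sigma b x) sa sb => y z y1 z1.
    rewrite (ipDl ip_inner) !(ipDr ip_inner) !(ipNl ip_inner) !(ipNr ip_inner).
    by rewrite y1 z1 (ipC ip_inner z y); lra.
  rewrite [X in (_ <= X)%E](_ : _ = 0%E); last first.
    rewrite probability_setC ?mu_sphere ?subee//; exact: measurable_sphere.
  by move=> h; apply/eqP; rewrite eq_le h /=; exact: measure_ge0.
move=> [y z] /= nyz [y1 z1 h]; apply: nyz; rewrite /angular_cost /angular_distance /=.
have yz1 : '[y, z] <= 1.
  by apply: le_trans (ip_le ip_inner _ _) _; rewrite y1 z1 mulr1.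
have yzN1 : -1 <= '[y, z].
  by apply: le_trans h; rewrite /c; nra.
rewrite lee_fin ger0_norm ?acos_ge0 ?yz1 ?yzN1//.
have -> : 3 * r = 3 / 2 * c by rewrite /c; field.
apply: acos_le_chord; last by rewrite h.
by rewrite /c; apply/andP; split; lra.
Qed.

Lemma wasserstein_ge0 p (mu1 mu2 : set (borel H) -> \bar R) :
  (0 <= wasserstein ip p mu1 mu2)%E.
Proof. by apply: le_ereal_inf_tmp => _ [g _ <-]; exact: Lnorm_ge0. Qed.

End Wasserstein.

(** * Assembly of the convergence theorem *)

Theorem theorem3p2 (R : realType) (H : completeNormedModType R)
    (ip : H -> H -> R) (ip_inner : inner_product ip)
    (mu : probability (borel H) R) (mu_sphere : mu sphere = 1%E)
    (w0 : H) (w0_ball : poincare_ball w0) (s : newton_scheme) :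
  let lambda := lambda_min ip mu w0 in
  let q := 4 * metric_norm ip w0 (Fmu ip mu w0) / lambda ^+ 2 in
  let w := newton_iterate ip s mu w0 in
  let mu_ := fun k => shifted_measure ip mu (w k) in
  0 < lambda ->
  q < 1 ->
  (forall k, poincare_ball (w k) /\ bijective (newton_operator ip s mu (w k))) /\
  exists ws : H,
    let mus := shifted_measure ip mu ws in
    [/\ conformal_barycenter ip mu ws,
        is_integral ip mus id 0,
        geodesic_distance ip (w k) ws @[k --> \oo] --> 0%E /\
        (forall p : \bar R, (1 <= p)%E ->
           wasserstein ip p (mu_ k) mus @[k --> \oo] --> 0%E),
        forall k, (geodesic_distance ip (w k) ws
                     <= (2^-1 * lambda * q ^+ (2 ^ k)%N)%:E)%E &
        forall (p : \bar R) (k : nat), (1 <= p)%E ->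
          (wasserstein ip p (mu_ k) mus <= (lambda * q ^+ (2 ^ k)%N)%:E)%E].
Proof.
move=> lambda q w mu_ lam0 q1.
have w01 : ip w0 w0 < 1 by exact/(ball_ip ip_inner).
have [cw0 lam1] := lambda_min_coercive ip_inner mu_sphere w01 lam0.
have mean_w0 : `|mean ip mu (sigma ip w0)| = lambda ^+ 2 * (q / 4).
  have -> : `|mean ip mu (sigma ip w0)| = metric_norm ip w0 (Fmu ip mu w0).
    have p0 : 0 < 1 - ip w0 w0 by rewrite subr_gt0.
    rewrite (metric_normE ip_inner)// (FmuE ip_inner mu_sphere w01) normrZ ger0_norm.
      by field; rewrite gt_eqF.
    by rewrite divr_ge0// ltW.
  by rewrite /q; field; rewrite gt_eqF.
have q0 : 0 <= q.
  by rewrite /q divr_ge0 ?sqr_ge0// mulr_ge0// sqrtr_ge0.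
have mean_le : `|mean ip mu (sigma ip w0)| <= lambda ^+ 2 * (q / 4) by rewrite mean_w0.
have wb := iterate_ball ip_inner mu_sphere s w01 lam0 lam1 q0 q1 cw0 mean_le.
split.
  move=> k; split; first exact/(ball_ip ip_inner)/wb.
  exact: (iterate_bijective ip_inner mu_sphere s w01 lam0 lam1 q0 q1 cw0 mean_le).
have [ws [ws1 ms dist]] :=
  iterate_limit ip_inner mu_sphere s w01 lam0 lam1 q0 q1 cw0 mean_le.
have nontrivial := sphere_nonempty mu_sphere.
have rad0 k := radius_ge0 lam0 q0 k.
have geo k : (geodesic_distance ip (w k) ws <= (radius lambda q k)%:E)%E.
  exact: (geodesic_distance_le ip_inner nontrivial (wb k) ws1 (rad0 k) (dist k)).
(* From [lambda <= 1] and [q < 1]; this keeps the chord bound [2 * radius] below one, where the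
   angle comparison holds. *)
have rad1 k : 0 <= radius lambda q k <= 1 / 3.
  rewrite rad0 /radius mulrA ler_pM2r ?invr_gt0//.
  have qk : q ^+ (2 ^ k)%N <= 1 by rewrite exprn_ile1// ltW.
  by rewrite mulr_ile1 ?exprn_ge0 ?(ltW lam0).
have was p k : (1 <= p)%E ->
    (wasserstein ip p (mu_ k) (shifted_measure ip mu ws) <= (3 * radius lambda q k)%:E)%E.
  exact: (wasserstein_le ip_inner mu_sphere (wb k) ws1 (rad1 k) (dist k)).
have cr := cvg_radius lambda q0 q1.
exists ws; split.
- split; first exact/(ball_ip ip_inner).
  by rewrite (FmuE ip_inner mu_sphere ws1) ms scaler0.
- move=> y.
  have sw := sphere_map_sigma ip_inner ws1.
  have a := admissible_sphere_map ip_inner y sw.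
  have -> := integral_shifted ip_inner mu_sphere ws1 (measurable_ipl ip_inner y) a.
  rewrite (avgE mu_sphere a) -(mean_ip ip_inner mu_sphere y sw) ms.
  by [].
- split.
    apply: (@squeeze_cvge _ _ _ _ (fun=> 0%E) _ (fun k => (radius lambda q k)%:E)).
    + by near=> k; rewrite geodesic_distance_ge0 geo.
    + exact: cvg_cst.
    + by apply: cvg_EFin => //; near=> k.
  move=> p p1.
  apply: (@squeeze_cvge _ _ _ _ (fun=> 0%E) _ (fun k => (3 * radius lambda q k)%:E)).
  + by near=> k; rewrite wasserstein_ge0 was.
  + exact: cvg_cst.
  + apply: cvg_EFin; first by near=> k.
    by rewrite -[X in _ --> X](mulr0 3); exact: cvgMl_tmp.
(* The radius has the factor [1 / 3], below the [1 / 2] claimed here; for the Wasserstein bound the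
   factor [3] uses it up exactly. *)
- move=> k; apply: le_trans (geo k) _; rewrite lee_fin /radius.
  by have := exprn_ge0 (2 ^ k)%N q0; have := lam0; nra.
move=> p k p1; apply: le_trans (was p k p1) _; rewrite lee_fin /radius.
by rewrite le_eqVlt; apply/orP; left; apply/eqP; field.
Unshelve. all: by end_near.
Qed.
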